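(* Let $X$ and $Y$ be objects of $\mathbf{cell}(\mathbf{Flow})$ and let $f:X\longrightarrow Y$ be a T-homotopy equivalence such that $Y^0=f(X^0)\sqcup\{\alpha\}$ for a single state $\alpha$. Then the canonical morphism $\varnothing\to X$ factors as a composite $\varnothing\to u_f(X)\to v_f(X)\to X$ such that: (1) there are a morphism $\{\widehat0,\widehat1\}={\rm Glob}(\mathbf{S}^{-1})\to u_f(X)$ such that $v_f(X)$ is the pushout of $u_f(X)\leftarrow{\rm Glob}(\mathbf{S}^{-1})\rightarrow{\rm Glob}(\mathbf{D}^0)=\vec I$ (with $u_f(X)\to v_f(X)$ the induced map), and, denoting by $\phi:\vec I\to\vec I*\vec I$ the unique morphism preserving the initial and final states and by $\widehat v_f(X)$ the pushout of $\vec I*\vec I\xleftarrow{\phi}\vec I\to v_f(X)$, the square formed by $v_f(X)\to X$, $v_f(X)\to\widehat v_f(X)$, $f:X\to Y$ and some morphism $\widehat v_f(X)\to Y$ is a pushout square (so $Y\cong X\sqcup_{v_f(X)}\widehat v_f(X)$); (2) the morphisms $\varnothing\to u_f(X)$ and $v_f(X)\to X$ are relative $I_g$-cell complexes.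
   Context: All spaces are compactly generated. A flow $X$ consists of a set $X^0$ of states, spaces $\mathbb{P}_{\alpha,\beta}X$ of execution paths from $\alpha$ to $\beta$, and continuous associative compositions $*:\mathbb{P}_{\alpha,\beta}X\times\mathbb{P}_{\beta,\gamma}X\to\mathbb{P}_{\alpha,\gamma}X$; morphisms are set maps on states with compatible continuous maps on path spaces; $\mathbb{P}X=\bigsqcup\mathbb{P}_{\alpha,\beta}X$, and for $x\in\mathbb{P}_{\alpha,\beta}X$, $s(x)=\alpha$, $t(x)=\beta$. Sets are flows with empty path space. ${\rm Glob}(Z)$: states $\widehat0,\widehat1$, $\mathbb{P}_{\widehat0,\widehat1}=Z$, other path spaces empty; $\vec I={\rm Glob}(\{0\})$. $\vec I*\vec I$ is the flow with three states $a<b<c$ and $\mathbb{P}_{a,b},\mathbb{P}_{b,c},\mathbb{P}_{a,c}$ singletons (others empty). $I^{gl}=\{{\rm Glob}(\mathbf{S}^{n-1})\subset{\rm Glob}(\mathbf{D}^n):n\ge0\}$, $I_g=I^{gl}\cup\{\varnothing\to\{0\}\}$, $I^{gl}_+=I_g\cup\{\{0,1\}\to\{0\}\}$; a relative $K$-cell complex is a transfinite composition of pushouts of elements of $K$; $\mathbf{cell}(\mathbf{Flow})$ is the full subcategory of flows $X$ with $\varnothing\to X$ a relative $I^{gl}_+$-cell complex. Branching space: $\mathbb{P}^-X$ is the quotient of $\mathbb{P}X$ by the equivalence relation generated by $x\sim x*y$ (whenever $t(x)=s(y)$), with quotient map $h^-$; $\mathbb{P}^-_\alpha X=h^-(\bigsqcup_\beta\mathbb{P}_{\alpha,\beta}X)$.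 Merging space: $\mathbb{P}^+X$ is the quotient of $\mathbb{P}X$ by the equivalence relation generated by $y\sim x*y$, with quotient map $h^+$; $\mathbb{P}^+_\alpha X=h^+(\bigsqcup_\beta\mathbb{P}_{\beta,\alpha}X)$. For $A,B\subset X^0$, $A$ is surrounded by $B$ if every $\alpha\in A$ is in $B$ or there are $\gamma_1,\gamma_2\in\mathbb{P}X$ with $s(\gamma_1)\in B$, $t(\gamma_1)=s(\gamma_2)=\alpha$, $t(\gamma_2)\in B$. For $A\subset X^0$, $X{\restriction}_A$ is the flow with states $A$ and path spaces $\mathbb{P}_{\alpha,\beta}X$ for $\alpha,\beta\in A$. A morphism $f:X\to Y$ between objects of $\mathbf{cell}(\mathbf{Flow})$ is a T-homotopy equivalence if (i) $f$ induces an isomorphism $X\to Y{\restriction}_{f(X^0)}$ (so $f^0$ is injective), (ii) for each $\alpha\in Y^0\setminus f(X^0)$, $\mathbb{P}^-_\alpha Y$ and $\mathbb{P}^+_\alpha Y$ are singletons, (iii) $Y^0$ is surrounded by $f(X^0)$. *)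

(* Defs.v *)
From HB Require Import structures.
From mathcomp Require Import all_boot all_algebra all_classical all_reals all_analysis.
From mathcomp Require Import Rstruct Rstruct_topology.
From Stdlib Require Import Rdefinitions Relation_Operators.

Set Implicit Arguments.
Unset Strict Implicit.
Unset Printing Implicit Defensive.

Local Open Scope classical_set_scope.
Local Open Scope ring_scope.

Definition test_space (K : topologicalType) : Prop :=
  compact [set: K] /\ hausdorff_space K.

Definition kspace (T : topologicalType) : Prop :=
  forall U : set T,
    (forall (K : topologicalType) (g : K -> T),
        test_space K -> continuous g -> open (g @^-1` U)) -> open U.

Definition weak_hausdorff (T : topologicalType) : Prop :=
  forall (K : topologicalType) (g : K -> T),
    test_space K -> continuous g -> closed (range g).

Definition cg_space (T : topologicalType) : Prop := kspace T /\ weak_hausdorff T.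

(* continuity of a binary map on the compactly generated product k(A x B):
   continuity of its composite with every compact-Hausdorff probe of A x B *)
Definition kcontinuous2 (A B C : topologicalType) (h : A -> B -> C) : Prop :=
  forall (K : topologicalType) (g : K -> (A * B)%type),
    test_space K -> continuous g -> continuous (fun k => h (g k).1 (g k).2).

Definition voidT : topologicalType := discrete_topology void.
Definition unitT : topologicalType := discrete_topology unit.

Lemma voidT_empty (x : voidT) : False. Proof. by case: x. Qed.

Lemma continuous_from_empty (A B : topologicalType) (f : A -> B) :
  (A -> False) -> continuous f.
Proof. by move=> h x; case: (h x). Qed.

Record flow := Flow {
  fst_ : Type;
  fP : fst_ -> fst_ -> topologicalType;
  fcomp : forall a b c, fP a b -> fP b c -> fP a c;
  fcompA : forall a b c d (x : fP a b) (y : fP b c) (z : fP c d),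
      fcomp (fcomp x y) z = fcomp x (fcomp y z);
  fcomp_cont : forall a b c, kcontinuous2 (@fcomp a b c) }.
Arguments fcomp {f a b c}.
Arguments fP : clear implicits.

Definition cg_flow (X : flow) : Prop := forall a b, cg_space (fP X a b).

Record mor (X Y : flow) := Mor {
  m0 : fst_ X -> fst_ Y;
  m1 : forall a b, fP X a b -> fP Y (m0 a) (m0 b);
  m1_cont : forall a b, continuous (@m1 a b);
  m1_comp : forall a b c (x : fP X a b) (y : fP X b c),
      m1 (fcomp x y) = fcomp (m1 x) (m1 y) }.
Arguments m0 {X Y}.
Arguments m1 {X Y} _ {a b}.

Definition Ptot (X : flow) := {p : fst_ X * fst_ X & fP X p.1 p.2}.
Definition psrc (X : flow) (u : Ptot X) : fst_ X := (projT1 u).1.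
Definition ptgt (X : flow) (u : Ptot X) : fst_ X := (projT1 u).2.
Definition pin (X : flow) (a b : fst_ X) (x : fP X a b) : Ptot X :=
  existT (fun p : fst_ X * fst_ X => fP X p.1 p.2) (a, b) x.

Definition meq (X Y : flow) (f g : mor X Y) : Prop :=
  (forall a, m0 f a = m0 g a) /\
  (forall a b (x : fP X a b), pin (m1 f x) = pin (m1 g x)).

Section MorOps.
Variables X Y Z : flow.

Definition mcomp (g : mor Y Z) (f : mor X Y) : mor X Z.
Proof.
refine (@Mor X Z (fun a => m0 g (m0 f a)) (fun a b x => m1 g (m1 f x)) _ _).
- move=> a b x; apply: continuous_comp; [exact: m1_cont | exact: m1_cont].
- by move=> a b c x y; rewrite !m1_comp.
Defined.
End MorOps.

Definition idmor (X : flow) : mor X X.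
Proof.
refine (@Mor X X (fun a => a) (fun a b x => x) _ _) => //.
by move=> a b x.
Defined.

Definition is_iso (X Y : flow) (f : mor X Y) : Prop :=
  exists g : mor Y X, meq (mcomp g f) (idmor X) /\ meq (mcomp f g) (idmor Y).

Definition is_pushout (A B C D : flow) (i : mor A B) (j : mor A C)
    (p : mor B D) (q : mor C D) : Prop :=
  [/\ cg_flow D, meq (mcomp p i) (mcomp q j) &
   forall Z : flow, cg_flow Z ->
   forall (p' : mor B Z) (q' : mor C Z), meq (mcomp p' i) (mcomp q' j) ->
   exists h : mor D Z,
     [/\ meq (mcomp h p) p', meq (mcomp h q) q' &
      forall h' : mor D Z, meq (mcomp h' p) p' -> meq (mcomp h' q) q' -> meq h' h]].

Definition is_colim (O : Type) (lt : O -> O -> Prop) (P : O -> Prop)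
    (X : O -> flow) (map : forall o1 o2, lt o1 o2 -> mor (X o1) (X o2))
    (L : flow) (c : forall o, P o -> mor (X o) L) : Prop :=
  [/\ cg_flow L,
   (forall o1 o2 (h : lt o1 o2) (p1 : P o1) (p2 : P o2),
       meq (mcomp (c o2 p2) (map o1 o2 h)) (c o1 p1)) &
   forall Z : flow, cg_flow Z ->
   forall c' : forall o, P o -> mor (X o) Z,
     (forall o1 o2 (h : lt o1 o2) (p1 : P o1) (p2 : P o2),
         meq (mcomp (c' o2 p2) (map o1 o2 h)) (c' o1 p1)) ->
     exists u : mor L Z,
       (forall o (p : P o), meq (mcomp u (c o p)) (c' o p)) /\
       forall u' : mor L Z,
         (forall o (p : P o), meq (mcomp u' (c o p)) (c' o p)) -> meq u' u].

Definition set_flow (S : Type) : flow.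
Proof.
refine (@Flow S (fun _ _ => voidT) (fun a b c x y => x) _ _).
- by move=> a b c d x; case: (voidT_empty x).
- move=> a b c K g _ _; apply: continuous_from_empty => k.
  exact: voidT_empty (g k).1.
Defined.

Definition set_mor (S T : Type) (h : S -> T) : mor (set_flow S) (set_flow T).
Proof.
refine (@Mor (set_flow S) (set_flow T) h (fun a b x => x) _ _) => //.
Defined.

Definition empty_flow : flow := set_flow void.

Definition empty_mor (X : flow) : mor empty_flow X.
Proof.
refine (@Mor empty_flow X (fun v => match v with end)
          (fun a b x => match a with end) _ _).
- by case.
- by case.
Defined.

(* Glob(Z): states 0^ = false, 1^ = true; P_{0^,1^} = Z, other path spaces empty *)
Definition glob_P (Z : topologicalType) (a b : bool) : topologicalType :=
  match a, b with false, true => Z | _, _ => voidT end.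

Definition glob_comp (Z : topologicalType) (a b c : bool) :
  glob_P Z a b -> glob_P Z b c -> glob_P Z a c.
Proof.
case: a; case: b => x y /=; solve [case: (voidT_empty x) | case: (voidT_empty y)].
Defined.

Lemma glob_no_compose (Z : topologicalType) (a b c : bool)
  (x : glob_P Z a b) (y : glob_P Z b c) : False.
Proof. by case: a b c x y => [] [] [] /= x y; apply: voidT_empty. Qed.

Definition glob (Z : topologicalType) : flow.
Proof.
refine (@Flow bool (glob_P Z) (@glob_comp Z) _ _).
- by move=> a b c d x y; case: (glob_no_compose x y).
- move=> a b c K g _ _; apply: continuous_from_empty => k.
  exact: glob_no_compose (g k).1 (g k).2.
Defined.

Definition glob_fun (Z Z' : topologicalType) (h : Z -> Z') (a b : bool) :
  glob_P Z a b -> glob_P Z' a b :=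
  match a as a', b as b' return glob_P Z a' b' -> glob_P Z' a' b' with
  | false, true => h
  | _, _ => fun x => x
  end.

Definition glob_mor (Z Z' : topologicalType) (h : Z -> Z') (hc : continuous h) :
  mor (glob Z) (glob Z').
Proof.
refine (@Mor (glob Z) (glob Z') (fun a => a) (glob_fun h) _ _).
- by case=> [] [] //= x.
- by move=> a b c x y; case: (glob_no_compose x y).
Defined.

Definition Dset (n : nat) : set 'rV[R]_n :=
  [set x | \sum_(i < n) x ord0 i ^+ 2 <= 1].
Arguments Dset : clear implicits.
Definition Disk (n : nat) : topologicalType := set_type (Dset n).
Definition Sset (n : nat) : set (Disk n) :=
  [set x : Disk n | \sum_(i < n) (@set_val _ (Dset n) x) ord0 i ^+ 2 = 1].
Arguments Sset : clear implicits.
(* Sphere n is S^{n-1}, a subspace of D^n; Sphere 0 = S^{-1} is empty *)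
Definition Sphere (n : nat) : topologicalType := set_type (Sset n).

Definition glob_incl (n : nat) : mor (glob (Sphere n)) (glob (Disk n)) :=
  @glob_mor (Sphere n) (Disk n) set_val (@initial_continuous _ (Disk n) (@set_val _ (Sset n))).

(* \vec I * \vec I : states a < b < c (0 < 1 < 2 in 'I_3), singleton path
   spaces P_{a,b}, P_{b,c}, P_{a,c}, all other path spaces empty *)
Definition II_P (i j : 'I_3) : topologicalType :=
  if ltn i j then unitT else voidT.

Lemma II_P_lt (i j : 'I_3) (x : II_P i j) : ltn i j.
Proof. by move: x; rewrite /II_P; case: (ltn i j) => // x; case: (voidT_empty x). Qed.

Definition II_comp (i j k : 'I_3) : II_P i j -> II_P j k -> II_P i k.
Proof.
move=> x y; have hik : ltn i k := ltn_trans (II_P_lt x) (II_P_lt y).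
by rewrite /II_P hik; exact: tt.
Defined.

Lemma II_P_sub (i j : 'I_3) (x y : II_P i j) : x = y.
Proof.
move: x y; rewrite /II_P; case: (ltn i j) => x y; first by case: x; case: y.
by case: (voidT_empty x).
Qed.

Definition IxI : flow.
Proof.
refine (@Flow 'I_3 II_P II_comp _ _).
- by move=> *; apply: II_P_sub.
- move=> i j k K g _ _ t.
  have hik : ltn i k := ltn_trans (II_P_lt (g t).1) (II_P_lt (g t).2).
  suff -> : (fun k0 => II_comp (g k0).1 (g k0).2) = cst (II_comp (g t).1 (g t).2).
    exact: cst_continuous.
  by apply: funext => ?; apply: II_P_sub.
Defined.

Definition morclass := forall A B : flow, mor A B -> Prop.

Inductive Ig : morclass :=
  | Ig_glob n : Ig (glob_incl n)
  | Ig_pt : Ig (set_mor (fun v : void => tt)).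

Inductive Iglp : morclass :=
  | Iglp_glob n : Iglp (glob_incl n)
  | Iglp_pt : Iglp (set_mor (fun v : void => tt))
  | Iglp_collapse : Iglp (set_mor (fun b : bool => tt)).

Definition K_pushout (K : morclass) (C D : flow) (g : mor C D) : Prop :=
  exists (A B : flow) (k : mor A B) (a : mor A C) (b : mor B D),
    K A B k /\ is_pushout k a b g.

Definition well_order_from (O : Type) (lt : O -> O -> Prop) (o0 : O) : Prop :=
  [/\ well_founded lt,
      (forall x y z, lt x y -> lt y z -> lt x z),
      (forall x y, x = y \/ lt x y \/ lt y x) &
      (forall o, o <> o0 -> lt o0 o)].

Definition is_succ (O : Type) (lt : O -> O -> Prop) (o1 o2 : O) : Prop :=
  lt o1 o2 /\ ~ (exists o, lt o1 o /\ lt o o2).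

Definition is_limit (O : Type) (lt : O -> O -> Prop) (o0 o : O) : Prop :=
  o <> o0 /\ forall o', lt o' o -> exists o'', lt o' o'' /\ lt o'' o.

(* f : A -> B is a relative K-cell complex: a transfinite composition of
   pushouts of elements of K, i.e. (up to the isomorphism iota) the map
   X_{o0} -> colim X of a colimit-preserving well-ordered sequence X whose
   successor maps are pushouts of elements of K *)
Definition rel_cell (K : morclass) (A B : flow) (f : mor A B) : Prop :=
  exists (O : Type) (lt : O -> O -> Prop) (o0 : O) (X : O -> flow)
         (map : forall o1 o2, lt o1 o2 -> mor (X o1) (X o2))
         (c : forall o, mor (X o) B) (iota : mor A (X o0)),
  [/\ well_order_from lt o0,
      (forall o1 o2 o3 (h12 : lt o1 o2) (h23 : lt o2 o3) (h13 : lt o1 o3),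
          meq (mcomp (map o2 o3 h23) (map o1 o2 h12)) (map o1 o3 h13)),
      (forall o1 o2 (h : lt o1 o2), is_succ lt o1 o2 -> K_pushout K (map o1 o2 h)) /\
      (forall o, is_limit lt o0 o ->
          @is_colim O lt (fun o' => lt o' o) X map (X o) (fun o' h => map o' o h)),
      @is_colim O lt (fun _ => True) X map B (fun o _ => c o) &
      is_iso iota /\ meq f (mcomp (c o0) iota)].

Definition cell_flow (X : flow) : Prop := rel_cell Iglp (empty_mor X).

Definition br_step (X : flow) (u v : Ptot X) : Prop :=
  exists a b c (x : fP X a b) (y : fP X b c), u = pin x /\ v = pin (fcomp x y).
Definition mg_step (X : flow) (u v : Ptot X) : Prop :=
  exists a b c (x : fP X a b) (y : fP X b c), u = pin y /\ v = pin (fcomp x y).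

Definition br_equiv (X : flow) := clos_refl_sym_trans (Ptot X) (@br_step X).
Definition mg_equiv (X : flow) := clos_refl_sym_trans (Ptot X) (@mg_step X).

Definition Pminus_singleton (X : flow) (alpha : fst_ X) : Prop :=
  (exists u : Ptot X, psrc u = alpha) /\
  forall u v : Ptot X, psrc u = alpha -> psrc v = alpha -> br_equiv u v.

Definition Pplus_singleton (X : flow) (alpha : fst_ X) : Prop :=
  (exists u : Ptot X, ptgt u = alpha) /\
  forall u v : Ptot X, ptgt u = alpha -> ptgt v = alpha -> mg_equiv u v.

Definition surrounded (X : flow) (A B : fst_ X -> Prop) : Prop :=
  forall alpha, A alpha -> B alpha \/
    exists g1 g2 : Ptot X, [/\ B (psrc g1), ptgt g1 = alpha, psrc g2 = alpha & B (ptgt g2)].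

Definition restr (X : flow) (A : fst_ X -> Prop) : flow.
Proof.
refine (@Flow {a : fst_ X | A a} (fun a b => fP X (sval a) (sval b))
          (fun a b c x y => fcomp x y) _ _).
- by move=> *; apply: fcompA.
- by move=> a b c; apply: fcomp_cont.
Defined.

Definition image_of (X Y : flow) (f : mor X Y) : fst_ Y -> Prop :=
  fun y => exists x, m0 f x = y.

Definition corestr (X Y : flow) (f : mor X Y) : mor X (restr (image_of f)).
Proof.
refine (@Mor X (restr (image_of f))
          (fun x => exist _ (m0 f x) (ex_intro _ x erefl))
          (fun a b x => m1 f x) _ _).
- by move=> a b; apply: m1_cont.
- by move=> a b c x y; apply: m1_comp.
Defined.

Definition T_homotopy_equiv (X Y : flow) (f : mor X Y) : Prop :=
  [/\ is_iso (corestr f),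
      (forall alpha, ~ image_of f alpha ->
          Pminus_singleton alpha /\ Pplus_singleton alpha) &
      surrounded (fun _ => True) (image_of f)].

(* Main.v *)
From HB Require Import structures.
Require Import Defs.
From mathcomp Require Import all_boot all_order all_algebra all_classical all_reals all_analysis.
From mathcomp Require Import Rstruct Rstruct_topology.
From mathcomp Require wochoice.
From Stdlib Require Import Rdefinitions.

Set Implicit Arguments.
Unset Strict Implicit.
Unset Printing Implicit Defensive.

Import Order.TTheory GRing.Theory Num.Theory.
Import numFieldNormedType.Exports.

Local Open Scope classical_set_scope.
Local Open Scope ring_scope.

(* A cell complex Y is, as a category without identities, free on the interior
   points of its globes. Hence if the branching and the merging spaces of Y at
   alpha are singletons, exactly one cell e1 starts and exactly one cell e0 ends
   at alpha, and both have dimension 0; this is detected by maps from Y to flows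
   with one state and path space R in which x * y = x, respectively x * y = y,
   since such maps extend over globes by Tietze's theorem. As Y^0 is surrounded,
   e0 : g -> alpha and e1 : alpha -> b with g, b in X^0. Take U = X^0 discrete and
   V = U with one edge e : g -> b. In the cell decomposition of Y, all states can
   be put in place and e0, e1 be attached at the beginning; the remaining cells
   have their ends in X^0, and restricting every stage to X^0 turns the sequence
   into a cell decomposition of V -> X, where e becomes e0 * e1. That a stage N is
   recovered from its restriction R N by subdividing e holds by lifting N -> N
   along Sub (R N) -> N cell by cell, which also gives the pushout square. *)

(** * Compactly generated spaces *)

(** Restriction to X^0 has no general reason to commute with pushouts and colimits. It does here
    because [Sub] plays two roles. On the one hand [Sub e] is Z with the path e subdivided; on the
    other hand, morphisms from a stage N to [Sub e] that respect the edges correspond to morphisms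
    from the restriction of N to Z that send the composite edge to e. Every test map on a
    restriction thus becomes a test map on the stage itself. A stage need not embed in Y on states,
    since states may be identified later in the sequence. Hence each stage is first pushed forward
    along its map to Y^0, after which all maps are the identity on states. The pushed-forward stages
    are given by generators and relations, and isomorphisms by bijections on test maps, so that the
    path spaces of a pushout never have to be described. A cell is told apart from all others by its
    center: Tietze's theorem leaves the value there free, whatever the boundary forces. *)

Lemma set_type_compact (T : topologicalType) (A : set T) :
  compact A -> compact [set: set_type A].
Proof.
move=> cA; apply/compact_near_coveringP => J F P FF cov.
have /compact_near_coveringP nc := cA.
have := nc J F (fun i x => forall h : x \in A, P i (exist _ x h)) FF.
move=> H; have {}H : \forall i \near F, A `<=` (fun x => forall h : x \in A, P i (exist _ x h)).
  apply: H => x Ax.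
  have h : x \in A by exact: mem_set.
  have [/= [B1 B2] [[V [[W oW WV] Vx VB]] FB2] BP] := cov (exist _ x h) I.
  exists (W, B2) => /=.
    split=> //; apply: open_nbhs_nbhs; split=> //.
    by move: Vx; rewrite -WV.
  move=> [y i] /= [Wy B2i] hy; apply: (BP (exist _ y hy, i)); split => //=.
  by apply: VB; rewrite -WV.
near=> i => -[x h] _; apply: (near H i) => //; exact: set_mem.
Unshelve. all: by end_near. Qed.

Lemma set_type_hausdorff (T : topologicalType) (A : set T) :
  hausdorff_space T -> hausdorff_space (set_type A).
Proof.
move=> hT x y clxy; apply: val_inj; apply: hT => U V nU nV.
have c := @initial_continuous _ _ (@set_val T A).
have [z [Uz Vz]] := clxy _ _ (c x U nU) (c y V nV).
by exists (set_val z).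
Qed.

Lemma test_set_type (T : topologicalType) (A : set T) :
  hausdorff_space T -> compact A -> test_space (set_type A).
Proof. by move=> hT cA; split; [exact: set_type_compact|exact: set_type_hausdorff]. Qed.

Lemma test_closed (K : topologicalType) (A : set K) :
  test_space K -> closed A -> test_space (set_type A).
Proof.
move=> [cK hK] cA; apply: test_set_type => //.
exact: subclosed_compact cK _.
Qed.

Lemma test_prod (K L : topologicalType) :
  test_space K -> test_space L -> test_space (K * L)%type.
Proof.
move=> [cK hK] [cL hL]; split.
  rewrite (_ : setT = setT `*` setT); first exact: compact_setX.
  by apply/seteqP; split=> // -[].
move=> [k l] [k' l'] clxy; congr pair.
- apply: hK => U V nU nV.
  have [z [Uz Vz]] := clxy _ _ (cvg_fst nU) (cvg_fst nV).
  by exists z.1.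
- apply: hL => U V nU nV.
  have [z [Uz Vz]] := clxy _ _ (cvg_snd nU) (cvg_snd nV).
  by exists z.2.
Qed.

Lemma hausdorff_wh (T : topologicalType) : hausdorff_space T -> weak_hausdorff T.
Proof.
move=> hT K g [cK _] gc; apply: compact_closed => //.
apply: continuous_compact => //; exact: continuous_subspaceT.
Qed.

Lemma test_cg (K : topologicalType) : test_space K -> cg_space K.
Proof.
move=> tK; split; last by apply: hausdorff_wh; case: tK.
move=> U /(_ K id tK); apply; by move=> x; exact: cvg_id.
Qed.

Lemma test_unit : test_space unitT.
Proof.
split; last exact: discrete_hausdorff.
apply: finite_compact.
by rewrite (_ : setT = [set tt]); [exact: finite_set1 | apply/seteqP; split=> [[]|]].
Qed.

Lemma test_empty (K : topologicalType) : (K -> False) -> test_space K.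
Proof.
move=> nK; split; last by move=> x; case: (nK x).
by rewrite (_ : setT = set0); [exact: compact0 | apply/seteqP; split=> x; case: (nK x)].
Qed.

Lemma wh_closed1 (W : topologicalType) (w : W) : weak_hausdorff W -> closed [set w].
Proof.
move=> whW; have -> : [set w] = range (fun _ : unitT => w).
  by apply/seteqP; split=> [x -> | x [_ _ <-]] //; exists tt.
by apply: whW; [exact: test_unit | exact: cst_continuous].
Qed.

(** By regularity [l0] has a closed neighbourhood whose image under [p] misses [q k0]. That image is
    closed, its source being compact Hausdorff, so its complement pulls back along [q] to a
    neighbourhood of [k0]. *)
Lemma wh_diag (W K L : topologicalType) (p : L -> W) (q : K -> W) :
  weak_hausdorff W -> test_space L -> continuous p -> continuous q ->
  open [set lk : L * K | p lk.1 <> q lk.2].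
Proof.
move=> whW tL pc qc; rewrite openE => -[l0 k0] /= pq0.
have [cL hL] := tL.
have oL' : open (p @^-1` (~` [set q k0])).
  by move/continuousP: pc; apply; rewrite openC; exact: wh_closed1.
have rL : regular_space L.
  by move=> x A; apply: (@compact_regular L x setT) => //; exact: filterT.
have /rL [B nB clB] : nbhs l0 (p @^-1` (~` [set q k0])).
  exact: open_nbhs_nbhs.
have tB : test_space (set_type (closure B)).
  by apply: test_closed => //; exact: closed_closure.
have cR : closed (range (p \o @set_val L (closure B))).
  apply: whW tB _ => x; apply: continuous_comp; last exact: pc.
  exact: initial_continuous.
exists (B, q @^-1` (~` range (p \o @set_val L (closure B)))).
  split => //=; apply: open_nbhs_nbhs; split.
    by move/continuousP: qc; apply; rewrite openC.
  move=> [[x hx] _ /= pxq]; have /clB := set_mem hx; exact.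
move=> [l k] /= [Bl nk] plk; apply: nk.
have hl : l \in closure B by apply: mem_set; exact: subset_closure.
by exists (exist _ l hl).
Qed.

(** A probe [u] is examined at a point [l0] sent outside the image of [g]. By [wh_diag] in a
    separating target, [u] near [l0] differs from [g] near each given [k]; compactness of [K] makes
    the neighbourhood of [l0] uniform in [k]. *)
Lemma wh_sep (T : topologicalType) :
  kspace T ->
  (forall x y : T, x <> y -> exists (W : topologicalType) (h : T -> W),
      [/\ weak_hausdorff W, continuous h & h x <> h y]) ->
  weak_hausdorff T.
Proof.
move=> kT sepT K g tK gc; rewrite -openC; apply: kT => L u tL uc.
rewrite openE => l0 /= nl0.
have /compact_near_coveringP nc := tK.1.
have near_l0 : \forall l \near l0, [set: K] `<=` (fun k => u l <> g k).
  apply: nc => k _; have ne : u l0 <> g k by move=> e; apply: nl0; exists k.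
  have [W [h [whW hc hne]]] := sepT _ _ ne.
  have o : open [set lk : L * K | h (u lk.1) <> h (g lk.2)].
    apply: (@wh_diag W K L (h \o u) (h \o g)) => // x.
      apply: continuous_comp; [exact: uc | exact: hc].
    apply: continuous_comp; [exact: gc | exact: hc].
  have : nbhs (l0, k) [set lk : L * K | h (u lk.1) <> h (g lk.2)].
    by apply: open_nbhs_nbhs.
  move=> [/= [B1 B2] [/= n1 n2] sB]; exists (B2, B1) => //= -[k' l'] /= [B2k B1l] e.
  by apply: (sB (l', k')) => //=; rewrite e.
by rewrite /interior; apply: filterS near_l0 => l sl [k _ /esym]; apply: sl.
Qed.

(* Whitehead's theorem: multiplying by a compact Hausdorff space preserves a
   topology that is final for a family of probes. *)
Lemma whitehead (A C K : topologicalType)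
    (Pr : forall L : topologicalType, (L -> A) -> Prop) (h : A -> K -> C) :
  test_space K ->
  (forall a, exists (L : topologicalType) (u : L -> A) l,
      [/\ test_space L, Pr L u & u l = a]) ->
  (forall U : set A, (forall L u, test_space L -> Pr L u -> open (u @^-1` U)) -> open U) ->
  (forall L u, test_space L -> Pr L u -> continuous (fun lk : L * K => h (u lk.1) lk.2)) ->
  continuous (fun ak : A * K => h ak.1 ak.2).
Proof.
move=> tK hit fin hc [a0 k0] W /=; rewrite nbhsE => -[W' [oW' W'0] sW].
have [cK hK] := tK.
have rK : regular_space K.
  by move=> x B; apply: (@compact_regular K x setT) => //; exact: filterT.
have ha0 : continuous (h a0).
  have [L [u [l [tL Pu <-]]]] := hit a0 => k.
  apply: (@continuous_comp _ _ _ (fun k => (l, k)) (fun lk => h (u lk.1) lk.2)).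
    by apply: cvg_pair; [exact: cst_continuous | exact: cvg_id].
  exact: hc.
have /rK [B nB clB] : nbhs k0 (h a0 @^-1` W') by apply: ha0; exact: open_nbhs_nbhs.
have cB : compact (closure B).
  by apply: (subclosed_compact _ cK) => //; exact: closed_closure.
pose V := [set a | forall k, closure B k -> W' (h a k)].
have oV : open V.
  apply: fin => L u tL Pu; rewrite openE => l Vl; rewrite /interior.
  have /compact_near_coveringP nc := cB.
  have := nc L (nbhs l) (fun l k => W' (h (u l) k)) _; apply.
  move=> k clk; have := hc L u tL Pu (l, k) W' => /=.
  case; first by apply: open_nbhs_nbhs; split=> //; exact: Vl.
  move=> -[B1 B2] /= [n1 n2] sB; exists (B2, B1) => //= -[k' l'] /= [B2k B1l].
  by apply: (sB (l', k')).
exists (V, B) => /=.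
  split=> //; apply: open_nbhs_nbhs; split=> // k /clB; exact.
move=> [a k] /= [Va Bk]; apply: sW; apply: Va; exact: subset_closure.
Qed.

(** [whitehead] is used once per variable: the probes of [B] are removed with the source of a probe
    of [A] as compact factor, then those of [A] with the source of the given [g] as compact factor.
    The product itself never has to carry a final topology. *)
Lemma kcontinuous2_final (A B C : topologicalType) (h : A -> B -> C)
    (PA : forall L : topologicalType, (L -> A) -> Prop)
    (PB : forall L : topologicalType, (L -> B) -> Prop) :
  (forall a, exists (L : topologicalType) (u : L -> A) l,
      [/\ test_space L, PA L u & u l = a]) ->
  (forall b, exists (L : topologicalType) (u : L -> B) l,
      [/\ test_space L, PB L u & u l = b]) ->
  (forall U : set A, (forall L u, test_space L -> PA L u -> open (u @^-1` U)) -> open U) ->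
  (forall U : set B, (forall L u, test_space L -> PB L u -> open (u @^-1` U)) -> open U) ->
  (forall K L u v, test_space K -> test_space L -> PA K u -> PB L v ->
     continuous (fun kl : K * L => h (u kl.1) (v kl.2))) ->
  kcontinuous2 h.
Proof.
move=> hA hB fA fB hc K g tK gc.
have c1 L u : test_space L -> PA L u ->
    continuous (fun bl : B * L => h (u bl.2) bl.1).
  move=> tL Pu; apply: (whitehead (h := fun b l => h (u l) b) tL hB fB).
  move=> M v tM Pv x.
  apply: (@continuous_comp _ _ _ (fun y : M * L => (y.2, y.1)) (fun kl => h (u kl.1) (v kl.2))).
    by apply: cvg_pair => /=; [exact: cvg_snd | exact: cvg_fst].
  exact: hc.
have c2 : continuous (fun ak : A * K => h ak.1 (g ak.2).2).
  apply: (whitehead (h := fun a k => h a (g k).2) tK hA fA) => L u tL Pu x.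
  apply: (@continuous_comp _ _ _ (fun y : L * K => ((g y.2).2, y.1)) (fun bl => h (u bl.2) bl.1)).
    apply: cvg_pair => /=; last exact: cvg_fst.
    apply: (@continuous_comp _ _ _ (fun y : L * K => g y.2) snd); last exact: cvg_snd.
    apply: (@continuous_comp _ _ _ snd g); [exact: cvg_snd | exact: gc].
  exact: c1.
move=> k; apply: (@continuous_comp _ _ _ (fun k => ((g k).1, k)) (fun ak => h ak.1 (g ak.2).2)).
  apply: cvg_pair => /=; last exact: cvg_id.
  apply: (@continuous_comp _ _ _ g fst); [exact: gc | exact: cvg_fst].
exact: c2.
Qed.

(** * Disks and spheres *)

Lemma sumsq_continuous (n : nat) :
  continuous (fun x : 'rV[R]_n => \sum_(i < n) x ord0 i ^+ 2 : R).
Proof.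
apply: continuous_big => [|i _]; first exact: (@add_continuous R^o).
move=> x; rewrite (_ : (fun _ => _) = (fun x : 'rV[R]_n => x ord0 i * x ord0 i)); last first.
  by apply/funext => y; rewrite expr2.
by have c := @coord_continuous R 1 n ord0 i x; exact: (cvgM c c).
Qed.

Lemma Dset_compact (n : nat) : compact (Dset n).
Proof.
apply: bounded_closed_compact.
  exists 1; split=> // M M1 x /= Dx.
  have -> : `|x| = mx_norm x by [].
  rewrite mx_normrE; apply/bigmax_leP; split=> [|[i j] _] /=.
    by apply: ltW; exact: lt_trans M1.
  rewrite (ord1 i); apply: le_trans (ltW M1).
  rewrite -(@ler_pXn2r _ 2%N) ?nnegrE// expr1n real_normK ?num_real//.
  apply: le_trans Dx; rewrite (bigD1 j)//= lerDl.
  by apply: sumr_ge0 => k _; exact: sqr_ge0.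
rewrite (_ : Dset n = (fun x : 'rV[R]_n => \sum_(i < n) x ord0 i ^+ 2 : R) @^-1` [set y : R | y <= 1]) //.
apply: closed_comp; last exact: closed_le.
by move=> x _; exact: sumsq_continuous.
Qed.

Lemma Disk_test (n : nat) : test_space (Disk n).
Proof. by apply: test_set_type; [exact: norm_hausdorff | exact: Dset_compact]. Qed.

Lemma center_mem (n : nat) : (0 : 'rV[R]_n) \in Dset n.
Proof.
apply/mem_set; rewrite /Dset /= big1 ?ler01// => i _.
by rewrite mxE expr0n.
Qed.

Definition center (n : nat) : Disk n := exist _ 0 (center_mem n).

Lemma center_notin_Sphere (n : nat) : ~ Sset n (center n).
Proof.
rewrite /Sset /= => /eqP; rewrite big1 => [|i _].
  by rewrite eq_sym oner_eq0.
by rewrite set_valE /= mxE expr0n.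
Qed.

Lemma Disk0_center (x : Disk 0) : x = center 0.
Proof. by apply: val_inj; apply/rowP => -[]. Qed.

Lemma Sphere0_empty (x : Sphere 0) : False.
Proof.
apply: (@center_notin_Sphere 0).
by rewrite -(Disk0_center (set_val x)); exact: set_valP.
Qed.

Lemma Sphere_pos (n : nat) : Sphere n.+1.
Proof.
have hD : (delta_mx ord0 ord0 : 'rV[R]_n.+1) \in Dset n.+1.
  apply/mem_set; rewrite /Dset /= (bigD1 ord0)//= big1 => [|i /negbTE ni].
    by rewrite mxE !eqxx expr1n addr0.
  by rewrite mxE ni andbF expr0n.
have hS : (exist (fun x => x \in Dset n.+1) _ hD : Disk n.+1) \in Sset n.+1.
  apply/mem_set; rewrite /Sset /= set_valE /=.
  rewrite (bigD1 ord0)//= big1 => [|i /negbTE ni].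
    by rewrite mxE !eqxx expr1n addr0.
  by rewrite mxE ni andbF expr0n.
exact: (exist (fun x : Disk n.+1 => x \in Sset n.+1) _ hS).
Qed.

Lemma Sset_closed (n : nat) : closed (Sset n).
Proof.
rewrite (_ : Sset n = (fun x : Disk n => \sum_(i < n) (@set_val _ (Dset n) x) ord0 i ^+ 2 : R) @^-1` [set 1]) //.
apply: closed_comp; last exact: closed_eq.
move=> x _; apply: (@continuous_comp _ _ _ (@set_val _ (Dset n)) (fun x : 'rV[R]_n => \sum_(i < n) x ord0 i ^+ 2 : R)).
  exact: initial_continuous.
exact: sumsq_continuous.
Qed.

Lemma Sphere_test (n : nat) : test_space (Sphere n).
Proof. by apply: test_closed; [exact: Disk_test | exact: Sset_closed]. Qed.

Lemma R_cg : cg_space R.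
Proof.
split; last by apply: hausdorff_wh; exact: Rhausdorff.
move=> U kU; rewrite openE => x Ux.
(* Openness is local, so a compact interval around [x] is probe enough. *)
pose A := `[x - 1, x + 1]%classic : set R.
have tA : test_space (set_type A).
  by apply: test_set_type; [exact: Rhausdorff | exact: segment_compact].
have /(_ tA) := kU (set_type A) set_val.
move=> /(_ (@initial_continuous _ _ _)) [V oV VU].
have Ax : x \in A by apply/mem_set; rewrite /A /= in_itv /= lerDl gerBl ler01.
have Vx : V x by have : (set_val @^-1` V) (exist _ x Ax : A) by rewrite VU.
rewrite /interior.
have : nbhs x (V `&` ball x 1).
  by apply: filterI; [exact: open_nbhs_nbhs | exact: nbhsx_ballx].
apply: filterS => y [Vy xy].
have Ay : y \in A.
  apply/mem_set; rewrite /A /= in_itv /=.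
  by move: xy; rewrite /ball /= ltr_distlC => /andP[/ltW -> /ltW ->].
by have : (set_val @^-1` V) (exist _ y Ay : A) by []; rewrite VU.
Qed.

(** Tietze's theorem on the closed set formed by the sphere and the center; the two prescriptions
    cannot conflict, the center not being on the sphere. *)
Lemma disk_extension (n : nat) (g : Sphere n -> R) (c : R) : continuous g ->
  exists d : Disk n -> R,
    [/\ continuous d, forall x : Sphere n, d (set_val x) = g x & d (center n) = c].
Proof.
move=> gc; have [cD hD] := Disk_test n.
have nD : normal_space (Disk n) by exact: compact_normal.
pose f (x : Disk n) : R := oapp g c (insub x : option (Sphere n)).
have fS (x : Sphere n) : f (set_val x) = g x by rewrite /f /= set_valE valK.
have fc : f (center n) = c.
  by rewrite /f insubN //; apply/negP => /set_mem; exact: center_notin_Sphere.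
pose A := Sset n `|` [set center n].
have clS := @Sset_closed n.
have cl1 : closed [set center n].
  by apply: accessible_closed_set1; exact: hausdorff_accessible.
have fw : {within A, continuous f}.
  apply: withinU_continuous => //.
    apply/subspace_sigL_continuousP; rewrite (_ : sigL _ f = g) //.
    by apply/funext => x; rewrite /sigL /=; exact: fS.
  exact: continuous_subspace1.
have cgA : compact (g @` setT).
  apply: continuous_compact; first exact: continuous_subspaceT.
  by case: (Sphere_test n).
have [M [_ bM]] := @compact_bounded R R^o _ cgA.
(* Tietze's theorem needs a positive bound: [M + 1] serves on the sphere, the norm of [c] at the
   center, and 1 gives positivity. *)
pose B := Num.max (Num.max (M + 1) `|c|) 1.
have B0 : 0 < B by rewrite /B !lt_max ltr01 orbT.
have bf x : A x -> `|f x| <= B.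
  move=> [Sx|->]; last by rewrite fc /B !le_max lexx orbT.
  have -> : x = set_val (exist _ x (mem_set Sx) : Sphere n) by [].
  rewrite fS; have : `|g (exist _ x (mem_set Sx) : Sphere n)| <= M + 1.
    by apply: (bM (M + 1)); [rewrite ltrDl ltr01 | exists (exist _ x (mem_set Sx))].
  by move=> h; rewrite /B !le_max h.
have clA : closed A by exact: closedU.
have [d [fd dc _]] := continuous_bounded_extension nD clA B0 fw bf.
exists d; split=> // [x|].
  by rewrite -fS fd //; apply/mem_set; left; exact: set_valP.
by rewrite -fc fd //; apply/mem_set; right.
Qed.

(** * Morphisms of flows *)

Lemma sig_eq (T : Type) (P : T -> Prop) (a b : {x | P x}) : sval a = sval b -> a = b.
Proof. by case: a b => [a ka] [b kb] /= e; subst b; rewrite (Prop_irrelevance ka kb). Qed.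

Lemma existT_inj (A : Type) (P : A -> Type) (a : A) (x y : P a) :
  existT P a x = existT P a y -> x = y.
Proof.
move=> e; have := projT2_eq e.
by rewrite (Prop_irrelevance (projT1_eq e) erefl).
Qed.

(** Paths whose ends are only provably equal are compared in the total space; injectivity of [pin],
    that is uniqueness of identity proofs, brings such an equality back to one path space. *)
Lemma pin_inj (X : flow) (a b : fst_ X) : injective (@pin X a b).
Proof. by move=> x y e; exact: existT_inj e. Qed.

Lemma pin_surj (X : flow) (u : Ptot X) : exists a b (x : fP X a b), u = pin x.
Proof. by case: u => [[a b] x]; exists a, b, x. Qed.

Lemma pin_cast (X : flow) (a b a' b' : fst_ X) (x : fP X a b) :
  a = a' -> b = b' -> exists x' : fP X a' b', pin x' = pin x.
Proof. by move=> <- <-; exists x. Qed.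

Lemma pin_ends (X : flow) (a b a' b' : fst_ X) (x : fP X a b) (y : fP X a' b') :
  pin x = pin y -> a = a' /\ b = b'.
Proof. by move=> e; case: (congr1 (@projT1 _ _) e) => -> ->. Qed.

Lemma pin_comp (X : flow) (a b c a' b' c' : fst_ X)
    (x : fP X a b) (y : fP X b c) (x' : fP X a' b') (y' : fP X b' c') :
  pin x = pin x' -> pin y = pin y' -> pin (fcomp x y) = pin (fcomp x' y').
Proof.
move=> ex ey; have [ea eb] := pin_ends ex; have [_ ec] := pin_ends ey.
by subst a' b' c'; move/pin_inj: ex => <-; move/pin_inj: ey => <-.
Qed.

Definition pmap (X Y : flow) (f : mor X Y) (u : Ptot X) : Ptot Y :=
  pin (m1 f (projT2 u)).

Lemma mor_eq (X Y : flow) (f g : mor X Y) : meq f g -> f = g.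
Proof.
case: f g => [f0 f1 fc fm] [g0 g1 gc gm] [/= e0 e1].
have {}e0 : f0 = g0 by exact: funext.
subst g0; have {}e1 : f1 = g1.
  by apply: functional_extensionality_dep => a; apply: functional_extensionality_dep => b;
     apply: funext => x; apply: pin_inj; exact: e1.
by subst g1; rewrite (Prop_irrelevance fc gc) (Prop_irrelevance fm gm).
Qed.

Lemma meq_refl (X Y : flow) (f g : mor X Y) : f = g -> meq f g.
Proof. by move=> ->. Qed.

Lemma mcompA (X Y Z W : flow) (f : mor X Y) (g : mor Y Z) (h : mor Z W) :
  mcomp h (mcomp g f) = mcomp (mcomp h g) f.
Proof. exact: mor_eq. Qed.

Lemma mcomp1m (X Y : flow) (f : mor X Y) : mcomp (idmor Y) f = f.
Proof. exact: mor_eq. Qed.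

Lemma mcompm1 (X Y : flow) (f : mor X Y) : mcomp f (idmor X) = f.
Proof. exact: mor_eq. Qed.

Lemma kcontinuous2_comp (A B C D E : topologicalType) (h : A -> B -> C)
    (f : D -> A) (g : E -> B) :
  kcontinuous2 h -> continuous f -> continuous g -> kcontinuous2 (fun d e => h (f d) (g e)).
Proof.
move=> hc fc gc K k tK kc; apply: (hc K (fun x => (f (k x).1, g (k x).2))) => // x.
apply: cvg_pair => /=.
  apply: (@continuous_comp _ _ _ (fun x => (k x).1) f); last exact: fc.
  apply: (@continuous_comp _ _ _ k fst); [exact: kc | exact: cvg_fst].
apply: (@continuous_comp _ _ _ (fun x => (k x).2) g); last exact: gc.
apply: (@continuous_comp _ _ _ k snd); [exact: kc | exact: cvg_snd].
Qed.

(** * Flows with a fixed set of states *)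

(** With the states fixed and morphisms the identity on them, path spaces match by conversion and
    transports disappear. The passage back to general targets is [mor_pull]: a morphism to [Z] over
    a map [tau] of states is an [smor] to [pull tau]. *)
Record sflow (S : Type) := SFlow {
  sP : S -> S -> topologicalType;
  scomp : forall a b c, sP a b -> sP b c -> sP a c;
  scompA : forall a b c d (x : sP a b) (y : sP b c) (z : sP c d),
    scomp (scomp x y) z = scomp x (scomp y z);
  scomp_cont : forall a b c, kcontinuous2 (@scomp a b c) }.
Arguments scomp {S s a b c}.

Definition toflow (S : Type) (X : sflow S) : flow :=
  Flow (@scompA S X) (@scomp_cont S X).
Coercion toflow : sflow >-> flow.

Definition scg (S : Type) (X : sflow S) := forall a b, cg_space (sP X a b).

Record smor (S : Type) (X Y : sflow S) := SMor {
  s1 :> forall a b, sP X a b -> sP Y a b;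
  s1_cont : forall a b, continuous (@s1 a b);
  s1_comp : forall a b c (x : sP X a b) (y : sP X b c),
    s1 (scomp x y) = scomp (s1 x) (s1 y) }.
Arguments s1 {S X Y} _ {a b}.

Lemma smor_eq (S : Type) (X Y : sflow S) (f g : smor X Y) :
  (forall a b (x : sP X a b), f _ _ x = g _ _ x) -> f = g.
Proof.
case: f g => [f fc fm] [g gc gm] /= e; have {}e : f = g.
  by apply: functional_extensionality_dep => a; apply: functional_extensionality_dep => b;
     apply: funext => x; exact: e.
by subst g; rewrite (Prop_irrelevance fc gc) (Prop_irrelevance fm gm).
Qed.

Definition s2m (S : Type) (X Y : sflow S) (f : smor X Y) : mor X Y :=
  @Mor X Y id (fun a b => @s1 _ _ _ f a b) (@s1_cont _ _ _ f) (@s1_comp _ _ _ f).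

Definition smcomp (S : Type) (X Y Z : sflow S) (g : smor Y Z) (f : smor X Y) : smor X Z.
Proof.
refine (@SMor S X Z (fun a b x => s1 g (s1 f x)) _ _).
- by move=> a b x; apply: continuous_comp; exact: s1_cont.
- by move=> a b c x y; rewrite !s1_comp.
Defined.

Lemma smcompA (S : Type) (X Y Z W : sflow S) (h : smor Z W) (g : smor Y Z) (f : smor X Y) :
  smcomp h (smcomp g f) = smcomp (smcomp h g) f.
Proof. exact: smor_eq. Qed.

Definition sid (S : Type) (X : sflow S) : smor X X.
Proof.
refine (@SMor S X X (fun a b x => x) _ _) => //.
by move=> a b x; exact: cvg_id.
Defined.

Lemma s2m_comp (S : Type) (X Y Z : sflow S) (g : smor Y Z) (f : smor X Y) :
  s2m (smcomp g f) = mcomp (s2m g) (s2m f).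
Proof. exact: mor_eq. Qed.

Lemma s2m_id (S : Type) (X : sflow S) : s2m (sid X) = idmor X.
Proof. exact: mor_eq. Qed.

Definition pull (S : Type) (Z : flow) (tau : S -> fst_ Z) : sflow S :=
  @SFlow S (fun a b => fP Z (tau a) (tau b)) (fun a b c => @fcomp Z _ _ _)
    (fun a b c d => @fcompA Z _ _ _ _) (fun a b c => @fcomp_cont Z _ _ _).

Lemma scg_pull (S : Type) (Z : flow) (tau : S -> fst_ Z) : cg_flow Z -> scg (pull tau).
Proof. by move=> cZ a b; exact: cZ. Qed.

Definition unpull (S : Type) (Z : flow) (tau : S -> fst_ Z) : mor (pull tau) Z.
Proof.
refine (@Mor (pull tau) Z tau (fun a b x => x) _ _) => //.
by move=> a b x; exact: cvg_id.
Defined.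

Lemma mor_pull (S : Type) (X : sflow S) (Z : flow) (tau : S -> fst_ Z) (h : mor X Z) :
  m0 h =1 tau -> exists g : smor X (pull tau), mcomp (unpull tau) (s2m g) = h.
Proof.
case: h => h0 h1 hc hm /= /funext e; subst h0.
by exists (@SMor S X (pull tau) h1 hc hm); exact: mor_eq.
Qed.

Lemma unpull_inj (S : Type) (X : sflow S) (Z : flow) (tau : S -> fst_ Z)
    (g g' : smor X (pull tau)) :
  mcomp (unpull tau) (s2m g) = mcomp (unpull tau) (s2m g') -> g = g'.
Proof.
move=> e; apply: smor_eq => a b x; apply: (@pin_inj Z).
by move/(congr1 (fun h => pmap h (@pin X _ _ x))): e.
Qed.

(** * Flows presented by generators and equations *)

(* Two words are identified when they agree in every admissible target, and the
   topology is final for the compact families of words; so evaluation in the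
   targets separates points, which gives the weak Hausdorff property. *)
Section Presented.
Variables (S J : Type) (src tgt : J -> S) (T : J -> topologicalType).

(** Words are nonempty, since flows have no identities. *)
Inductive word : S -> S -> Type :=
  | w1 j (x : T j) : word (src j) (tgt j)
  | wc j (x : T j) t (w : word (tgt j) t) : word (src j) t.

Fixpoint wapp s t (w : word s t) : forall u, word t u -> word s u :=
  match w with
  | w1 j x => fun u w' => wc x w'
  | wc j x t w => fun u w' => wc x (wapp w w')
  end.

Lemma wappA s t (w : word s t) u (w' : word t u) v (w'' : word u v) :
  wapp (wapp w w') w'' = wapp w (wapp w' w'').
Proof. by elim: w u w' w'' => //= j x t' w IH u w' w''; rewrite IH. Qed.

Definition assignment (Z : sflow S) := forall j, T j -> sP Z (src j) (tgt j).

Fixpoint weval (Z : sflow S) (phi : assignment Z) s t (w : word s t) : sP Z s t :=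
  match w with
  | w1 j x => phi j x
  | wc j x t w => scomp (phi j x) (weval phi w)
  end.

Lemma weval_app (Z : sflow S) (phi : assignment Z) s t (w : word s t) u (w' : word t u) :
  weval phi (wapp w w') = scomp (weval phi w) (weval phi w').
Proof. by elim: w u w' => //= j x t' w IH u w'; rewrite IH scompA. Qed.

Inductive wprobe (K : topologicalType) : forall s t, (K -> word s t) -> Prop :=
  | wp1 j (g : K -> T j) : continuous g -> wprobe (fun k => w1 (g k))
  | wpc j (g : K -> T j) t (u : K -> word (tgt j) t) :
      continuous g -> wprobe u -> wprobe (fun k => wc (g k) (u k)).

Lemma wprobetcst (K : topologicalType) s t (w : word s t) : wprobe (fun _ : K => w).
Proof.
elim: w => [j x|j x t' w IH]; first by apply: (wp1 (g := fun=> x)); exact: cst_continuous.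
by apply: (wpc (g := fun=> x)) => //; exact: cst_continuous.
Qed.

Lemma wprobetcomp (K L : topologicalType) (h : L -> K) s t (u : K -> word s t) :
  continuous h -> wprobe u -> wprobe (fun l => u (h l)).
Proof.
move=> hc; elim=> {s t u} [j g gc|j g t u gc _ IH].
  by apply: (wp1 (g := fun l => g (h l))) => x; apply: continuous_comp; [exact: hc | exact: gc].
by apply: (wpc (g := fun l => g (h l))) => // x; apply: continuous_comp; [exact: hc | exact: gc].
Qed.

Lemma wprobetapp (K : topologicalType) s t (u : K -> word s t) r (v : K -> word t r) :
  wprobe u -> wprobe v -> wprobe (fun k => wapp (u k) (v k)).
Proof.
move=> pu; elim: pu r v => {s t u} [j g gc|j g t u gc _ IH] r v pv /=; first exact: wpc.
by apply: wpc => //; exact: IH.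
Qed.

Lemma weval_probe (Z : sflow S) (phi : assignment Z) (K : topologicalType) s t
    (u : K -> word s t) :
  test_space K -> (forall j, continuous (phi j)) -> wprobe u ->
  continuous (fun k => weval phi (u k)).
Proof.
move=> tK pc; elim=> {s t u} [j g gc|j g t u gc _ IH] /=.
  by move=> x; apply: continuous_comp; [exact: gc | exact: pc].
apply: (@scomp_cont _ Z _ _ _ K (fun k => (phi j (g k), weval phi (u k)))) => // x.
apply: cvg_pair => /=; last exact: IH.
by apply: (@continuous_comp _ _ _ g (phi j)); [exact: gc | exact: pc].
Qed.

Variable ok : forall Z : sflow S, assignment Z -> Prop.
Arguments ok : clear implicits.

Definition admissible (Z : sflow S) (phi : assignment Z) :=
  [/\ scg Z, forall j, continuous (phi j) & ok Z phi].

Definition weq s t (w w' : word s t) : Prop :=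
  forall Z (phi : assignment Z), admissible phi -> weval phi w = weval phi w'.

(** [weq] quantifies over all admissible targets but is a proposition. A class, being a predicate on
    words, thus stays in the universe of the targets, and a presented flow can itself serve as a
    target. *)
Definition wclass s t : Type := {A : word s t -> Prop | exists w, A = weq w}.

Definition cls s t (w : word s t) : wclass s t := exist _ (weq w) (ex_intro _ w erefl).

Lemma clsP s t (w w' : word s t) : cls w = cls w' <-> weq w w'.
Proof.
split=> [e|e]; first by have /= -> := congr1 sval e.
apply: eq_exist => /=; apply: funext => v; apply: propext.
by split=> h Z phi a; rewrite -(h Z phi a) (e Z phi a).
Qed.

Lemma cls_surj s t (q : wclass s t) : exists w, cls w = q.
Proof. by case: q => A [w e]; exists w; exact: eq_exist. Qed.

Definition wrepr s t (q : wclass s t) : word s t := sval (cid (cls_surj q)).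

Lemma wreprK s t (q : wclass s t) : cls (wrepr q) = q.
Proof. exact: svalP (cid (cls_surj q)). Qed.

Lemma weval_repr s t (w : word s t) (Z : sflow S) (phi : assignment Z) :
  admissible phi -> weval phi (wrepr (cls w)) = weval phi w.
Proof. by move=> a; have /clsP := wreprK (cls w); exact. Qed.

HB.instance Definition _ s t := gen_eqMixin (wclass s t).
HB.instance Definition _ s t := gen_choiceMixin (wclass s t).

Definition wopen s t : set (set (wclass s t)) :=
  [set U | forall (K : topologicalType) (u : K -> word s t),
     test_space K -> wprobe u -> open [set k | U (cls (u k))]].

Lemma wopenT s t : wopen (@setT (wclass s t)).
Proof. by move=> K u _ _; exact: openT. Qed.

Lemma wopenI s t : setI_closed (@wopen s t).
Proof. by move=> U V oU oV K u tK pu; apply: openI; [exact: oU | exact: oV]. Qed.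

Lemma wopen_bigU s t (I : Type) (f : I -> set (wclass s t)) :
  (forall i, wopen (f i)) -> wopen (\bigcup_i f i).
Proof.
move=> o K u tK pu.
rewrite (_ : [set k | _] = \bigcup_i [set k | f i (cls (u k))]) //.
by apply: bigcup_open => i _; exact: o.
Qed.

HB.instance Definition _ s t :=
  isOpenTopological.Build (wclass s t) (@wopenT s t) (@wopenI s t) (@wopen_bigU s t).

Lemma wclass_openE s t (U : set (wclass s t)) : open U = wopen U.
Proof. by []. Qed.


Lemma wclass_continuous s t (W : topologicalType) (f : wclass s t -> W) :
  (forall (K : topologicalType) (u : K -> word s t), test_space K -> wprobe u ->
     continuous (fun k => f (cls (u k)))) -> continuous f.
Proof.
move=> fc; apply/continuousP => U oU; rewrite wclass_openE => K u tK pu.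
have /continuousP := fc K u tK pu; exact.
Qed.

Lemma cls_probetcontinuous s t (K : topologicalType) (u : K -> word s t) :
  test_space K -> wprobe u -> continuous (fun k => cls (u k) : wclass s t).
Proof. by move=> tK pu; apply/continuousP => U; rewrite wclass_openE; exact. Qed.

Lemma wclass_kspace s t : kspace (wclass s t).
Proof.
move=> U oU; rewrite wclass_openE => K u tK pu.
by apply: (oU K (fun k => cls (u k)) tK); exact: cls_probetcontinuous.
Qed.

Definition qeval (Z : sflow S) (phi : assignment Z) s t (q : wclass s t) : sP Z s t :=
  weval phi (wrepr q).

Lemma qeval_cls (Z : sflow S) (phi : assignment Z) s t (w : word s t) :
  admissible phi -> qeval phi (cls w) = weval phi w.
Proof. exact: weval_repr. Qed.

Lemma qeval_continuous (Z : sflow S) (phi : assignment Z) s t :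
  admissible phi -> continuous (@qeval Z phi s t).
Proof.
move=> a; apply: wclass_continuous => K u tK pu.
rewrite (_ : (fun k => _) = (fun k => weval phi (u k))).
  by case: a => _ pc _; exact: weval_probe.
by apply: funext => k; exact: qeval_cls.
Qed.

Lemma wclass_cg s t : cg_space (wclass s t).
Proof.
split; first exact: wclass_kspace.
apply: wh_sep => [|x y]; first exact: wclass_kspace.
have [w <-] := cls_surj x; have [w' <-] := cls_surj y => ne.
have [Z [phi [a ne']]] : exists Z (phi : assignment Z),
    admissible phi /\ weval phi w <> weval phi w'.
  apply: contrapT => n; apply: ne; apply/clsP => Z phi a.
  by apply: contrapT => n'; apply: n; exists Z, phi.
exists (sP Z s t), (@qeval Z phi s t); split.
- by case: a => + _ _ => /(_ s t) [].
- exact: qeval_continuous.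
- by rewrite !qeval_cls.
Qed.

Definition qcomp a b c (q : wclass a b) (r : wclass b c) : wclass a c :=
  cls (wapp (wrepr q) (wrepr r)).

Lemma qcomp_cls a b c (w : word a b) (w' : word b c) :
  qcomp (cls w) (cls w') = cls (wapp w w').
Proof.
by apply/clsP => Z phi adm; rewrite !weval_app !weval_repr.
Qed.

Lemma qcompA a b c d (x : wclass a b) (y : wclass b c) (z : wclass c d) :
  qcomp (qcomp x y) z = qcomp x (qcomp y z).
Proof.
have [w <-] := cls_surj x; have [w' <-] := cls_surj y; have [w'' <-] := cls_surj z.
by rewrite !qcomp_cls wappA.
Qed.

(** Concatenating two probes gives a probe on the product of their sources, which is again compact
    Hausdorff; [kcontinuous2_final] reduces continuity to this case. *)
Lemma qcomp_cont a b c : kcontinuous2 (@qcomp a b c).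
Proof.
pose P s t (L : topologicalType) (u : L -> wclass s t) :=
  exists2 v : L -> word s t, wprobe v & u = (fun k => cls (v k)).
have hit s t (q : wclass s t) : exists (L : topologicalType) (u : L -> wclass s t) l,
    [/\ test_space L, P s t L u & u l = q].
  exists unitT, (fun=> q), tt; split; [exact: test_unit| |by []].
  exists (fun=> wrepr q); first exact: wprobetcst.
  by apply: funext => _; rewrite wreprK.
have fin s t (U : set (wclass s t)) :
    (forall L u, test_space L -> P s t L u -> open (u @^-1` U)) -> open U.
  move=> o; rewrite wclass_openE => K u tK pu.
  by apply: (o K (fun k => cls (u k)) tK); exists u.
apply: (@kcontinuous2_final _ _ _ _ (P a b) (P b c) (@hit _ _) (@hit _ _) (@fin _ _) (@fin _ _)).
move=> K L u v tK tL [u' pu ->] [v' pv ->].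
rewrite (_ : (fun kl => _) = (fun kl : K * L => cls (wapp (u' kl.1) (v' kl.2)))); last first.
  by apply: funext => kl; rewrite qcomp_cls.
apply: cls_probetcontinuous; first exact: test_prod.
apply: wprobetapp.
  by apply: (wprobetcomp _ pu) => x; exact: cvg_fst.
by apply: (wprobetcomp _ pv) => x; exact: cvg_snd.
Qed.

Definition presented : sflow S := SFlow qcompA qcomp_cont.

Lemma scg_presented : scg presented.
Proof. by move=> a b; exact: wclass_cg. Qed.

Definition gen : assignment presented := fun j x => cls (w1 x).

Lemma gen_continuous j : kspace (T j) -> continuous (@gen j).
Proof.
move=> kT; apply/continuousP => U; rewrite wclass_openE => oU.
apply: kT => K g tK gc; apply: (oU K (fun k => w1 (g k)) tK); exact: wp1.
Qed.

Lemma presented_univ (Z : sflow S) (phi : assignment Z) : admissible phi ->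
  exists H : smor presented Z, forall j x, H _ _ (@gen j x) = phi j x.
Proof.
move=> a.
have Hc s t : continuous (fun x : sP presented s t => qeval phi x) by exact: qeval_continuous.
have Hm s t u (x : sP presented s t) (y : sP presented t u) :
    qeval phi (scomp x y) = scomp (qeval phi x) (qeval phi y).
  have [w <-] := cls_surj x; have [w' <-] := cls_surj y.
  by rewrite [scomp _ _]qcomp_cls !qeval_cls // weval_app.
by exists (SMor Hc Hm) => j x; rewrite [LHS]qeval_cls.
Qed.

Lemma presented_uniq (Z : sflow S) (H H' : smor presented Z) :
  (forall j x, H _ _ (@gen j x) = H' _ _ (@gen j x)) -> H = H'.
Proof.
move=> e; apply: smor_eq => a b q; have [w <-] := cls_surj q.
elim: w => [j x|j x t w IH]; first exact: e.
rewrite -[cls (wc x w)](qcomp_cls (w1 x) w) -[qcomp _ _]/(@scomp _ presented _ _ _ _ _).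
by rewrite !s1_comp IH [s1 H _]e.
Qed.

End Presented.

(** * Universal properties of flows and their effect on states *)

Lemma pushoutP (A B C D : flow) (i : mor A B) (j : mor A C) (p : mor B D) (q : mor C D) :
  is_pushout i j p q <->
  [/\ cg_flow D, mcomp p i = mcomp q j &
   forall Z : flow, cg_flow Z ->
   forall (p' : mor B Z) (q' : mor C Z), mcomp p' i = mcomp q' j ->
   exists h : mor D Z,
     [/\ mcomp h p = p', mcomp h q = q' &
      forall h' : mor D Z, mcomp h' p = p' -> mcomp h' q = q' -> h' = h]].
Proof.
split=> -[cD e u]; split=> //.
- exact: mor_eq.
- move=> Z cZ p' q' /meq_refl /(u Z cZ) [h [hp hq hu]]; exists h.
  split; [exact: mor_eq | exact: mor_eq | move=> h' e1 e2; apply: mor_eq].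
  by apply: hu; exact: meq_refl.
- exact: meq_refl.
- move=> Z cZ p' q' /mor_eq /(u Z cZ) [h [hp hq hu]]; exists h.
  split; [exact: meq_refl | exact: meq_refl | move=> h' /mor_eq e1 /mor_eq e2].
  by rewrite (hu h').
Qed.

Lemma colimP (O : Type) (lt : O -> O -> Prop) (P : O -> Prop)
    (X : O -> flow) (map : forall o1 o2, lt o1 o2 -> mor (X o1) (X o2))
    (L : flow) (c : forall o, P o -> mor (X o) L) :
  is_colim map c <->
  [/\ cg_flow L,
   (forall o1 o2 (h : lt o1 o2) (p1 : P o1) (p2 : P o2),
       mcomp (c o2 p2) (map o1 o2 h) = c o1 p1) &
   forall Z : flow, cg_flow Z ->
   forall c' : forall o, P o -> mor (X o) Z,
     (forall o1 o2 (h : lt o1 o2) (p1 : P o1) (p2 : P o2),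
         mcomp (c' o2 p2) (map o1 o2 h) = c' o1 p1) ->
     exists u : mor L Z,
       (forall o (p : P o), mcomp u (c o p) = c' o p) /\
       forall u' : mor L Z, (forall o (p : P o), mcomp u' (c o p) = c' o p) -> u' = u].
Proof.
split=> -[cL e u]; split=> //.
- by move=> o1 o2 h p1 p2; exact: mor_eq.
- move=> Z cZ c' ec; have [|h [h1 h2]] := u Z cZ c'.
    by move=> o1 o2 h p1 p2; apply: meq_refl.
  exists h; split=> [x p|u' eu]; first exact: mor_eq.
  by apply: mor_eq; apply: h2 => o p; exact: meq_refl.
- by move=> o1 o2 h p1 p2; exact: meq_refl.
- move=> Z cZ c' ec; have [|h [h1 h2]] := u Z cZ c'.
    by move=> o1 o2 h p1 p2; apply: mor_eq.
  exists h; split=> [x p|u' eu]; first exact: meq_refl.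
  by apply: meq_refl; apply: h2 => o p; exact: mor_eq.
Qed.

Lemma cg_unit : cg_space unitT. Proof. exact: test_cg test_unit. Qed.

Lemma cg_void : cg_space voidT.
Proof. by apply: test_cg; apply: test_empty => x; exact: voidT_empty x. Qed.

Definition truth (P : Prop) : topologicalType := if pselect P then unitT else voidT.

Lemma truthP (P : Prop) (x : truth P) : P.
Proof. by move: x; rewrite /truth; case: (pselect P) => // n x; case: (voidT_empty x). Qed.

Lemma truth_inh (P : Prop) : P -> exists x : truth P, True.
Proof. by rewrite /truth; case: (pselect P) => // p _; exists tt. Qed.

Lemma truth_sub (P : Prop) (x y : truth P) : x = y.
Proof.
move: x y; rewrite /truth; case: (pselect P) => p x y; last by case: (voidT_empty x).
by case: x; case: y.
Qed.

Lemma cg_truth (P : Prop) : cg_space (truth P).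
Proof. by rewrite /truth; case: (pselect P) => p; [exact: cg_unit | exact: cg_void]. Qed.

Section RelFlow.
Variables (T : Type) (Q : T -> T -> Prop).
Hypothesis Qtr : forall a b c, Q a b -> Q b c -> Q a c.

Definition relP (a b : T) : topologicalType := truth (Q a b).

Lemma relP_Q a b (x : relP a b) : Q a b. Proof. exact: truthP x. Qed.

Lemma relP_inh a b : Q a b -> exists x : relP a b, True. Proof. exact: truth_inh. Qed.

Lemma relP_sub a b (x y : relP a b) : x = y. Proof. exact: truth_sub. Qed.

Definition rel_comp a b c (x : relP a b) (y : relP b c) : relP a c :=
  sval (cid (relP_inh (Qtr (relP_Q x) (relP_Q y)))).

(** A transitive relation seen as a flow with at most one path between two states, so that a
    morphism into it is merely a map of states respecting the relation. *)
Definition rel_flow : flow.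
Proof.
refine (@Flow T relP rel_comp _ _).
- by move=> a b c d x y z; exact: relP_sub.
- move=> a b c K g _ _ k.
  rewrite (_ : (fun _ => _) = cst (rel_comp (g k).1 (g k).2)); first exact: cst_continuous.
  by apply: funext => ?; exact: relP_sub.
Defined.

Lemma cg_rel_flow : cg_flow rel_flow.
Proof. by move=> a b; exact: cg_truth. Qed.

Lemma rel_flow_mor (X : flow) (u : fst_ X -> T) :
  (forall a b (x : fP X a b), Q (u a) (u b)) ->
  exists f : mor X rel_flow, m0 f = u.
Proof.
move=> hQ.
pose f1 a b (x : fP X a b) : fP rel_flow (u a) (u b) := sval (cid (relP_inh (hQ a b x))).
have f1c a b : continuous (@f1 a b).
  move=> x; rewrite (_ : @f1 a b = cst (f1 a b x)); first exact: cst_continuous.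
  by apply: funext => ?; exact: relP_sub.
by exists (@Mor X rel_flow u f1 f1c (fun _ _ _ _ _ => relP_sub _ _)).
Qed.

Lemma rel_flow_eq (X : flow) (f g : mor X rel_flow) : m0 f =1 m0 g -> f = g.
Proof.
case: f g => [f0 f1 fc fm] [g0 g1 gc gm] /= /funext e; subst g0.
by apply: mor_eq; split=> //= a b x; congr pin; exact: relP_sub.
Qed.

End RelFlow.

(** Any map from the states to [T] underlies a morphism to the indiscrete flow on [T], so the
    uniqueness clause of the universal property applies to it. *)
Lemma pushout_states (A B C D : flow) (i : mor A B) (j : mor A C) (p : mor B D) (q : mor C D)
    (T : Type) (u v : fst_ D -> T) :
  is_pushout i j p q ->
  (forall b, u (m0 p b) = v (m0 p b)) -> (forall c, u (m0 q c) = v (m0 q c)) -> u =1 v.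
Proof.
case/pushoutP => cD e univ ep eq_ d.
pose Z := @rel_flow T (fun _ _ => True) (fun _ _ _ _ _ => Logic.I).
have cZ : cg_flow Z by exact: cg_rel_flow.
have [f fu] : exists f : mor D Z, m0 f = u by exact: rel_flow_mor.
have [g gv] : exists g : mor D Z, m0 g = v by exact: rel_flow_mor.
have [|h [_ _ uq]] := univ Z cZ (mcomp f p) (mcomp f q); first by rewrite -!mcompA e.
suff -> : u = v by [].
rewrite -fu -gv (uq f) // (uq g) //; apply: rel_flow_eq => x /=; by rewrite fu gv.
Qed.

Lemma colim_states (O : Type) (lt : O -> O -> Prop) (P : O -> Prop)
    (X : O -> flow) (map : forall o1 o2, lt o1 o2 -> mor (X o1) (X o2))
    (L : flow) (c : forall o, P o -> mor (X o) L) (T : Type) (u v : fst_ L -> T) :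
  is_colim map c ->
  (forall o p a, u (m0 (c o p) a) = v (m0 (c o p) a)) -> u =1 v.
Proof.
case/colimP => cD e univ ep d.
pose Z := @rel_flow T (fun _ _ => True) (fun _ _ _ _ _ => Logic.I).
have cZ : cg_flow Z by exact: cg_rel_flow.
have [f fu] : exists f : mor L Z, m0 f = u by exact: rel_flow_mor.
have [g gv] : exists g : mor L Z, m0 g = v by exact: rel_flow_mor.
have [|h [_ uq]] := univ Z cZ (fun o p => mcomp f (c o p)).
  by move=> o1 o2 l p1 p2; rewrite -mcompA e.
suff -> : u = v by [].
by rewrite -fu -gv (uq f) // (uq g) // => o p; apply: rel_flow_eq => x /=; rewrite fu gv.
Qed.

(** Opcartesian for the functor of states, tested on compactly generated targets: the paths of [B]
    are generated by those of [A], with only the composites forced by the new states. *)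
Definition cocart (A B : flow) (f : mor A B) : Prop :=
  forall Z : flow, cg_flow Z -> forall (h : mor A Z) (tau : fst_ B -> fst_ Z),
  (forall a, tau (m0 f a) = m0 h a) ->
  exists h' : mor B Z, [/\ m0 h' =1 tau, mcomp h' f = h &
    forall h'' : mor B Z, m0 h'' =1 tau -> mcomp h'' f = h -> h'' = h'].

Definition set_to (T : Type) (Z : flow) (s : T -> fst_ Z) : mor (set_flow T) Z.
Proof.
refine (@Mor (set_flow T) Z s (fun a b x => match voidT_empty x with end) _ _).
- by move=> a b; apply: continuous_from_empty => x; exact: voidT_empty x.
- by move=> a b c x; case: (voidT_empty x).
Defined.

Lemma set_flow_eq (T : Type) (Z : flow) (f g : mor (set_flow T) Z) :
  m0 f =1 m0 g -> f = g.
Proof. by move=> e; apply: mor_eq; split=> // a b x; case: (voidT_empty x). Qed.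

Lemma pushout_set_cocart (S T : Type) (w : S -> T) (C D : flow)
    (a : mor (set_flow S) C) (b : mor (set_flow T) D) (f : mor C D) :
  is_pushout (set_mor w) a b f -> cocart f.
Proof.
move=> po Z cZ h tau et; have /pushoutP [cD e univ] := po.
have [|h' [h1 h2 h3]] := univ Z cZ (set_to (fun t => tau (m0 b t))) h.
  apply: set_flow_eq => s /=; rewrite -et; congr tau.
  by move/(congr1 (fun g => m0 g s)): e.
exists h'; split=> //.
  apply: (pushout_states po) => [t|c]; last by rewrite et -h2.
  by move/(congr1 (fun g => m0 g t)): h1.
move=> h'' t'' e''; apply: h3 => //; apply: set_flow_eq => t /=; exact: t''.
Qed.

(** * Well-ordered sequences *)

Section WellOrder.
Variables (O : Type) (lt : O -> O -> Prop) (o0 : O).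
Hypothesis wo : well_order_from lt o0.

Lemma wo_irr o : ~ lt o o.
Proof.
case: wo => wf _ _ _; elim: (wf o) => {}o _ IH l; exact: (IH o l l).
Qed.

Lemma wo_asym a b : lt a b -> ~ lt b a.
Proof. by case: wo => _ tr _ _ ab ba; exact: wo_irr (tr _ _ _ ab ba). Qed.

Lemma wo_cases o : [\/ o = o0, exists o1, is_succ lt o1 o | is_limit lt o0 o].
Proof.
have [->|n0] := pselect (o = o0); first by constructor 1.
have [l|nl] := pselect (is_limit lt o0 o); first by constructor 3.
constructor 2; apply: contrapT => ns; apply: nl; split=> // o' l.
by apply: contrapT => nb; apply: ns; exists o'.
Qed.

Lemma wo_min (P : O -> Prop) : (exists o, P o) -> exists o, P o /\ forall o', P o' -> o = o' \/ lt o o'.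
Proof.
case: wo => wf _ tot _ [x Px]; apply: contrapT => n.
elim: (wf x) Px => {}x _ IH Px; apply: n; exists x; split=> // o' Po'.
have [->|[|l]] := tot x o'; [by left | by right | by case: (IH o' l Po')].
Qed.

Lemma succ_le o1 o2 o : is_succ lt o1 o2 -> lt o o2 -> o = o1 \/ lt o o1.
Proof.
case: wo => wf tr tot _ [l nb] lo; have [->|[|l']] := tot o o1; [by left|by right|].
by case: nb; exists o.
Qed.

Lemma succ_inj_l a b o : is_succ lt a o -> is_succ lt b o -> a = b.
Proof.
move=> sa sb; have [->//|lab] := succ_le sb (proj1 sa).
by have [//|lba] := succ_le sa (proj1 sb); case: (wo_asym lab lba).
Qed.

Lemma succ_inj_r o a b : is_succ lt o a -> is_succ lt o b -> a = b.
Proof.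
case: wo => wf tr tot _ sa sb; have [//|[l|l]] := tot a b.
  by case: sb => _ []; exists a; split => //; case: sa.
by case: sa => _ []; exists b; split => //; case: sb.
Qed.

Variables (X : O -> flow) (map : forall o1 o2, lt o1 o2 -> mor (X o1) (X o2)).

(** Transition maps are indexed by strict inequalities only; adding the identity at the maximum
    gives every stage a map to the last one. *)
Lemma maps_to_max (m : O) : (forall o, o = m \/ lt o m) ->
  exists r : forall o, mor (X o) (X m), r m = idmor (X m) /\ forall o (l : lt o m), r o = map l.
Proof.
move=> mx.
have H o : exists g : mor (X o) (X m),
    (forall e : m = o, g = eq_rect m (fun o => mor (X o) (X m)) (idmor (X m)) o e) /\
    forall l : lt o m, g = map l.
  have [e|l] := mx o.
    subst o; exists (idmor _); split=> [e|l]; last by case: (wo_irr l).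
    by rewrite (Prop_irrelevance e erefl).
  exists (map l); split=> [e|l']; last by rewrite (Prop_irrelevance l' l).
  by subst o; case: (wo_irr l).
exists (fun o => sval (cid (H o))); split.
  by have [/(_ erefl)] := svalP (cid (H m)).
by move=> o l; have [_] := svalP (cid (H o)); exact.
Qed.

End WellOrder.

(** * Towers *)

(* The last stage of a tower is the flow itself. Apart from the attachment of a
   globe, all steps (a new state, the identification of two states, the passage
   to the last stage) are covered by being cocartesian over the maps of states. *)
Record tower := Tower {
  tO : Type;
  tlt : tO -> tO -> Prop;
  t0 : tO;
  ttop : tO;
  twf : well_order_from tlt t0;
  ttop_max : forall o, o = ttop \/ tlt o ttop;
  tF : tO -> flow;
  tmap : forall o1 o2, tlt o1 o2 -> mor (tF o1) (tF o2);
  tmapD : forall o1 o2 o3 (h12 : tlt o1 o2) (h23 : tlt o2 o3) (h13 : tlt o1 o3),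
      mcomp (tmap h23) (tmap h12) = tmap h13;
  tempty : fst_ (tF t0) -> False;
  tcg : forall o, cg_flow (tF o);
  tsucc : forall o1 o2 (h : tlt o1 o2), is_succ tlt o1 o2 ->
      (exists n (a : mor (glob (Sphere n)) (tF o1)) (b : mor (glob (Disk n)) (tF o2)),
         is_pushout (glob_incl n) a b (tmap h)) \/ cocart (tmap h);
  tlim : forall o, is_limit tlt t0 o ->
      @is_colim tO tlt (fun o' => tlt o' o) tF tmap (tF o) (fun o' h => tmap h) }.

Lemma K_pushout_Iglp (C D : flow) (f : mor C D) : K_pushout Iglp f ->
  (exists n (a : mor (glob (Sphere n)) C) (b : mor (glob (Disk n)) D),
         is_pushout (glob_incl n) a b f) \/ cocart f.
Proof.
case=> A [B [k [a [b [Kk po]]]]]; case: A B k / Kk a b po => [n||] a b po.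
- by left; exists n, a, b.
- by right; exact: pushout_set_cocart po.
- by right; exact: pushout_set_cocart po.
Qed.

Section CellTower.
Variables (Y : flow) (O : Type) (lt : O -> O -> Prop) (o0 : O) (X : O -> flow)
  (map : forall o1 o2, lt o1 o2 -> mor (X o1) (X o2)) (c : forall o, mor (X o) Y).
Hypothesis wo : well_order_from lt o0.
Hypothesis mapD : forall o1 o2 o3 (h12 : lt o1 o2) (h23 : lt o2 o3) (h13 : lt o1 o3),
  mcomp (map h23) (map h12) = map h13.
Hypothesis Hsucc : forall o1 o2 (h : lt o1 o2), is_succ lt o1 o2 ->
  K_pushout Iglp (map h).
Hypothesis Hlim : forall o, is_limit lt o0 o ->
  @is_colim O lt (fun o' => lt o' o) X map (X o) (fun o' h => map h).
Hypothesis Hcolim : @is_colim O lt (fun _ => True) X map Y (fun o _ => c o).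
Hypothesis Hempty : fst_ (X o0) -> False.

(** [None] is a new largest index and carries [Y], so that maps out of [Y] come from the same
    recursion as maps out of the stages. *)
Definition lt_top (x y : option O) : Prop :=
  match x, y with
  | Some a, Some b => lt a b
  | Some _, None => True
  | None, _ => False
  end.

Definition F_top (x : option O) : flow := match x with Some o => X o | None => Y end.

Definition map_top (x y : option O) : lt_top x y -> mor (F_top x) (F_top y) :=
  match x, y return lt_top x y -> mor (F_top x) (F_top y) with
  | Some a, Some b => fun h => map h
  | Some a, None => fun _ => c a
  | None, _ => fun h => match h with end
  end.

Lemma lt_top_wo : well_order_from lt_top (Some o0).
Proof.
case: wo => wf tr tot mn; split.
- have wfS o : Acc lt_top (Some o).
    by elim: (wf o) => {}o _ IH; constructor => -[y|//] /IH.
  by case=> [ o|]; [exact: wfS | constructor => -[y|//] _; exact: wfS].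
- by move=> [x|] [y|] [z|] //=; exact: tr.
- move=> [x|] [y|] /=; [|by right; left|by right; right|by left].
  by have [->|[|]] := tot x y; [left|right; left|right; right].
- by move=> [y|] //= n; apply: mn => e; apply: n; rewrite e.
Qed.

Lemma Hc o1 o2 (h : lt o1 o2) : mcomp (c o2) (map h) = c o1.
Proof. by case/colimP: Hcolim => _ e _; exact: e. Qed.

Lemma cg_stage o : cg_flow (X o).
Proof.
have [->|[ o1 s]|l] := wo_cases lt o0 o.
- by move=> a; case: (Hempty a).
- by have [A [B [k [a [b [_ /pushoutP [cg _ _]]]]]]] := Hsucc (proj1 s) s.
- by have /colimP [] := Hlim l.
Qed.

(** Here the original index has a largest element [o], so the colimit [Y] is [X o] up to isomorphism
    and [h] extends uniquely. Agreement with [tau] is then automatic, all states of [Y] coming from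
    stages. *)
Lemma cocart_top o : is_succ lt_top (Some o) None -> cocart (c o).
Proof.
move=> [_ nb]; have mx o' : o' = o \/ lt o' o.
  case: wo => _ _ tot _; have [|[|l]] := tot o' o; [by left|by right|].
  by case: nb; exists (Some o').
have [r [r1 r2]] := maps_to_max wo map mx.
have rD o1 o2 (l : lt o1 o2) : mcomp (r o2) (map l) = r o1.
  have [_ tr _ _] := wo; have [e|l2] := mx o2; last by rewrite (r2 _ l2) (mapD _ _ (tr _ _ _ l l2)) (r2 _ (tr _ _ _ l l2)).
  by subst o2; rewrite r1 mcomp1m (r2 _ l).
have cr o' : mcomp (c o) (r o') = c o'.
  have [e|l2] := mx o'; last by rewrite (r2 _ l2) Hc.
  by subst o'; rewrite r1 mcompm1.
move=> Z cZ h tau et; have /colimP [_ _ univ] := Hcolim.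
have [|h' [h1 h2]] := univ Z cZ (fun o' _ => mcomp h (r o')).
  by move=> o1 o2 l _ _; rewrite -mcompA rD.
exists h'; split.
- apply: (colim_states Hcolim) => o' _ a.
  have /(congr1 (fun g => m0 g a)) /= -> := h1 o' Logic.I.
  rewrite -et; congr tau.
  by move/(congr1 (fun g => m0 g a)): (cr o').
- by rewrite (h1 o Logic.I) r1 mcompm1.
- by move=> h'' _ e; apply: h2 => o' _; rewrite -cr mcompA e.
Qed.

Lemma tower_of_cells : exists t : tower, tF (ttop t) = Y.
Proof.
have D o1 o2 o3 (h12 : lt_top o1 o2) (h23 : lt_top o2 o3) (h13 : lt_top o1 o3) :
    mcomp (map_top h23) (map_top h12) = map_top h13.
  by move: o1 o2 o3 h12 h23 h13 => [ o1|] [ o2|] [ o3|] //= h12 h23 h13; exact: Hc.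
have C o : cg_flow (F_top o).
  by case: o => [ o|] /=; [exact: cg_stage | case/colimP: Hcolim].
have succ_top a b : is_succ lt_top (Some a) (Some b) -> is_succ lt a b.
  by move=> [l nb]; split => // -[x [x1 x2]]; apply: nb; exists (Some x).
have S o1 o2 (h : lt_top o1 o2) : is_succ lt_top o1 o2 ->
    (exists n (a : mor (glob (Sphere n)) (F_top o1)) (b : mor (glob (Disk n)) (F_top o2)),
       is_pushout (glob_incl n) a b (map_top h)) \/ cocart (map_top h).
  move: o1 o2 h => [ o1|] [ o2|] //= h s; last by right; exact: cocart_top.
  by apply: K_pushout_Iglp; apply: Hsucc; exact: succ_top.
have L o : is_limit lt_top (Some o0) o ->
    @is_colim _ lt_top (fun o' => lt_top o' o) F_top map_top (F_top o) (fun o' h => map_top h).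
  move=> [n0 lim]; case: o n0 lim => [ o|] n0 lim.
    have l : is_limit lt o0 o.
      split=> [e|o' lo']; first by rewrite e in n0.
      by have [[x|] hx] := lim (Some o') lo'; [exists x | case: hx].
    have /colimP [cg e univ] := Hlim l.
    apply/colimP; split=> //.
    move=> Z cZ c' ec; have [|u [u1 u2]] := univ Z cZ (fun o' p => c' (Some o') p).
      by move=> a b h p1 p2; exact: (ec (Some a) (Some b)).
    exists u; split=> [[a|] p //|u' eu']; first exact: u1.
    by apply: u2 => a p; exact: (eu' (Some a)).
  have /colimP [cg e univ] := Hcolim.
  apply/colimP; split=> //.
  move=> Z cZ c' ec; have [|u [u1 u2]] := univ Z cZ (fun o' _ => c' (Some o') Logic.I).
    by move=> a b h p1 p2; exact: (ec (Some a) (Some b)).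
  exists u; split=> [[a|] [] //|u' eu']; first exact: u1.
  by apply: u2 => a p; exact: (eu' (Some a)).
have mx o : o = None \/ lt_top o None by case: o => [ o|]; [right|left].
by exists (Tower lt_top_wo mx D Hempty C S L).
Qed.

End CellTower.

Lemma cell_flow_tower (Y : flow) : cell_flow Y -> exists t : tower, tF (ttop t) = Y.
Proof.
case=> O [lt [ o0 [X [map [c [iota [wo D [Hs Hl] Hc [[g [_ ig]] _]]]]]]]].
apply: (tower_of_cells wo _ Hs Hl Hc) => [ o1 o2 o3 h12 h23 h13|a].
  by apply: mor_eq; exact: D.
by case: (m0 g a).
Qed.

Section TowerMaps.
Variable t : tower.
Local Notation tl := (@tlt t).

Lemma tlt_trans o1 o2 o3 : tl o1 o2 -> tl o2 o3 -> tl o1 o3.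
Proof. by case: (twf t) => _ tr _ _; exact: tr. Qed.

Lemma tower_cmap : exists c : forall o, mor (tF o) (tF (ttop t)),
  c (ttop t) = idmor _ /\ forall o1 o2 (l : tl o1 o2), mcomp (c o2) (tmap l) = c o1.
Proof.
have [r [r1 r2]] := maps_to_max (twf t) (@tmap t) (@ttop_max t).
exists r; split=> // o1 o2 l.
have [e|l2] := ttop_max o2; last by rewrite (r2 _ l2) (tmapD _ _ (tlt_trans l l2)) (r2 _ (tlt_trans l l2)).
by subst o2; rewrite r1 mcomp1m (r2 _ l).
Qed.

Lemma tower_ext (Z : flow) (Rule : forall o, mor (tF o) Z -> Prop) :
  cg_flow Z ->
  (exists h, Rule (t0 t) h) ->
  (forall o1 o2 (l : tl o1 o2) (h1 : mor (tF o1) Z), is_succ (@tlt t) o1 o2 -> Rule o1 h1 ->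
     exists h2 : mor (tF o2) Z, mcomp h2 (tmap l) = h1 /\ Rule o2 h2) ->
  (forall o (h : mor (tF o) Z), is_limit (@tlt t) (t0 t) o ->
     (forall o' (l : tl o' o), Rule o' (mcomp h (tmap l))) -> Rule o h) ->
  exists h : forall o, mor (tF o) Z,
    (forall o, Rule o (h o)) /\
    forall o1 o2 (l : tl o1 o2), mcomp (h o2) (tmap l) = h o1.
Proof.
move=> cZ base succ lim.
(* Asking the new map to restrict to all maps chosen before makes the family coherent, hence a
   cocone at limit stages. [step] returns [None] when no such map exists, a case that [H] excludes
   afterwards. *)
pose spec o (rec : forall o', tl o' o -> option (mor (tF o') Z)) (h : mor (tF o) Z) :=
  Rule o h /\ forall o' (l : tl o' o), rec o' l = Some (mcomp h (tmap l)).
pose step o rec : option (mor (tF o) Z) :=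
  if pselect (exists h, spec o rec h) is left e then Some (sval (cid e)) else None.
have wf : well_founded (@tlt t) by case: (twf t).
pose f := Fix wf (fun o => option (mor (tF o) Z)) step.
have fE o : f o = step o (fun o' _ => f o').
  rewrite /f Fix_eq // => x g g' e; congr step.
  by apply: functional_extensionality_dep => y; apply: functional_extensionality_dep => p.
have H o : exists h, f o = Some h /\ spec o (fun o' _ => f o') h.
  elim: (wf o) => {}o _ IH.
  suff [h sh] : exists h, spec o (fun o' _ => f o') h.
    rewrite fE /step; case: pselect => [e|[]]; last by exists h.
    by exists (sval (cid e)); split=> //; exact: svalP (cid e).
  have [e|[ o1 s]|l] := wo_cases (@tlt t) (t0 t) o.
  - subst o; have [h Rh] := base; exists h; split=> // o' l.
    have [_ _ _ mn] := twf t; have [e|n] := pselect (o' = t0 t).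
      by subst o'; case: (wo_irr (twf t) l).
    by case: (wo_asym (twf t) l (mn _ n)).
  - have [h1 [f1 [R1 c1]]] := IH o1 (proj1 s).
    have [h2 [e2 R2]] := succ o1 o (proj1 s) h1 s R1.
    exists h2; split=> // o' l; have [e|l'] := succ_le (twf t) s l.
      by subst o'; rewrite (Prop_irrelevance l (proj1 s)) e2.
    by rewrite -(tmapD l' (proj1 s) l) mcompA e2 -c1.
  - pose g o' (l : tl o' o) := sval (cid (IH o' l)).
    have gP o' (l : tl o' o) := svalP (cid (IH o' l)).
    have gc o1 o2 (h : tl o1 o2) (p1 : tl o1 o) (p2 : tl o2 o) :
        mcomp (g o2 p2) (tmap h) = g o1 p1.
      have [e1 [R1 c1]] := gP o1 p1; have [e2 [R2 c2]] := gP o2 p2.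
      by have := c2 o1 h; rewrite e1 => -[].
    have /colimP [_ _ univ] := tlim l.
    have [u [u1 _]] := univ Z cZ g gc.
    exists u; split=> [|o' l']; last by rewrite u1; have [] := gP o' l'.
    by apply: lim => // o' l'; rewrite u1; have [_ []] := gP o' l'.
exists (fun o => sval (cid (H o))); split=> [ o|o1 o2 l].
  by have [_ []] := svalP (cid (H o)).
have [e1 _] := svalP (cid (H o1)).
have [_ [_ /(_ o1 l) e2]] := svalP (cid (H o2)).
by have := etrans (esym e1) e2; case.
Qed.

End TowerMaps.

(** * The edges at the extra state *)

(* Rectangular bands: the value of a map into [band d] on a path depends only on
   its class in the branching space (d = true) or the merging space (d = false). *)
Definition band (d : bool) : flow.
Proof.
refine (@Flow unit (fun _ _ => R) (fun _ _ _ x y => if d then x else y) _ _).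
- by case: d.
- move=> _ _ _ K g _ gc; case: d => x.
    apply: (@continuous_comp _ _ _ g fst); [exact: gc | exact: cvg_fst].
  apply: (@continuous_comp _ _ _ g snd); [exact: gc | exact: cvg_snd].
Defined.

Lemma cg_band d : cg_flow (band d).
Proof. by move=> a b; exact: R_cg. Qed.

Definition band_zero d (X : flow) : mor X (band d).
Proof.
refine (@Mor X (band d) (fun=> tt) (fun _ _ _ => 0 : R) _ _).
- by move=> a b; exact: cst_continuous.
- by move=> a b c x y /=; case: d.
Defined.

Definition bval d (X : flow) (h : mor X (band d)) (u : Ptot X) : R := m1 h (projT2 u).

Lemma bval_comp d (X Y : flow) (f : mor X Y) (h : mor Y (band d)) u :
  bval (mcomp h f) u = bval h (pmap f u).
Proof. by []. Qed.

Lemma band_eq d (X : flow) (f g : mor X (band d)) : (forall u, bval f u = bval g u) -> f = g.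
Proof.
move=> e; apply: mor_eq; split=> [a|a b x]; first by case: (m0 f a); case: (m0 g a).
have {e} := e (pin x); rewrite /bval /=.
move: (m1 f x) (m1 g x); case: (m0 f a); case: (m0 g a); case: (m0 f b); case: (m0 g b).
by move=> u v /= ->.
Qed.

Lemma bval_br (X : flow) (h : mor X (band true)) u v : br_equiv u v -> bval h u = bval h v.
Proof.
elim=> {u v} [u v [a [b [c [x [y [-> ->]]]]]]|//|u v _ ->//|u v w _ -> _ -> //].
by rewrite /bval /= m1_comp.
Qed.

Lemma bval_mg (X : flow) (h : mor X (band false)) u v : mg_equiv u v -> bval h u = bval h v.
Proof.
elim=> {u v} [u v [a [b [c [x [y [-> ->]]]]]]|//|u v _ ->//|u v w _ -> _ -> //].
by rewrite /bval /= m1_comp.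
Qed.

Definition glob_to (Z : flow) (K : topologicalType) (s t : fst_ Z) (d : K -> fP Z s t)
  (dc : continuous d) : mor (glob K) Z.
Proof.
refine (@Mor (glob K) Z (fun b => if b then t else s)
  (fun a b => match a, b return glob_P K a b -> fP Z (if a then t else s) (if b then t else s) with
   | false, true => d
   | true, true | false, false | true, false => fun x => match voidT_empty x with end end) _ _).
- case=> [] [] //; apply: continuous_from_empty => x; exact: voidT_empty x.
- by move=> a b c x y; case: (glob_no_compose x y).
Defined.

Lemma glob_mor_eq (K : topologicalType) (Z : flow) (f g : mor (glob K) Z) :
  m0 f =1 m0 g ->
  (forall x : K, pin (@m1 _ _ f false true x) = pin (@m1 _ _ g false true x)) -> f = g.
Proof.
move=> e0 e1; apply: mor_eq; split=> // -[] [] x; try by case: (voidT_empty x).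
exact: e1.
Qed.

Section Cells.
Variable t : tower.
Local Notation tl := (@tlt t).
Local Notation F := (@tF t).
Local Notation Y := (tF (ttop t)).

Record gcell (o1 o2 : tO t) := GCell {
  gl : tl o1 o2;
  gs : is_succ tl o1 o2;
  gn : nat;
  ga : mor (glob (Sphere gn)) (F o1);
  gb : mor (glob (Disk gn)) (F o2);
  gpo : is_pushout (glob_incl gn) ga gb (tmap gl) }.

(** A step may be presented as the attachment of a globe in several ways; one presentation is fixed,
    so that one can speak of the cell of a step. *)
Definition sel (o1 o2 : tO t) : option (gcell o1 o2) :=
  if pselect (exists c : gcell o1 o2, True) is left e then Some (sval (cid e)) else None.

Lemma sel_none (o1 o2 : tO t) (l : tl o1 o2) :
  is_succ tl o1 o2 -> sel o1 o2 = None -> cocart (tmap l).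
Proof.
move=> s; rewrite /sel; case: pselect => // ne _.
have [[n [a [b po]]]|//] := tsucc l s.
by case: ne; exists (GCell s po).
Qed.

Definition cm : forall o, mor (F o) Y := sval (cid (tower_cmap t)).

Lemma cm_top : cm (ttop t) = idmor _.
Proof. by have [] := svalP (cid (tower_cmap t)). Qed.

Lemma cm_map o1 o2 (l : tl o1 o2) : mcomp (cm o2) (tmap l) = cm o1.
Proof. by have [_] := svalP (cid (tower_cmap t)); exact. Qed.

Lemma cm_map0 o1 o2 (l : tl o1 o2) a : m0 (cm o2) (m0 (tmap l) a) = m0 (cm o1) a.
Proof. by rewrite -(cm_map l). Qed.

Section OneCell.
Variables (o1 o2 : tO t) (c : gcell o1 o2).

Lemma gcell_eq : mcomp (gb c) (glob_incl (gn c)) = mcomp (tmap (gl c)) (ga c).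
Proof. by case/pushoutP: (gpo c). Qed.

Lemma gcell_st b : m0 (gb c) b = m0 (tmap (gl c)) (m0 (ga c) b).
Proof. exact: (congr1 (fun f : mor (glob (Sphere (gn c))) (F o2) => m0 f b) gcell_eq). Qed.

Definition cend (b : bool) : fst_ Y := m0 (cm o2) (m0 (gb c) b).

Lemma cendE b : cend b = m0 (cm o1) (m0 (ga c) b).
Proof. by rewrite /cend gcell_st cm_map0. Qed.

Definition cpt (x : Disk (gn c)) : Ptot (F o2) := pin (@m1 _ _ (gb c) false true x).

Definition cbd (x : Sphere (gn c)) : Ptot (F o1) := pin (@m1 _ _ (ga c) false true x).

Lemma cbdE x : pmap (tmap (gl c)) (cbd x) = cpt (set_val x).
Proof.
exact: (esym (congr1 (fun f : mor (glob (Sphere (gn c))) (F o2) =>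
  pmap f (@pin (glob (Sphere (gn c))) false true x)) gcell_eq)).
Qed.
End OneCell.
Arguments cend {o1 o2} c b.
Arguments cpt {o1 o2} c x.
Arguments cbd {o1 o2} c x.

Lemma tower_states_succ (o1 o2 : tO t) (c : gcell o1 o2) (T : Type) (u v : fst_ (F o2) -> T) :
  (forall a, u (m0 (tmap (gl c)) a) = v (m0 (tmap (gl c)) a)) -> u =1 v.
Proof.
move=> e; apply: (pushout_states (gpo c)) => // b.
by rewrite gcell_st.
Qed.

(** A morphism to the flow of the relation [Q] is built stage by stage over the maps of states to
    [Y]. A globe can be mapped as soon as its ends are related, and the other steps impose
    nothing. *)
Lemma paths_related (Q : fst_ Y -> fst_ Y -> Prop) :
  (forall a b c, Q a b -> Q b c -> Q a c) ->
  (forall o1 o2 (c : gcell o1 o2), sel o1 o2 = Some c -> Q (cend c false) (cend c true)) ->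
  forall a b (x : fP Y a b), Q a b.
Proof.
move=> Qtr Qc a b x.
have cZ : cg_flow (rel_flow Qtr) by exact: cg_rel_flow.
have [|||h [h1 _]] := @tower_ext t (rel_flow Qtr) (fun o h => m0 h =1 m0 (cm o)) cZ.
- have [|h e] := @rel_flow_mor _ _ Qtr (F (t0 t)) (fun a => match tempty a with end).
    by move=> y; case: (tempty y).
  by exists h => y; case: (tempty y).
- move=> o1 o2 l h1 s R1; case E : (sel o1 o2) => [c|].
    pose u (b : bool) := cend c b.
    have [|p' ep] := @rel_flow_mor _ _ Qtr (glob (Disk (gn c))) u.
      by move=> [] [] //= y; exact: Qc.
    have [_ _ univ] := (pushoutP _ _ _ _).1 (gpo c).
    have [|h2 [e1 e2 _]] := univ _ cZ p' h1.
      by apply: rel_flow_eq => b' /=; rewrite ep R1 /u cendE.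
    exists h2; split; first by rewrite -e2 (Prop_irrelevance l (gl c)).
    apply: (tower_states_succ (c := c)) => y.
    by rewrite cm_map0 -R1 -e2.
  have [|h2 [e1 e2 _]] := sel_none (l := l) s E cZ (h := h1) (tau := m0 (cm o2)).
    by move=> y; rewrite cm_map0 R1.
  by exists h2.
- move=> o h l Rl; apply: (colim_states (tlim l)) => o' p y.
  by rewrite cm_map0; exact: Rl.
move: (relP_Q (m1 (h (ttop t)) x)); rewrite !h1 cm_top; exact.
Qed.

(** The map is zero up to stage [p]. From there on, the values on the boundary of each new globe are
    given, and [disk_extension] leaves the value at the center free: 1 for the cell attached at [p],
    0 for every other one. The remaining steps leave no choice, a band having a single state. *)
Lemma band_test d (p q : tO t) (c0 : gcell p q) :
  exists h : forall o, mor (F o) (band d),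
  [/\ forall o1 o2 (l : tl o1 o2), mcomp (h o2) (tmap l) = h o1,
      forall o1 o2 (c : gcell o1 o2), sel o1 o2 = Some c ->
        bval (h o2) (cpt c (center (gn c))) = (if pselect (o1 = p) then 1 else 0) &
      forall u, bval (h p) u = 0].
Proof.
have cZ : cg_flow (band d) by exact: cg_band.
pose Rule o (h : mor (F o) (band d)) :=
  (forall o1 (c : gcell o1 o), sel o1 o = Some c ->
     bval h (cpt c (center (gn c))) = if pselect (o1 = p) then 1 else 0) /\
  (~ tl p o -> forall u, bval h u = 0).
have wo := twf t.
have [|||h [h1 h2]] := @tower_ext t (band d) Rule cZ.
- exists (band_zero d _); split=> // o1 c.
  have [_ _ _ mn] := wo; have l := gl c.
  have [e|n] := pselect (o1 = t0 t); first by subst o1; case: (wo_irr wo l).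
  by case: (wo_asym wo l (mn _ n)).
- move=> o1 o2 l h1 s [Ra Rb]; have [lp|nlp] := pselect (tl p o2); last first.
    exists (band_zero d _); split.
      apply: band_eq => u; rewrite Rb // => l1; apply: nlp; exact: tlt_trans l1 l.
    split=> // o1' c _; case: (pselect (o1' = p)) => // e; subst o1'.
    by case: nlp; exact: gl c.
  case E : (sel o1 o2) => [c|].
    have [|g [gc gS g0]] := @disk_extension (gn c) (fun x => bval h1 (cbd c x))
        (if pselect (o1 = p) then 1 else 0).
      have := @m1_cont _ _ (mcomp h1 (ga c)) false true; exact.
    have [_ _ univ] := (pushoutP _ _ _ _).1 (gpo c).
    have [|h2 [e1 e2 _]] := univ _ cZ (@glob_to (band d) _ tt tt g gc) h1.
      apply: glob_mor_eq => [b|x] /=; first by case: b => /=; case: (m0 h1 _).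
      rewrite gS /bval /=.
      by move: (m1 h1 _); case: (m0 h1 _); case: (m0 h1 _).
    exists h2; split; first by rewrite -e2 (Prop_irrelevance l (gl c)).
    split=> [ o1' c' E'|//].
    have e := succ_inj_l wo (gs c') s; subst o1'.
    rewrite E in E'; case: E' => <-; rewrite -g0.
    have : bval h2 (cpt c (center (gn c))) = bval (mcomp h2 (gb c)) (@pin (glob (Disk (gn c))) false true (center _)) by [].
    by move=> ->; rewrite e1.
  have [|h2 [e1 e2 _]] := sel_none (l := l) s E cZ (h := h1) (tau := fun=> tt).
    by move=> y; case: (m0 h1 y).
  exists h2; split=> //; split=> // o1' c' E'.
  have e := succ_inj_l wo (gs c') s; subst o1'.
  by rewrite E in E'.
- move=> o h l Rl; split=> [ o1 c _|np u].
    have [_ nb] := gs c; have [_ lim] := l.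
    by case: nb; exact: lim (gl c).
  (* At a limit stage not beyond [p], the map and the zero map agree on all earlier stages, hence
     are equal. *)
  suff -> : h = band_zero d _ by [].
  have /colimP [_ _ univ] := tlim l.
  have [|v [_ v2]] := univ _ cZ (fun o' p => mcomp h (tmap p)).
    by move=> a b l1 l2 l3; rewrite -mcompA tmapD.
  rewrite (v2 h) // (v2 (band_zero d _)) // => o' l'.
  apply: band_eq => w; have [_ R2] := Rl o' l'.
  by rewrite R2 // => l2; apply: np; exact: tlt_trans l2 l'.
exists h; split=> //.
- by move=> o1 o2 c; have [H _] := h1 o2; exact: H.
- by have [_ H] := h1 p; apply: H; exact: (wo_irr (twf t)).
Qed.

Definition pend (X : flow) (b : bool) (u : Ptot X) : fst_ X := if b then ptgt u else psrc u.

Definition end_singleton (b : bool) (alpha : fst_ Y) : Prop :=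
  if b then Pplus_singleton alpha else Pminus_singleton alpha.

(** The negation pairs targets ([b = true]) with the band where x * y = y, which is constant on
    merging classes, and sources with the band where x * y = x, constant on branching classes. *)
Lemma end_singleton_bval b alpha (h : mor Y (band (~~ b))) u v : end_singleton b alpha ->
  pend b u = alpha -> pend b v = alpha -> bval h u = bval h v.
Proof.
case: b h => h [_ H] /= eu ev; [apply: bval_mg | apply: bval_br]; exact: H.
Qed.

Lemma bval_cm d (h : forall o, mor (F o) (band d)) :
  (forall o1 o2 (l : tl o1 o2), mcomp (h o2) (tmap l) = h o1) ->
  forall o u, bval (h (ttop t)) (pmap (cm o) u) = bval (h o) u.
Proof.
move=> hc o u; rewrite -bval_comp.
have [e|l] := ttop_max o; first by subst o; rewrite cm_top mcompm1.
by rewrite -(hc _ _ l) -(cm_map l) cm_top mcomp1m.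
Qed.

(** The centers of the two cells are equivalent, having the same end [alpha]; but the map of
    [band_test] for [c0] is 1 on the center of [c0] and 0 on the center of a cell attached at
    another stage. *)
Lemma end_cell_unique b alpha (p q : tO t) (c0 : gcell p q) (o1 o2 : tO t) (c : gcell o1 o2) :
  end_singleton b alpha -> sel p q = Some c0 -> sel o1 o2 = Some c ->
  cend c0 b = alpha -> cend c b = alpha -> o1 = p.
Proof.
move=> sg E0 E e0 e; have [h [hc hv _]] := band_test (~~ b) c0.
have H := end_singleton_bval (h (ttop t)) sg (u := pmap (cm q) (cpt c0 (center _)))
  (v := pmap (cm o2) (cpt c (center _))).
have {H} := H _ _; rewrite !bval_cm // (hv _ _ _ E0) (hv _ _ _ E).
case: (pselect (p = p)) => // ?; case: (pselect (o1 = p)) => // ? H.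
have : (1 : R) = 0 by apply: H; case: (b) e0 e.
by move/eqP; rewrite oner_eq0.
Qed.

(** In positive dimension the boundary sphere is nonempty. Its paths have the ends of the cell and
    already exist at stage [p], where the map of [band_test] vanishes, whereas it is 1 at the
    center. *)
Lemma end_cell_dim b alpha (p q : tO t) (c0 : gcell p q) :
  end_singleton b alpha -> sel p q = Some c0 -> cend c0 b = alpha -> gn c0 = 0%N.
Proof.
move=> sg E0 e0; have [h [hc hv hz]] := band_test (~~ b) c0.
case E : (gn c0) => [//|n].
have x : Sphere (gn c0) by rewrite E; exact: Sphere_pos.
have H := end_singleton_bval (h (ttop t)) sg (u := pmap (cm q) (cpt c0 (center _)))
  (v := pmap (cm p) (cbd c0 x)).
have {H} := H _ _; rewrite !bval_cm // (hv _ _ _ E0) hz.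
case: (pselect (p = p)) => // ? H.
have : (1 : R) = 0 by apply: H; move: e0; rewrite ?cendE; case: (b) => //; rewrite -cendE.
by move/eqP; rewrite oner_eq0.
Qed.

(** If no cell joined [alpha] to another state in this direction, the transitive relation [Q] would
    contain the ends of every cell, hence of every path by [paths_related], against the existence of
    [u]. *)
Lemma end_cell_exists (b : bool) (alpha : fst_ Y) (u : Ptot Y) :
  pend b u = alpha -> pend (~~ b) u <> alpha ->
  exists o1 o2 (c : gcell o1 o2),
    [/\ sel o1 o2 = Some c, cend c b = alpha & cend c (~~ b) <> alpha].
Proof.
move=> u1 u2; apply: contrapT => n.
pose Q x y := ~ ((if b then y else x) = alpha /\ (if b then x else y) <> alpha).
apply: (@paths_related Q _ _ _ _ (projT2 u)); last by move: u1 u2; rewrite /pend; case: (b).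
  rewrite /Q; case: (b) => x y z Qxy Qyz [e ne]; [apply: Qyz|apply: Qxy]; split=> // e'.
    by apply: Qxy.
  by apply: Qyz.
move=> o1 o2 c E [e ne]; apply: n; exists o1, o2, c.
by split=> //; move: e ne; case: (b).
Qed.

(* The edge entering alpha has index false, the edge leaving it index true. *)
Lemma edges_exist (alpha : fst_ Y) :
  Pminus_singleton alpha -> Pplus_singleton alpha ->
  (forall b, exists u : Ptot Y, pend b u = alpha /\ pend (~~ b) u <> alpha) ->
  exists (p q : bool -> tO t) (c : forall b, gcell (p b) (q b)),
    [/\ forall b, sel (p b) (q b) = Some (c b), forall b, gn (c b) = 0%N,
        forall b, cend (c b) (~~ b) = alpha, forall b, cend (c b) b <> alpha &
        forall b o1 o2 (c' : gcell o1 o2), sel o1 o2 = Some c' ->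
          cend c' (~~ b) = alpha -> o1 = p b].
Proof.
move=> hm hp hu.
have sg b : end_singleton b alpha by case: b.
have H b : exists x : {p : tO t & {q : tO t & gcell p q}},
    [/\ sel _ _ = Some (projT2 (projT2 x)), cend (projT2 (projT2 x)) (~~ b) = alpha &
        cend (projT2 (projT2 x)) b <> alpha].
  have [u [u1 u2]] := hu (~~ b).
  have [ o1 [ o2 [c [E e ne]]]] := end_cell_exists u1 u2.
  by exists (existT _ o1 (existT _ o2 c)); split=> //; move: ne; rewrite negbK.
pose x b := sval (cid (H b)).
exists (fun b => projT1 (x b)), (fun b => projT1 (projT2 (x b))), (fun b => projT2 (projT2 (x b))).
split=> [b|b|b|b|b o1 o2 c' E' e'].
- by case: (svalP (cid (H b))).
- case: (svalP (cid (H b))) => E e _; exact: (end_cell_dim (sg _) E e).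
- by case: (svalP (cid (H b))).
- by case: (svalP (cid (H b))).
- case: (svalP (cid (H b))) => E e _; exact: (end_cell_unique (sg _) E E' e e').
Qed.

End Cells.
Arguments cend {t o1 o2} c b.
Arguments cpt {t o1 o2} c x.
Arguments cbd {t o1 o2} c x.

(** * Adjoining the edges first *)

(** Isomorphism expressed through compactly generated test objects (see [triv_iso]), the form that
    passes through presentations, restrictions and limits. [scell] and [scolim] do the same for cell
    attachments and colimits over fixed states. *)
Definition triv (S : Type) (A B : sflow S) (f : smor A B) : Prop :=
  forall Z : sflow S, scg Z -> forall h : smor A Z,
  exists h' : smor B Z, smcomp h' f = h /\
    forall h'' : smor B Z, smcomp h'' f = h -> h'' = h'.

Definition scell (S : Type) (A B : sflow S) (f : smor A B) (n : nat) (s u : S)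
    (bd : Sphere n -> sP A s u) (ch : Disk n -> sP B s u) : Prop :=
  [/\ continuous bd, continuous ch, forall x, f _ _ (bd x) = ch (set_val x) &
   forall Z : sflow S, scg Z -> forall (h : smor A Z) (d : Disk n -> sP Z s u),
   continuous d -> (forall x, h _ _ (bd x) = d (set_val x)) ->
   exists h' : smor B Z, [/\ smcomp h' f = h, forall x, h' _ _ (ch x) = d x &
     forall h'' : smor B Z, smcomp h'' f = h -> (forall x, h'' _ _ (ch x) = d x) -> h'' = h']].

Definition scolim (S O : Type) (lt : O -> O -> Prop) (P : O -> Prop) (A : O -> sflow S)
    (n : forall o1 o2, lt o1 o2 -> smor (A o1) (A o2)) (L : sflow S)
    (c : forall o, P o -> smor (A o) L) : Prop :=
  (forall o1 o2 (l : lt o1 o2) (p1 : P o1) (p2 : P o2), smcomp (c o2 p2) (n o1 o2 l) = c o1 p1) /\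
  forall Z : sflow S, scg Z -> forall c' : forall o, P o -> smor (A o) Z,
  (forall o1 o2 (l : lt o1 o2) (p1 : P o1) (p2 : P o2), smcomp (c' o2 p2) (n o1 o2 l) = c' o1 p1) ->
  exists u : smor L Z, (forall o p, smcomp u (c o p) = c' o p) /\
    forall u' : smor L Z, (forall o p, smcomp u' (c o p) = c' o p) -> u' = u.

Lemma pin_cast_fun (K : topologicalType) (X : flow) (a b a' b' : fst_ X) (f : K -> fP X a b) :
  continuous f -> a = a' -> b = b' ->
  exists f' : K -> fP X a' b', continuous f' /\ forall x, pin (f' x) = pin (f x).
Proof. by move=> fc <- <-; exists f. Qed.

Lemma pin_cls (S J : Type) (src tgt : J -> S) (T : J -> topologicalType)
    (ok : forall Z : sflow S, assignment src tgt T Z -> Prop)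
    (s u s' u' : S) (w : word src tgt T s u) (w' : word src tgt T s' u') :
  s = s' -> u = u' ->
  (forall Z (phi : assignment src tgt T Z), admissible ok phi ->
     @pin Z _ _ (weval phi w) = @pin Z _ _ (weval phi w')) ->
  @pin (presented (T := T) ok) _ _ (cls ok w) = @pin (presented (T := T) ok) _ _ (cls ok w').
Proof.
move=> es eu; subst s' u' => H; congr pin; apply/clsP => Z phi a.
by apply: (@pin_inj Z); exact: H.
Qed.

(* [Nst o] is the stage [F o] with its states pushed forward to [option S] and the
   two edges at [None] adjoined from the start; [isE] identifies these edges with
   the corresponding 0-cells of [F o] once they have been attached. *)
Section EdgesFirst.
Variables (t : tower) (S : Type) (gam bet : S).
Local Notation tl := (@tlt t).
Local Notation F := (@tF t).
Local Notation Y := (tF (ttop t)).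
Variables (kap : fst_ Y -> option S) (p q : bool -> tO t) (c : forall b, gcell (p b) (q b)).

Definition es (b : bool) : option S := if b then None else Some gam.
Definition et (b : bool) : option S := if b then Some bet else None.

Hypothesis c_sel : forall b, sel (p b) (q b) = Some (c b).
Hypothesis c_dim : forall b, gn (c b) = 0%N.
Hypothesis c_src : forall b, kap (cend (c b) false) = es b.
Hypothesis c_tgt : forall b, kap (cend (c b) true) = et b.
Hypothesis c_other : forall (o1 o2 : tO t) (c' : gcell o1 o2), sel o1 o2 = Some c' ->
  (forall b, o1 <> p b) -> forall b, kap (cend c' b) <> None.

Definition kst (o : tO t) (a : fst_ (F o)) : option S := kap (m0 (cm o) a).

Lemma kst_map o1 o2 (l : tl o1 o2) a : kst (m0 (tmap l) a) = kst a.
Proof. by rewrite /kst cm_map0. Qed.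

Lemma sel_cend (o1 o2 o1' o2' : tO t) (c1 : gcell o1 o2) (c2 : gcell o1' o2') b :
  sel o1 o2 = Some c1 -> sel o1' o2' = Some c2 -> o1 = o1' -> cend c1 b = cend c2 b.
Proof.
move=> E1 E2 e; subst o1'; have e := succ_inj_r (twf t) (gs c1) (gs c2); subst o2'.
by rewrite E1 in E2; case: E2 => ->.
Qed.

Lemma p_inj b b' : p b = p b' -> b = b'.
Proof.
move=> e; have := sel_cend false (c_sel b) (c_sel b') e.
by move/(congr1 kap); rewrite !c_src; case: b b' {e} => [] [].
Qed.

Definition ecell b : Ptot (F (q b)) := cpt (c b) (center _).

Lemma cpt_ecell b x : cpt (c b) x = ecell b.
Proof.
rewrite /ecell; congr cpt; move: x; rewrite c_dim => x.
by rewrite (Disk0_center x).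
Qed.

Definition isE b o (u : Ptot (F o)) : Prop :=
  (exists e : q b = o, u = eq_rect (q b) (fun o => Ptot (F o)) (ecell b) o e) \/
  exists l : tl (q b) o, u = pmap (tmap l) (ecell b).

Lemma isE_new b u : @isE b (q b) u -> u = ecell b.
Proof.
case=> [[e ->]|[l _]]; first by rewrite (Prop_irrelevance e erefl).
by case: (wo_irr (twf t) l).
Qed.

Lemma isE_here b : isE b (ecell b).
Proof. by left; exists erefl. Qed.

Lemma isE_map b o o' (l : tl o o') u : isE b u -> isE b (pmap (tmap l) u).
Proof.
case=> [[e ->]|[l' ->]]; right.
  by subst o; exists l.
by exists (tlt_trans l' l); rewrite -(tmapD l' l (tlt_trans l' l)).
Qed.

Lemma isE_ends b o (u : Ptot (F o)) :
  isE b u -> kst (psrc u) = es b /\ kst (ptgt u) = et b.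
Proof.
have H : kst (psrc (ecell b)) = es b /\ kst (ptgt (ecell b)) = et b.
  by rewrite /psrc /ptgt /= /kst -/(cend (c b) false) -/(cend (c b) true) c_src c_tgt.
case=> [[e ->]|[l ->]]; first by subst o.
by rewrite /psrc /ptgt /= !kst_map.
Qed.

Lemma isE_succ b o1 o2 (l : tl o1 o2) u : is_succ tl o1 o2 -> o1 <> p b ->
  isE b u -> exists u1, isE b u1 /\ u = pmap (tmap l) u1.
Proof.
move=> s n [[e ->]|[l' ->]].
  by subst o2; case: n; exact: (succ_inj_l (twf t) s (gs (c b))).
have [e|l1] := succ_le (twf t) s l'.
  by subst o1; exists (ecell b); rewrite (Prop_irrelevance l' l); split=> //; exact: isE_here.
exists (pmap (tmap l1) (ecell b)); split; first by right; exists l1.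
by rewrite -(tmapD l1 l l').
Qed.

Lemma isE_lim b o u : is_limit tl (t0 t) o -> @isE b o u ->
  exists o' (l : tl o' o) u1, isE b u1 /\ u = pmap (tmap l) u1.
Proof.
move=> lim [[e ->]|[l ->]].
  subst o; have [_ H] := lim; have [l nb] := gs (c b).
  by case: nb; exact: H.
by exists (q b), l, (ecell b); split=> //; exact: isE_here.
Qed.

Section Stage.
Variable o : tO t.

Definition gidx : Type := (fst_ (F o) * fst_ (F o) + bool)%type.
Definition gsrc (j : gidx) : option S := match j with inl ab => kst ab.1 | inr b => es b end.
Definition gtgt (j : gidx) : option S := match j with inl ab => kst ab.2 | inr b => et b end.
Definition gsp (j : gidx) : topologicalType :=
  match j with inl ab => fP (F o) ab.1 ab.2 | inr b => unitT end.

Definition Nok (Z : sflow (option S)) (phi : assignment gsrc gtgt gsp Z) : Prop :=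
  (forall a b c (x : fP (F o) a b) (y : fP (F o) b c),
     phi (inl (a, c)) (fcomp x y) = scomp (phi (inl (a, b)) x) (phi (inl (b, c)) y)) /\
  forall b a a' (x : fP (F o) a a'), isE b (pin x) ->
     @pin Z _ _ (phi (inl (a, a')) x) = @pin Z _ _ (phi (inr b) tt).

Definition Nst : sflow (option S) := presented Nok.

Lemma scg_Nst : scg Nst.
Proof. exact: scg_presented. Qed.

Definition gN : assignment gsrc gtgt gsp Nst := @gen _ _ gsrc gtgt gsp Nok.
Arguments gN : clear implicits.

Lemma gen_comp a b d (x : fP (F o) a b) (y : fP (F o) b d) :
  gN (inl (a, d) : gidx) (fcomp x y) =
  scomp (gN (inl (a, b) : gidx) x) (gN (inl (b, d) : gidx) y).
Proof.
rewrite [RHS]qcomp_cls; apply/clsP => Z phi [_ _ [H _]] /=; exact: H.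
Qed.

Lemma gen_edge b a a' (x : fP (F o) a a') : isE b (pin x) ->
  @pin Nst _ _ (gN (inl (a, a') : gidx) x) = @pin Nst _ _ (gN (inr b : gidx) tt).
Proof.
move=> h; have [e1 e2] := isE_ends h.
apply: pin_cls => // Z phi [_ _ [_ H]] /=; exact: H.
Qed.

Definition jN : mor (F o) Nst.
Proof.
refine (@Mor (F o) Nst (fun a => kst a) (fun a b x => gN (inl (a, b) : gidx) x) _ _).
- move=> a b; have [kab _] := tcg a b.
  exact: (@gen_continuous _ _ gsrc gtgt gsp Nok (inl (a, b)) kab).
- by move=> a b d x y; exact: gen_comp.
Defined.

Definition eta b : sP Nst (es b) (et b) := gN (inr b : gidx) tt.

Lemma jN_edge b u : isE b u -> pmap jN u = @pin Nst _ _ (eta b).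
Proof. by have [a [a' [x ->]]] := pin_surj u => h; exact: gen_edge. Qed.

Lemma Nst_univ (Z : sflow (option S)) (h : mor (F o) Z) (ep : forall b, sP Z (es b) (et b)) :
  scg Z -> m0 h =1 kst (o := o) ->
  (forall b u, isE b u -> pmap h u = @pin Z _ _ (ep b)) ->
  exists H : smor Nst Z, mcomp (s2m H) jN = h /\ forall b, H _ _ (eta b) = ep b.
Proof.
case: h => h0 h1 hc hm cZ /= /funext e hE; subst h0.
pose phi : assignment gsrc gtgt gsp Z := fun j =>
  match j return gsp j -> sP Z (gsrc j) (gtgt j) with
  | inl ab => fun x => h1 ab.1 ab.2 x
  | inr b => fun _ => ep b
  end.
have adm : admissible Nok phi.
  split=> //.
    by move=> [ab|b] /=; [exact: hc | exact: cst_continuous].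
  by split=> [a b d x y|b a a' x h]; [exact: hm | exact: (hE b (pin x) h)].
have [H HE] := presented_univ adm.
exists H; split=> [|b]; last exact: (HE (inr b)).
by apply: mor_eq; split=> // a b x /=; congr pin; exact: (HE (inl (a, b))).
Qed.

Lemma Nst_uniq (Z : sflow (option S)) (H H' : smor Nst Z) :
  mcomp (s2m H) jN = mcomp (s2m H') jN -> (forall b, H _ _ (eta b) = H' _ _ (eta b)) -> H = H'.
Proof.
move=> e e'; apply: presented_uniq => -[[a b]|b] x; last by case: x; exact: e'.
apply: (@pin_inj Z).
exact: (congr1 (fun f : mor (F o) Z => pmap f (pin x)) e).
Qed.

End Stage.
Arguments jN {o}.
Arguments eta {o} b.

Lemma Nmap_ex o1 o2 (l : tl o1 o2) : exists n : smor (Nst o1) (Nst o2),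
  mcomp (s2m n) jN = mcomp jN (tmap l) /\ forall b, n _ _ (eta b) = eta b.
Proof.
apply: Nst_univ; first exact: scg_Nst.
  by move=> a /=; rewrite kst_map.
by move=> b u h; rewrite -(jN_edge (isE_map l h)).
Qed.

Definition Nmap o1 o2 (l : tl o1 o2) : smor (Nst o1) (Nst o2) := sval (cid (Nmap_ex l)).

Lemma Nmap_j o1 o2 (l : tl o1 o2) : mcomp (s2m (Nmap l)) jN = mcomp jN (tmap l).
Proof. by have [] := svalP (cid (Nmap_ex l)). Qed.

Lemma Nmap_eta o1 o2 (l : tl o1 o2) b : Nmap l _ _ (eta b) = eta b.
Proof. by have [_] := svalP (cid (Nmap_ex l)); exact. Qed.

Lemma NmapD o1 o2 o3 (h12 : tl o1 o2) (h23 : tl o2 o3) (h13 : tl o1 o3) :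
  smcomp (Nmap h23) (Nmap h12) = Nmap h13.
Proof.
apply: Nst_uniq; last by move=> b /=; rewrite !Nmap_eta.
by rewrite s2m_comp -mcompA Nmap_j mcompA Nmap_j -mcompA (tmapD h12 h23 h13) Nmap_j.
Qed.

(** The first stage is empty, so the two adjoined edges are the only generators and no relation
    remains. *)
Lemma Nst_base (Z : sflow (option S)) (ep : forall b, sP Z (es b) (et b)) : scg Z ->
  exists H : smor (Nst (t0 t)) Z, (forall b, H _ _ (eta b) = ep b) /\
  forall H' : smor (Nst (t0 t)) Z, (forall b, H' _ _ (eta b) = ep b) -> H' = H.
Proof.
move=> cZ.
have [h _] : exists h : mor (F (t0 t)) Z, True.
  unshelve eexists; last by [].
  refine (@Mor (F (t0 t)) Z (fun a => match tempty a with end)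
    (fun a => match tempty a with end) _ _) => a; by case: (tempty a).
have e : forall f g : mor (F (t0 t)) Z, f = g.
  by move=> f g; apply: mor_eq; split=> a; case: (tempty a).
have [||H [_ H2]] := @Nst_univ (t0 t) Z h ep cZ.
- by move=> a; case: (tempty a).
- by move=> b u; case: (tempty (psrc u)).
exists H; split=> // H' H2'; apply: Nst_uniq => // b.
by rewrite H2 H2'.
Qed.

Section Succ.
Variables (o1 o2 : tO t) (l : tl o1 o2).
Hypothesis s : is_succ tl o1 o2.

(** A step without globe acts on states only, and these have already been pushed forward. It is not
    the step of an edge, so an edge present after it was present before. *)
Lemma Nst_other_step : sel o1 o2 = None -> triv (Nmap l).
Proof.
move=> E Z cZ h.
have np b : o1 <> p b.
  move=> e; have sb := gs (c b); rewrite -e in sb.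
  have e2 := succ_inj_r (twf t) s sb.
  have E' : sel (p b) (q b) = None by rewrite -e -e2.
  by rewrite c_sel in E'.
have cZ' : cg_flow Z by exact: cZ.
have [|g [g0 g1 gu]] := sel_none (l := l) s E cZ' (h := mcomp (s2m h) jN) (tau := kst (o := o2)).
  by move=> a /=; rewrite kst_map.
have [//|b u hu|H [H1 H2]] := @Nst_univ o2 Z g (fun b => h _ _ (eta b)) cZ.
  have [u1 [hu1 ->]] := isE_succ l s (np b) hu.
  rewrite (_ : pmap g _ = pmap (mcomp g (tmap l)) u1) // g1.
  by rewrite (_ : pmap _ u1 = pmap (s2m h) (pmap jN u1)) // (jN_edge hu1).
exists H; split.
  apply: Nst_uniq => [|b] /=; last by rewrite Nmap_eta.
  by rewrite s2m_comp -mcompA Nmap_j mcompA H1.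
move=> H' e; apply: Nst_uniq => [|b].
  rewrite H1; apply: gu => //.
  by rewrite -mcompA -Nmap_j mcompA -s2m_comp e.
by rewrite H2 -e /= Nmap_eta.
Qed.

Variable c' : gcell o1 o2.
Hypothesis E : sel o1 o2 = Some c'.

Lemma kst_ga b : kst (m0 (ga c') b) = kap (cend c' b).
Proof. by rewrite cendE. Qed.

(** At the step [p b] the selected cell is [c b], but over indices that are only propositionally
    equal; stating [P] for all steps allows the transport. *)
Lemma edge_gcell b (P : forall o1 o2 : tO t, gcell o1 o2 -> Prop) :
  o1 = p b -> P (p b) (q b) (c b) -> P o1 o2 c'.
Proof.
move=> e1 Pc; have sb := gs (c b); rewrite -e1 in sb; have e2 := succ_inj_r (twf t) s sb.
have H : forall c'' : gcell (p b) (q b), sel (p b) (q b) = Some c'' -> P _ _ c''.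
  by move=> c'' E''; rewrite c_sel in E''; case: E'' => <-.
by move: c' E; clear - e1 e2 H; subst o1 o2 => c' E; exact: H.
Qed.

Lemma Nst_cell_extend (Z : sflow (option S)) (h : smor (Nst o1) Z) (g : mor (F o2) Z) :
  scg Z -> mcomp g (tmap (gl c')) = mcomp (s2m h) jN ->
  (forall b, o1 = p b -> pmap g (cpt c' (center _)) = @pin Z _ _ (h _ _ (eta b))) ->
  exists H : smor (Nst o2) Z, mcomp (s2m H) jN = g /\ smcomp H (Nmap l) = h.
Proof.
move=> cZ e eb.
have g0 : m0 g =1 kst (o := o2).
  apply: (tower_states_succ (c := c')) => a.
  by rewrite kst_map; exact: (congr1 (fun f : mor (F o1) Z => m0 f a) e).
have [//|b u hu|H [H1 H2]] := @Nst_univ o2 Z g (fun b => h _ _ (eta b)) cZ.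
  have [e1|np] := pselect (o1 = p b); last first.
    have [u1 [hu1 ->]] := isE_succ (gl c') s np hu.
    rewrite (_ : pmap g _ = pmap (mcomp g (tmap (gl c'))) u1) // e.
    by rewrite (_ : pmap _ u1 = pmap (s2m h) (pmap jN u1)) // (jN_edge hu1).
  rewrite -(eb b e1); congr pmap.
  apply: (edge_gcell (P := fun o1 o2 c'' => forall u, @isE b o2 u -> u = cpt c'' (center _)) e1) => //.
  exact: isE_new.
exists H; split=> //; apply: Nst_uniq => [|b] /=; last by rewrite Nmap_eta.
by rewrite s2m_comp -mcompA Nmap_j mcompA H1 (Prop_irrelevance l (gl c')).
Qed.

(** The cell has empty boundary and its single point is identified with [eta b], which is there from
    the start; attaching it changes nothing. *)
Lemma Nst_edge_step b : o1 = p b -> triv (Nmap l).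
Proof.
move=> e1 Z cZ h; have cZ' : cg_flow Z by exact: cZ.
have bd0 : Sphere (gn c') -> False.
  apply: (edge_gcell (P := fun o1 o2 c'' => Sphere (gn c'') -> False) e1).
  by rewrite c_dim; exact: Sphere0_empty.
have ctr x : cpt c' x = cpt c' (center _).
  apply: (edge_gcell (P := fun o1 o2 c'' => forall x, cpt c'' x = cpt c'' (center _)) e1).
  exact: cpt_ecell.
have Ec : isE b (cpt c' (center _)).
  apply: (edge_gcell (P := fun o1 o2 c'' => isE b (cpt c'' (center _))) e1).
  exact: isE_here.
have ends : kap (cend c' false) = es b /\ kap (cend c' true) = et b.
  by apply: (edge_gcell (P := fun o1 o2 c'' => kap (cend c'' false) = es b /\ kap (cend c'' true) = et b) e1).
have [_ _ univ] := (pushoutP _ _ _ _).1 (gpo c').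
pose p' : mor (glob (Disk (gn c'))) Z :=
  @glob_to Z _ (es b) (et b) (cst (h _ _ (eta b))) (@cst_continuous _ _ _).
have [|g [e2 e3 gu]] := univ Z cZ' p' (mcomp (s2m h) jN).
  apply: glob_mor_eq => [b'|x]; last by case: (bd0 x).
  by rewrite /= kst_ga; case: b'; case: ends.
have pg : pmap g (cpt c' (center _)) = @pin Z _ _ (h _ _ (eta b)).
  exact: (congr1 (fun f => pmap f (@pin (glob (Disk (gn c'))) false true (center _))) e2).
have [b' eb'|H [H1 H2]] := @Nst_cell_extend Z h g cZ e3.
  by rewrite -(p_inj (etrans (esym e1) eb')).
exists H; split=> // H' eH; apply: Nst_uniq => [|b'].
  rewrite H1; apply: gu.
    apply: glob_mor_eq => [b'|x].
      by rewrite /= -/(cend _ _) ; case: b'; case: ends => // <-.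
    rewrite -[LHS]/(pmap (s2m H') (pmap jN (cpt c' x))) ctr (jN_edge Ec) /=.
    by rewrite -eH /= Nmap_eta.
  by rewrite -mcompA -(Prop_irrelevance l (gl c')) -Nmap_j mcompA -s2m_comp eH.
have := congr1 (fun f : smor (Nst o1) Z => f _ _ (eta b')) (etrans eH (esym H2)).
by rewrite /= Nmap_eta.
Qed.

(** By [c_other] such a cell has both ends different from [None]. Its boundary and characteristic
    maps are those of the stage followed by [jN], cast along the equalities of ends. *)
Lemma Nst_cell_step : (forall b, o1 <> p b) ->
  exists n (x y : S) (bd : Sphere n -> sP (Nst o1) (Some x) (Some y))
    (ch : Disk n -> sP (Nst o2) (Some x) (Some y)), scell (Nmap l) bd ch.
Proof.
move=> np.
have [x ex] : exists x, kap (cend c' false) = Some x.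
  by have := c_other E np (b := false); case: (kap _) => [x _|//]; exists x.
have [y ey] : exists y, kap (cend c' true) = Some y.
  by have := c_other E np (b := true); case: (kap _) => [y _|//]; exists y.
have [|||bd [bdc bdE]] := @pin_cast_fun (Sphere (gn c')) (Nst o1) _ _ (Some x) (Some y)
   (fun z => m1 jN (@m1 _ _ (ga c') false true z)).
- exact: (@m1_cont _ _ (mcomp jN (ga c')) false true).
- by rewrite -ex -kst_ga.
- by rewrite -ey -kst_ga.
have [|||ch [chc chE]] := @pin_cast_fun (Disk (gn c')) (Nst o2) _ _ (Some x) (Some y)
   (fun z => m1 jN (@m1 _ _ (gb c') false true z)).
- exact: (@m1_cont _ _ (mcomp jN (gb c')) false true).
- by rewrite -ex.
- by rewrite -ey.
exists (gn c'), x, y, bd, ch; split=> // [z|Z cZ h d dc dE].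
  apply: (@pin_inj (Nst o2)); rewrite chE.
  rewrite -[LHS]/(pmap (s2m (Nmap l)) (@pin (Nst o1) _ _ (bd z))) bdE.
  rewrite -[LHS]/(pmap (mcomp (s2m (Nmap l)) jN) (cbd c' z)) Nmap_j.
  by rewrite -[RHS]/(pmap jN (cpt c' (set_val z))) -cbdE (Prop_irrelevance l (gl c')).
have cZ' : cg_flow Z by exact: cZ.
have [_ _ univ] := (pushoutP _ _ _ _).1 (gpo c').
have [|g [e2 e3 gu]] := univ Z cZ' (@glob_to Z _ (Some x) (Some y) d dc) (mcomp (s2m h) jN).
  apply: glob_mor_eq => [b'|z] /=.
    by rewrite kst_ga; case: b'; rewrite ?ex ?ey.
  rewrite -dE.
  by rewrite -[LHS]/(pmap (s2m h) (@pin (Nst o1) _ _ (bd z))) bdE.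
have [b' eb'|H [H1 H2]] := @Nst_cell_extend Z h g cZ e3; first by case: (np b').
exists H; split=> // [z|H' eH cH].
  apply: (@pin_inj Z); rewrite -[LHS]/(pmap (s2m H) (@pin (Nst o2) _ _ (ch z))) chE.
  rewrite -[LHS]/(pmap (mcomp (s2m H) jN) (cpt c' z)) H1.
  exact: (congr1 (fun f => pmap f (@pin (glob (Disk (gn c'))) false true z)) e2).
apply: Nst_uniq => [|b].
  rewrite H1; apply: gu.
    apply: glob_mor_eq => [b'|z] /=.
      by case: b'; [rewrite -ey | rewrite -ex].
    rewrite -[LHS]/(pmap (s2m H') (pmap jN (cpt c' z))) -[pmap jN _]chE.
    by rewrite /pmap /= cH.
  by rewrite -mcompA -(Prop_irrelevance l (gl c')) -Nmap_j mcompA -s2m_comp eH.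
have := congr1 (fun f : smor (Nst o1) Z => f _ _ (eta b)) (etrans eH (esym H2)).
by rewrite /= Nmap_eta.
Qed.

End Succ.

Lemma Nst_lim o : is_limit tl (t0 t) o ->
  @scolim _ _ tl (fun o' => tl o' o) Nst Nmap (Nst o) (fun o' l => Nmap l).
Proof.
move=> lim; split=> [ o1 o2 l p1 p2|Z cZ c' cc]; first exact: NmapD.
have cZ' : cg_flow Z by exact: cZ.
have [_ _ univ] := (colimP _ _).1 (tlim lim).
have [|g [g1 gu]] := univ Z cZ' (fun o' l => mcomp (s2m (c' o' l)) jN).
  by move=> o1 o2 h p1 p2; rewrite -mcompA -Nmap_j mcompA -s2m_comp cc.
have [ o' lo'] : exists o', tl o' o.
  exists (t0 t); have [n _] := lim; have [_ _ _ mn] := twf t; exact: mn.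
(* The image of an edge does not depend on the leg of the cocone: indices are comparable and the
   transition maps fix [eta]. *)
have same_eta o1 (l1 : tl o1 o) b : c' o1 l1 _ _ (eta b) = c' o' lo' _ _ (eta b).
  have [_ _ tot _] := twf t.
  have [e|[l|l]] := tot o1 o'.
  - by subst o1; rewrite (Prop_irrelevance l1 lo').
  - by rewrite -(cc _ _ l l1 lo') /= Nmap_eta.
  - by rewrite -(cc _ _ l lo' l1) /= Nmap_eta.
have [||H [H1 H2]] := @Nst_univ o Z g (fun b => c' o' lo' _ _ (eta b)) cZ.
- apply: (colim_states (tlim lim)) => o1 l1 a; rewrite kst_map.
  exact: (congr1 (fun f : mor (F o1) Z => m0 f a) (g1 o1 l1)).
- move=> b u hu; have [ o1 [l1 [u1 [hu1 ->]]]] := isE_lim lim hu.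
  rewrite -[LHS]/(pmap (mcomp g (tmap l1)) u1) g1.
  rewrite -[LHS]/(pmap (s2m (c' o1 l1)) (pmap jN u1)) (jN_edge hu1).
  by rewrite /pmap /= (same_eta o1 l1).
exists H; split=> [ o1 l1|H' e].
  apply: Nst_uniq => [|b] /=; last by rewrite Nmap_eta H2 (same_eta o1 l1).
  by rewrite s2m_comp -mcompA Nmap_j mcompA H1.
apply: Nst_uniq => [|b].
  rewrite H1; apply: gu => o1 l1.
  by rewrite -mcompA -Nmap_j mcompA -s2m_comp e.
by rewrite H2 -(e o' lo') /= Nmap_eta.
Qed.

Lemma Nst_succ o1 o2 (l : tl o1 o2) : is_succ tl o1 o2 -> triv (Nmap l) \/
  exists n (x y : S) (bd : Sphere n -> sP (Nst o1) (Some x) (Some y))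
    (ch : Disk n -> sP (Nst o2) (Some x) (Some y)), scell (Nmap l) bd ch.
Proof.
move=> s; case E : (sel o1 o2) => [c'|]; last by left; exact: Nst_other_step.
have [[b e]|n] := pselect (exists b, o1 = p b).
  by left; exact: (Nst_edge_step l s E e).
by right; apply: (Nst_cell_step l s E) => b e; apply: n; exists b.
Qed.

End EdgesFirst.

Lemma kspace_continuous (A B : topologicalType) (f : A -> B) : kspace A ->
  (forall (K : topologicalType) (g : K -> A), test_space K -> continuous g ->
     continuous (f \o g)) -> continuous f.
Proof.
move=> kA fc; apply/continuousP => U oU; apply: kA => K g tK gc.
by have /continuousP := fc K g tK gc; exact.
Qed.

Lemma kcontinuous2_l (A B C : topologicalType) (h : A -> B -> C) (b : B) :
  kspace A -> kcontinuous2 h -> continuous (fun a => h a b).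
Proof.
move=> kA hc; apply: kspace_continuous => // K g tK gc.
apply: (hc K (fun k => (g k, b))) => // x.
by apply: cvg_pair => /=; [exact: gc | exact: cvg_cst].
Qed.

Lemma kcontinuous2_swap (A B C : topologicalType) (h : A -> B -> C) :
  kcontinuous2 h -> kcontinuous2 (fun b a => h a b).
Proof.
move=> hc K g tK gc; apply: (hc K (fun k => ((g k).2, (g k).1))) => // x.
apply: cvg_pair => /=.
  by apply: (@continuous_comp _ _ _ g snd); [exact: gc | exact: cvg_snd].
by apply: (@continuous_comp _ _ _ g fst); [exact: gc | exact: cvg_fst].
Qed.

(** * Adjoining a point *)

Section One.
Variables (A : topologicalType) (Q : Prop).

(** The second summand is a point if [Q] holds and empty otherwise. With [Q] the equality of two
    states, identities are adjoined uniformly in the states. *)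
Definition oneF (b : bool) : topologicalType := if b then A else truth Q.
Definition one : topologicalType := {b : bool & oneF b}.
Definition one_in (a : A) : one := existT oneF true a.
Definition one_pt (e : truth Q) : one := existT oneF false e.

Lemma one_in_continuous : continuous one_in.
Proof. exact: (@existT_continuous _ oneF true). Qed.

Lemma one_continuous (B : topologicalType) (f : one -> B) :
  continuous (f \o one_in) -> continuous f.
Proof.
move=> fc [[] x] U nU; first exact: fc.
suff : nbhs x [set y | U (f (existT oneF false y))] by [].
apply: nearW => y /=; rewrite (truth_sub y x); exact: nbhs_singleton.
Qed.

Definition one_pr (a0 : A) (x : one) : A :=
  match x with existT b y =>
    match b return oneF b -> A with true => id | false => fun=> a0 end y
  end.

Lemma one_pr_continuous a0 : continuous (one_pr a0).
Proof. by apply: one_continuous => x; exact: cvg_id. Qed.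

Lemma one_tag_open b : open [set x : one | projT1 x = b].
Proof.
apply/sigT_openP => i; have [->|n] := eqVneq i b.
  by rewrite (_ : _ @^-1` _ = setT); [exact: openT | apply/seteqP].
rewrite (_ : _ @^-1` _ = set0); first exact: open0.
by apply/seteqP; split=> // x /= e; move/eqP: n.
Qed.

Lemma one_kspace : kspace A -> kspace one.
Proof.
move=> kA U oU; apply/sigT_openP => -[].
  apply: kA => K g tK gc; apply: (oU K (one_in \o g) tK) => x.
  by apply: continuous_comp; [exact: gc | exact: one_in_continuous].
have [kT _] := cg_truth Q.
apply: kT => K g tK gc; apply: (oU K (one_pt \o g) tK) => x.
by apply: continuous_comp; [exact: gc | exact: (@existT_continuous _ oneF false)].
Qed.

Lemma cg_one : cg_space A -> cg_space one.
Proof.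
move=> [kA whA]; split; first exact: one_kspace.
apply: wh_sep; first exact: one_kspace.
have tagc : continuous (fun x : one => (projT1 x : discrete_topology bool)).
  apply/continuousP => V _.
  rewrite (_ : _ @^-1` V = \bigcup_(b in V) [set x : one | projT1 x = b]).
    by apply: bigcup_open => b _; exact: one_tag_open.
  apply/seteqP; split=> [x Vx|x [b Vb /= e]]; first by exists (projT1 x).
  by rewrite e.
(* Two points of [A] are separated by the retraction [one_pr], points of different summands by their
   tags. *)
move=> [[] x] [[] y] ne.
- exists A, (one_pr x); split=> //; first exact: one_pr_continuous.
  by move=> /= e; apply: ne; rewrite e.
- exists (discrete_topology bool), (fun x : one => projT1 x); split => //.
  by apply: hausdorff_wh; exact: discrete_hausdorff.
- exists (discrete_topology bool), (fun x : one => projT1 x); split => //.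
  by apply: hausdorff_wh; exact: discrete_hausdorff.
- by case: ne; rewrite (truth_sub x y).
Qed.

(** The tag of the first component is locally constant along a probe. Near [k0] that component can
    therefore be replaced by its retraction to [A], or by a constant point. *)
Lemma kcontinuous2_one_l (B C : topologicalType) (h : one -> B -> C) :
  kcontinuous2 (fun a b => h (one_in a) b) ->
  (forall q, continuous (h (one_pt q))) -> kcontinuous2 h.
Proof.
move=> h1 h2 K g tK gc k0.
have near_tag : \forall k \near k0, projT1 (g k).1 = projT1 (g k0).1.
  have c : continuous (fst \o g).
    by move=> x; apply: continuous_comp; [exact: gc | exact: cvg_fst].
  have /continuousP /(_ _ (@one_tag_open (projT1 (g k0).1))) o := c.
  by apply: open_nbhs_nbhs; split; first exact: o.
case E : (g k0).1 near_tag => [[] a0] /= nt.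
  apply: (@cvg_trans _ ((fun k => h (one_in (one_pr a0 (g k).1)) (g k).2) @ k0)).
    apply: near_eq_cvg; apply: filterS nt => k.
    by case: (g k).1 => -[] //= a _.
  have -> : h (g k0).1 (g k0).2 = h (one_in (one_pr a0 (g k0).1)) (g k0).2.
    by rewrite E.
  apply: (h1 K (fun k => (one_pr a0 (g k).1, (g k).2))) => // x.
  apply: cvg_pair => /=.
    apply: (@continuous_comp _ _ _ (fst \o g) (one_pr a0)); last exact: one_pr_continuous.
    by apply: continuous_comp; [exact: gc | exact: cvg_fst].
  by apply: (@continuous_comp _ _ _ g snd); [exact: gc | exact: cvg_snd].
apply: (@cvg_trans _ ((fun k => h (one_pt a0) (g k).2) @ k0)).
  apply: near_eq_cvg; apply: filterS nt => k.
  by case: (g k).1 => -[] //= a _; rewrite (truth_sub a a0).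
have -> : h (g k0).1 (g k0).2 = h (one_pt a0) (g k0).2 by rewrite E.
apply: (@continuous_comp _ _ _ (snd \o g) (h (one_pt a0))); last exact: h2.
by apply: continuous_comp; [exact: gc | exact: cvg_snd].
Qed.

End One.

Lemma kcontinuous2_one_r (A B C : topologicalType) (Q : Prop) (h : B -> one A Q -> C) :
  kcontinuous2 (fun b a => h b (one_in Q a)) ->
  (forall q : truth Q, continuous (h^~ (one_pt A q))) -> kcontinuous2 h.
Proof.
move=> h1 h2; apply: (kcontinuous2_swap (h := fun a b => h b a)).
by apply: kcontinuous2_one_l => //; exact: kcontinuous2_swap h1.
Qed.

(** * Adjoining identities *)

Section Unital.
Variables (S : Type) (Z : sflow S).

Definition uP (s t : S) : topologicalType := one (sP Z s t) (s = t).
Definition uin s t (a : sP Z s t) : uP s t := one_in (s = t) a.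
Definition upt s t (e : truth (s = t)) : uP s t := one_pt (sP Z s t) e.

Lemma uP_ind (Pr : forall s t, uP s t -> Prop) :
  (forall s t (a : sP Z s t), Pr s t (uin a)) ->
  (forall s (e : truth (s = s)), Pr s s (upt e)) -> forall s t x, Pr s t x.
Proof.
move=> h1 h2 s t [[] x]; first exact: h1.
have e := truthP x; subst t; exact: h2.
Qed.

Section LeftAction.
Variables (M : S -> Type) (op : forall s t, sP Z s t -> M t -> M s).

(** The action of Z on a left module [M], extended to Z^1 with identities acting trivially. All
    products below are instances of [lact] and [ract], so most associativity laws follow from
    naturality ([lact_map], [ract_map]), from [act_balanced] and from [lact_mmul]. *)
Definition lact s t (x : uP s t) : M t -> M s :=
  match x with existT b y =>
    match b return oneF (sP Z s t) (s = t) b -> M t -> M s with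
    | true => fun a m => op a m
    | false => fun e m => eq_rect_r M m (truthP e)
    end y
  end.

Lemma lact_in s t (a : sP Z s t) m : lact (uin a) m = op a m.
Proof. by []. Qed.

Lemma lact_pt s (e : truth (s = s)) m : lact (upt e) m = m.
Proof. by rewrite /lact /= (Prop_irrelevance (truthP e) erefl). Qed.
End LeftAction.

Section RightAction.
Variables (M : S -> Type) (op : forall s t, M s -> sP Z s t -> M t).

Definition ract s t (m : M s) (x : uP s t) : M t :=
  match x with existT b y =>
    match b return oneF (sP Z s t) (s = t) b -> M t with
    | true => fun a => op m a
    | false => fun e => eq_rect s M m t (truthP e)
    end y
  end.

Lemma ract_pt s (e : truth (s = s)) m : ract m (upt e) = m.
Proof. by rewrite /ract /= (Prop_irrelevance (truthP e) erefl). Qed.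
End RightAction.

Definition lmul s t u : uP s t -> sP Z t u -> sP Z s u :=
  @lact (fun s => sP Z s u) (fun s t => @scomp _ Z s t u) s t.

Definition rmul s t u : sP Z s t -> uP t u -> sP Z s u :=
  @ract (fun u => sP Z s u) (fun t u => @scomp _ Z s t u) t u.

Definition mmul s t u : uP s t -> uP t u -> uP s u :=
  @lact (fun s => uP s u) (fun s t a y => uin (rmul a y)) s t.

Lemma lmul_in s t u (a : sP Z s t) (y : sP Z t u) : lmul (uin a) y = scomp a y.
Proof. by []. Qed.
Lemma lmul_pt s u (e : truth (s = s)) (y : sP Z s u) : lmul (upt e) y = y.
Proof. exact: lact_pt. Qed.
Lemma rmul_in s t u (a : sP Z s t) (y : sP Z t u) : rmul a (uin y) = scomp a y.
Proof. by []. Qed.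
Lemma rmul_pt s t (a : sP Z s t) (e : truth (t = t)) : rmul a (upt e) = a.
Proof. exact: ract_pt. Qed.
Lemma mmul_in s t u (a : sP Z s t) (y : uP t u) : mmul (uin a) y = uin (rmul a y).
Proof. by []. Qed.
Lemma mmul_pt s u (e : truth (s = s)) (y : uP s u) : mmul (upt e) y = y.
Proof. exact: lact_pt. Qed.

Lemma lact_map (M N : S -> Type) (op : forall s t, sP Z s t -> M t -> M s)
    (op' : forall s t, sP Z s t -> N t -> N s) (f : forall s, M s -> N s) s t (x : uP s t) m :
  (forall s t (a : sP Z s t) m, f s (op s t a m) = op' s t a (f t m)) ->
  f s (lact op x m) = lact op' x (f t m).
Proof.
move=> h; elim/uP_ind: x m => [{}s {}t a m|{}s e m]; first exact: h.
by rewrite !lact_pt.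
Qed.

Lemma ract_map (M N : S -> Type) (op : forall s t, M s -> sP Z s t -> M t)
    (op' : forall s t, N s -> sP Z s t -> N t) (f : forall s, M s -> N s) s t (x : uP s t) m :
  (forall s t m (a : sP Z s t), f t (op s t m a) = op' s t (f s m) a) ->
  f t (ract op m x) = ract op' (f s m) x.
Proof.
move=> h; elim/uP_ind: x m => [{}s {}t a m|{}s e m]; first exact: h.
by rewrite !ract_pt.
Qed.

Lemma act_balanced (M N : S -> Type) (C : Type) (op : forall s t, sP Z s t -> M t -> M s)
    (op' : forall s t, N s -> sP Z s t -> N t) (f : forall s, N s -> M s -> C) s t (x : uP s t) n m :
  (forall s t n (a : sP Z s t) m, f t (op' s t n a) m = f s n (op s t a m)) ->
  f t (ract op' n x) m = f s n (lact op x m).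
Proof.
move=> h; elim/uP_ind: x n m => [{}s {}t a n m|{}s e n m]; first exact: h.
by rewrite lact_pt ract_pt.
Qed.

Lemma lmul_comp s t u v (x : uP s t) (a : sP Z t u) (b : sP Z u v) :
  scomp (lmul x a) b = lmul x (scomp a b).
Proof.
apply: (@lact_map (fun s => sP Z s u) (fun s => sP Z s v) _ _ (fun s y => scomp y b)).
by move=> *; exact: scompA.
Qed.

Lemma rmul_comp s t u v (a : sP Z s t) (b : sP Z t u) (x : uP u v) :
  rmul (scomp a b) x = scomp a (rmul b x).
Proof.
apply/esym; apply: (@ract_map (fun v => sP Z t v) (fun v => sP Z s v) _ _ (fun v y => scomp a y)).
by move=> *; rewrite scompA.
Qed.

Lemma rmul_lmul s t u v (a : sP Z s t) (x : uP t u) (b : sP Z u v) :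
  scomp (rmul a x) b = scomp a (lmul x b).
Proof.
apply: (@act_balanced (fun t => sP Z t v) (fun t => sP Z s t) _ _ _ (fun t => @scomp _ Z s t v)).
by move=> *; exact: scompA.
Qed.

Lemma lmul_rmul s t u v (x : uP s t) (a : sP Z t u) (y : uP u v) :
  rmul (lmul x a) y = lmul x (rmul a y).
Proof.
apply: (@lact_map (fun s => sP Z s u) (fun s => sP Z s v) _ _ (fun s b => rmul b y)).
by move=> *; exact: rmul_comp.
Qed.

Lemma lact_mmul (M : S -> Type) (op : forall s t, sP Z s t -> M t -> M s) s t u
    (x : uP s t) (y : uP t u) (m : M u) :
  (forall s t u (a : sP Z s t) (b : sP Z t u) m, op s u (scomp a b) m = op s t a (op t u b m)) ->
  lact op (mmul x y) m = lact op x (lact op y m).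
Proof.
move=> h; elim/uP_ind: x y => [{}s {}t a y|{}s e y]; last by rewrite mmul_pt lact_pt.
rewrite mmul_in !lact_in; elim/uP_ind: y a m => [{}t {}u b a m|{}t e a m].
  by rewrite rmul_in h.
by rewrite rmul_pt lact_pt.
Qed.

Lemma lmul_mmul s t u v (x : uP s t) (y : uP t u) (a : sP Z u v) :
  lmul (mmul x y) a = lmul x (lmul y a).
Proof. by apply: lact_mmul => *; exact: scompA. Qed.

Lemma rmul_mmul s t u v (a : sP Z s t) (x : uP t u) (y : uP u v) :
  rmul a (mmul x y) = rmul (rmul a x) y.
Proof.
elim/uP_ind: x a y => [{}t {}u b a y|{}t e a y]; last by rewrite mmul_pt rmul_pt.
by rewrite mmul_in !rmul_in rmul_comp.
Qed.

Lemma mmulA s t u v (x : uP s t) (y : uP t u) (z : uP u v) :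
  mmul (mmul x y) z = mmul x (mmul y z).
Proof.
apply: (@lact_mmul (fun s => uP s v)) => s' t' u' a b z'.
by rewrite rmul_comp.
Qed.

Lemma mmul_uin s t u (x : uP s t) (a : sP Z t u) : mmul x (uin a) = uin (lmul x a).
Proof.
apply/esym; apply: (@lact_map (fun s => sP Z s u) (fun s => uP s u) _ _ (fun s => @uin s u)).
by [].
Qed.

Hypothesis cZ : scg Z.

Lemma lmul_cont s t u : kcontinuous2 (@lmul s t u).
Proof.
apply: kcontinuous2_one_l => [|q]; first exact: scomp_cont.
have e := truthP q; subst t.
rewrite (_ : lmul _ = id); first by move=> x; exact: cvg_id.
by apply: funext => x; exact: lmul_pt.
Qed.

Lemma rmul_cont s t u : kcontinuous2 (@rmul s t u).
Proof.
apply: kcontinuous2_one_r => [|q]; first exact: scomp_cont.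
have e := truthP q; subst u.
rewrite (_ : (fun x => _) = id); first by move=> x; exact: cvg_id.
by apply: funext => x; exact: rmul_pt.
Qed.

Lemma uin_continuous s t : continuous (@uin s t).
Proof. exact: one_in_continuous. Qed.

Lemma kcontinuous2_post (A B C D : topologicalType) (h : A -> B -> C) (f : C -> D) :
  kcontinuous2 h -> continuous f -> kcontinuous2 (fun a b => f (h a b)).
Proof.
move=> hc fc K g tK gc x.
by apply: (@continuous_comp _ _ _ (fun k => h (g k).1 (g k).2) f); [exact: hc | exact: fc].
Qed.

Lemma mmul_cont s t u : kcontinuous2 (@mmul s t u).
Proof.
apply: kcontinuous2_one_l => [|q].
  by apply: kcontinuous2_post; [exact: rmul_cont | exact: uin_continuous].
have e := truthP q; subst t.
rewrite (_ : mmul _ = id); first by move=> x; exact: cvg_id.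
by apply: funext => x; exact: mmul_pt.
Qed.

End Unital.

(** * Subdivision of an edge *)

Definition restS (S : Type) (B : sflow (option S)) : sflow S := @pull S B Some.

Definition restm (S : Type) (B C : sflow (option S)) (f : smor B C) : smor (restS B) (restS C) :=
  @SMor S (restS B) (restS C) (fun a b x => f _ _ x) (fun a b => @s1_cont _ _ _ f _ _)
    (fun a b c => @s1_comp _ _ _ f _ _ _).

Lemma scg_restS (S : Type) (B : sflow (option S)) : scg B -> scg (restS B).
Proof. by move=> cB a b; exact: cB. Qed.

(* [Sub Z ep] subdivides the path [ep] of Z by a new state None. The paths
   s -> None, None -> t, None -> None are the elements of Z^1(s,g), Z^1(b,t),
   Z^1(b,g), where Z^1 is Z with identities adjoined. *)
Section Subdivision.
Variables (S : Type) (g b : S) (Z : sflow S) (ep : sP Z g b).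

Definition subP (x y : option S) : topologicalType :=
  match x, y with
  | Some s, Some t => sP Z s t
  | Some s, None => uP Z s g
  | None, Some t => uP Z b t
  | None, None => uP Z b g
  end.

(** Let e0, e1 be the edges. An element p of Z^1(s,g) stands for p e0, an element q of Z^1(b,t) for
    e1 q, and an element r of Z^1(b,g) for e1 r e0; an identity thus stands for e0, e1 or e1 e0.
    Composing at [None] makes e0 e1 appear, which is read as [ep]. *)
Definition sub_comp (x y z : option S) : subP x y -> subP y z -> subP x z :=
  match x, y, z return subP x y -> subP y z -> subP x z with
  | Some s, Some t, Some u => fun p q => scomp p q
  | Some s, Some t, None => fun p q => uin (rmul p q)
  | Some s, None, Some u => fun p q => lmul p (rmul ep q)
  | Some s, None, None => fun p q => uin (lmul p (rmul ep q))
  | None, Some t, Some u => fun p q => uin (lmul p q)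
  | None, Some t, None => fun p q => mmul p q
  | None, None, Some u => fun p q => uin (lmul p (rmul ep q))
  | None, None, None => fun p q => uin (lmul p (rmul ep q))
  end.

Lemma sub_compA (x y z w : option S) (p : subP x y) (q : subP y z) (r : subP z w) :
  sub_comp (sub_comp p q) r = sub_comp p (sub_comp q r).
Proof.
move: x y z w p q r => [s|] [t|] [u|] [v|] /= p q r;
  rewrite ?lmul_in ?rmul_in ?mmul_in ?mmul_uin ?rmul_in ?lmul_in ?lmul_mmul ?rmul_mmul
    ?mmulA ?scompA ?rmul_comp ?lmul_comp ?rmul_lmul ?lmul_rmul ?scompA ?rmul_comp
    ?rmul_lmul ?lmul_rmul ?lmul_comp //.
Qed.

Lemma kcontinuous2_nest (A B C D E : topologicalType) (h : A -> B -> C) (h' : D -> E -> B)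
    (d : D) : kcontinuous2 h -> kcontinuous2 h' -> kcontinuous2 (fun a e => h a (h' d e)).
Proof.
move=> hc hc' K k tK kc; apply: (hc K (fun x => ((k x).1, h' d (k x).2))) => // x.
apply: cvg_pair => /=.
  by apply: (@continuous_comp _ _ _ k fst); [exact: kc | exact: cvg_fst].
apply: (hc' K (fun x => (d, (k x).2))) => // y.
apply: cvg_pair => /=; first exact: cvg_cst.
by apply: (@continuous_comp _ _ _ k snd); [exact: kc | exact: cvg_snd].
Qed.

Lemma sub_comp_cont (x y z : option S) : kcontinuous2 (@sub_comp x y z).
Proof.
have c1 s t : kcontinuous2 (fun (p : uP Z s g) (q : uP Z b t) => lmul p (rmul ep q)).
  by apply: kcontinuous2_nest; [exact: lmul_cont | exact: rmul_cont].
have uc s t := @uin_continuous _ Z s t.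
move: x y z => [s|] [t|] [u|] /=.
- exact: scomp_cont.
- by apply: kcontinuous2_post; [exact: rmul_cont | exact: uc].
- exact: c1.
- by apply: kcontinuous2_post; [exact: c1 | exact: uc].
- by apply: kcontinuous2_post; [exact: lmul_cont | exact: uc].
- exact: mmul_cont.
- by apply: kcontinuous2_post; [exact: c1 | exact: uc].
- by apply: kcontinuous2_post; [exact: c1 | exact: uc].
Qed.

Definition Sub : sflow (option S) := SFlow sub_compA sub_comp_cont.

Lemma scg_Sub : scg Z -> scg Sub.
Proof. by move=> cZ [s|] [t|] /=; rewrite ?/uP; [|exact: cg_one|exact: cg_one|exact: cg_one]. Qed.

Lemma truth_refl (P : Prop) : P -> truth P.
Proof. by move=> p; exact: sval (cid (truth_inh p)). Qed.

Definition sedge (i : bool) : sP Sub (es g i) (et b i) :=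
  match i return sP Sub (es g i) (et b i) with
  | false => upt Z (truth_refl (erefl g))
  | true => upt Z (truth_refl (erefl b))
  end.

Lemma sedge_comp : @scomp _ Sub (Some g) None (Some b) (sedge false) (sedge true) = ep.
Proof.
rewrite -[LHS]/(lmul (upt Z (truth_refl (erefl g))) (rmul ep (upt Z (truth_refl (erefl b))))).
by rewrite lmul_pt rmul_pt.
Qed.

Lemma Sub_in s (a : sP Z s g) :
  @scomp _ Sub (Some s) (Some g) None a (sedge false) = uin a.
Proof.
rewrite -[LHS]/(uin (rmul a (upt Z (truth_refl (erefl g))))).
by rewrite rmul_pt.
Qed.

Lemma Sub_out t (a : sP Z b t) :
  @scomp _ Sub None (Some b) (Some t) (sedge true) a = uin a.
Proof.
rewrite -[LHS]/(uin (lmul (upt Z (truth_refl (erefl b))) a)).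
by rewrite lmul_pt.
Qed.

Lemma Sub_loop (x : uP Z b g) :
  @scomp _ Sub None (Some b) None (sedge true) x = x.
Proof.
rewrite -[LHS]/(mmul (upt Z (truth_refl (erefl b))) x).
by rewrite mmul_pt.
Qed.

Section Extension.
Variables (B : sflow (option S)) (eB : forall i, sP B (es g i) (et b i)).
Let e0 : sP B (Some g) None := eB false.
Let e1 : sP B None (Some b) := eB true.

(** By [Sub_in], [Sub_out] and [Sub_loop], every path of [Sub] is a composite of edges and of paths
    of Z. *)
Lemma Sub_uniq (H H' : smor Sub B) :
  (forall s t (a : sP Z s t), H (Some s) (Some t) a = H' (Some s) (Some t) a) ->
  (forall i, H _ _ (sedge i) = H' _ _ (sedge i)) -> H = H'.
Proof.
move=> ha he; apply: smor_eq.
have hSN s (x : sP Sub (Some s) None) : H _ _ x = H' _ _ x.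
  move: x => [[] a].
    rewrite -[existT _ _ _]/(uin a) -Sub_in !s1_comp; congr scomp; [exact: ha | exact: (he false)].
  have e := truthP a; subst s; rewrite (truth_sub a (truth_refl (erefl g))); exact: (he false).
have hNS s (x : sP Sub None (Some s)) : H _ _ x = H' _ _ x.
  move: x => [[] a].
    rewrite -[existT _ _ _]/(uin a) -Sub_out !s1_comp; congr scomp; [exact: (he true) | exact: ha].
  have e := truthP a; subst s; rewrite (truth_sub a (truth_refl (erefl b))); exact: (he true).
move=> [s|] [t|] x; [exact: ha | exact: hSN | exact: hNS|].
rewrite -(Sub_loop x) !s1_comp; congr scomp; [exact: (he true) | exact: hSN].
Qed.

Hypothesis cZ : scg Z.
Variable f : smor Z (restS B).
Hypothesis fe : f _ _ ep = scomp e0 e1.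

Definition actl s t v : uP Z s t -> sP B (Some t) v -> sP B (Some s) v :=
  @lact _ Z (fun s => sP B (Some s) v) (fun s t a y => @scomp _ B _ _ _ (f _ _ a) y) s t.

Definition actr v s t : sP B v (Some s) -> uP Z s t -> sP B v (Some t) :=
  @ract _ Z (fun s => sP B v (Some s)) (fun s t y a => @scomp _ B _ _ _ y (f _ _ a)) s t.

Lemma f_lmul s t u (x : uP Z s t) (a : sP Z t u) :
  f _ _ (lmul x a) = actl x (f _ _ a : sP B (Some t) (Some u)).
Proof.
apply: (@lact_map _ _ (fun s => sP Z s u) (fun s => sP B (Some s) (Some u)) _ _ (fun s a => f _ _ a)).
by move=> s' t' a' m; exact: (@s1_comp _ Z (restS B) f s' t' _ a' m).
Qed.

Lemma f_rmul s t u (a : sP Z s t) (x : uP Z t u) :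
  f _ _ (rmul a x) = actr (f _ _ a : sP B (Some s) (Some t)) x.
Proof.
apply: (@ract_map _ _ (fun u => sP Z s u) (fun u => sP B (Some s) (Some u)) _ _ (fun s a => f _ _ a)).
by move=> s' t' m a'; exact: (@s1_comp _ Z (restS B) f _ s' t' m a').
Qed.

Lemma actl_comp s t v w (x : uP Z s t) (y : sP B (Some t) v) (z : sP B v w) :
  scomp (actl x y) z = actl x (scomp y z).
Proof.
apply: (@lact_map _ _ (fun s => sP B (Some s) v) (fun s => sP B (Some s) w) _ _ (fun s a => scomp a z)).
by move=> *; exact: scompA.
Qed.

Lemma actr_comp s t v w (x : uP Z s t) (y : sP B w v) (z : sP B v (Some s)) :
  actr (scomp y z) x = scomp y (actr z x).
Proof.
apply/esym; apply: (@ract_map _ _ (fun s => sP B v (Some s)) (fun s => sP B w (Some s)) _ _ (fun s a => scomp y a)).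
by move=> *; rewrite scompA.
Qed.

Lemma act_bal s t v w (y : sP B v (Some s)) (x : uP Z s t) (z : sP B (Some t) w) :
  scomp (actr y x) z = scomp y (actl x z).
Proof.
apply: (@act_balanced _ _ (fun t => sP B (Some t) w) (fun t => sP B v (Some t)) _ _ _
  (fun t a b => scomp a b)).
by move=> *; exact: scompA.
Qed.

Lemma actl_mmul s t u v (x : uP Z s t) (y : uP Z t u) (m : sP B (Some u) v) :
  actl (mmul x y) m = actl x (actl y m).
Proof.
apply: (@lact_mmul _ _ (fun s => sP B (Some s) v)) => s' t' u' a a' m'.
by rewrite s1_comp [LHS](@scompA _ B).
Qed.

Definition ext_map (x y : option S) : subP x y -> sP B x y :=
  match x, y return subP x y -> sP B x y with
  | Some s, Some t => fun a => f _ _ a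
  | Some s, None => fun a => actl a e0
  | None, Some t => fun a => actr e1 a
  | None, None => fun a => scomp e1 (actl a e0)
  end.

Lemma ext_map_cont x y : continuous (@ext_map x y).
Proof.
have cl s t v (m : sP B (Some t) v) : continuous (fun x : uP Z s t => actl x m).
  apply: one_continuous.
  apply: (@kcontinuous2_l _ _ _ (fun a m => @scomp _ B (Some s) (Some t) v (f _ _ a) m)).
    by case: (cZ s t).
  apply: (kcontinuous2_comp (h := @scomp _ B (Some s) (Some t) v) (g := id)).
  - exact: scomp_cont.
  - exact: (@s1_cont _ Z (restS B) f s t).
  - by move=> ?; exact: cvg_id.
have cr s t v (m : sP B v (Some s)) : continuous (fun x : uP Z s t => actr m x).
  apply: one_continuous.
  apply: (@kcontinuous2_l _ _ _ (fun a m => @scomp _ B v (Some s) (Some t) m (f _ _ a))).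
    by case: (cZ s t).
  apply: kcontinuous2_swap; apply: (kcontinuous2_comp (h := @scomp _ B v (Some s) (Some t)) (f := id)).
  - exact: scomp_cont.
  - by move=> ?; exact: cvg_id.
  - exact: (@s1_cont _ Z (restS B) f s t).
move: x y => [s|] [t|] /=; [exact: (@s1_cont _ Z (restS B) f) | exact: cl | exact: cr|].
apply: one_continuous.
apply: (@kcontinuous2_l _ _ _ (fun a m => @scomp _ B None (Some b) None m (@scomp _ B (Some b) (Some g) None (f _ _ a) e0))).
  by case: (cZ b g).
apply: kcontinuous2_swap => K k tK kc.
apply: (@scomp_cont _ B None (Some b) None K (fun x => ((k x).1, @scomp _ B (Some b) (Some g) None (f _ _ (k x).2) e0))) => // x.
apply: cvg_pair => /=.
  by apply: (@continuous_comp _ _ _ k fst); [exact: kc | exact: cvg_fst].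
apply: (@scomp_cont _ B (Some b) (Some g) None K (fun x => (f _ _ (k x).2, e0))) => // y.
apply: cvg_pair => /=; last exact: cvg_cst.
apply: (@continuous_comp _ _ _ (snd \o k) (fun x => f _ _ x)); last exact: (@s1_cont _ Z (restS B) f).
by apply: (@continuous_comp _ _ _ k snd); [exact: kc | exact: cvg_snd].
Qed.

Lemma ext_map_comp x y z (p : subP x y) (q : subP y z) :
  ext_map (sub_comp p q) = scomp (ext_map p) (ext_map q).
Proof.
(* This is where [fe] enters: a composite crossing [None] contains [ep], whose image splits as [e0]
   followed by [e1]. *)
have key s t (p' : uP Z s g) (q' : uP Z b t) :
    f _ _ (lmul p' (rmul ep q')) = scomp (actl p' e0) (actr e1 q').
  rewrite f_lmul f_rmul fe actl_comp; congr actl.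
  by rewrite -actr_comp.
move: x y z p q => [s|] [t|] [u|] /= p q.
- exact: (@s1_comp _ Z (restS B) f).
- by rewrite f_rmul act_bal.
- exact: key.
- by rewrite key scompA act_bal.
- by rewrite f_lmul act_bal.
- by rewrite actl_mmul act_bal.
- by rewrite key scompA.
- by rewrite key !scompA act_bal.
Qed.

Lemma Sub_univ : exists H : smor Sub B,
  (forall s t (a : sP Z s t), H (Some s) (Some t) a = f _ _ a) /\ forall i, H _ _ (sedge i) = eB i.
Proof.
exists (@SMor _ Sub B ext_map ext_map_cont ext_map_comp); split=> // -[].
  exact: (@ract_pt _ Z (fun s => sP B None (Some s))).
exact: (@lact_pt _ Z (fun s => sP B (Some s) None)).
Qed.

End Extension.
End Subdivision.

(** * Restriction of the stages to the original states *)

Definition epath (S : Type) (g b : S) (B : sflow (option S))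
    (eB : forall i, sP B (es g i) (et b i)) : sP (restS B) g b :=
  @scomp _ B (Some g) None (Some b) (eB false) (eB true).

Section Restriction.
Variables (S : Type) (g b : S) (O : Type) (lt : O -> O -> Prop) (o0 : O).
Hypothesis wo : well_order_from lt o0.
Variables (A : O -> sflow (option S)) (n : forall o1 o2, lt o1 o2 -> smor (A o1) (A o2))
  (eta : forall o i, sP (A o) (es g i) (et b i)).
Hypothesis cA : forall o, scg (A o).
Hypothesis n_eta : forall o1 o2 (l : lt o1 o2) i, n l _ _ (eta o1 i) = eta o2 i.
Hypothesis base : forall (Z : sflow (option S)) (eZ : forall i, sP Z (es g i) (et b i)),
  scg Z -> exists H : smor (A o0) Z, (forall i, H _ _ (eta o0 i) = eZ i) /\
  forall H' : smor (A o0) Z, (forall i, H' _ _ (eta o0 i) = eZ i) -> H' = H.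
Hypothesis succ : forall o1 o2 (l : lt o1 o2), is_succ lt o1 o2 -> triv (n l) \/
  exists k (x y : S) (bd : Sphere k -> sP (A o1) (Some x) (Some y))
    (ch : Disk k -> sP (A o2) (Some x) (Some y)), scell (n l) bd ch.
Hypothesis lim : forall o, is_limit lt o0 o ->
  @scolim _ _ lt (fun o' => lt o' o) A n (A o) (fun o' l => n l).

(* All cells attached after the edges have both ends different from [None], where
   [Sub (restS B)] and [B] have the same paths. *)
Lemma lift (B : sflow (option S)) (eB : forall i, sP B (es g i) (et b i))
    (E : smor (Sub (epath eB)) B) :
  scg B -> (forall s t a, E (Some s) (Some t) a = a) -> (forall i, E _ _ (sedge (epath eB) i) = eB i) ->
  forall o (bm : smor (A o) B), (forall i, bm _ _ (eta o i) = eB i) ->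
  exists H : smor (A o) (Sub (epath eB)),
    [/\ smcomp E H = bm, forall i, H _ _ (eta o i) = sedge (epath eB) i &
     forall H' : smor (A o) (Sub (epath eB)), smcomp E H' = bm ->
       (forall i, H' _ _ (eta o i) = sedge (epath eB) i) -> H' = H].
Proof.
move=> cB E_in E_e; have [wf _ tot mn] := wo.
have cS : scg (Sub (epath eB)) by apply: scg_Sub; exact: scg_restS.
have E_SS o (H : smor (A o) (Sub (epath eB))) s t x :
    H (Some s) (Some t) x = smcomp E H (Some s) (Some t) x by rewrite /= E_in.
elim/(well_founded_ind wf) => o IH bm eb.
have pre o' (l : lt o' o) i : smcomp bm (n l) _ _ (eta o' i) = eB i by rewrite /= n_eta.
have [e|[ o1 s]|l] := wo_cases lt o0 o.
- subst o; have [H [H1 H2]] := base (sedge (epath eB)) cS.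
  have [D [_ D2]] := base eB cB.
  exists H; split=> // [|H' _]; last exact: H2.
  by rewrite (D2 bm) // (D2 (smcomp E H)) // => i /=; rewrite H1.
- have l := proj1 s.
  have [H1 [H1c H1e H1u]] := IH o1 l (smcomp bm (n l)) (pre o1 l).
  have [tr|[k [x [y [bd [ch [bdc chc bdE univ]]]]]]] := succ l s.
    have [H2 [H2c H2u]] := tr _ cS H1.
    exists H2; split.
    + have [D [Dc Du]] := tr _ cB (smcomp bm (n l)).
      rewrite (Du bm) // (Du (smcomp E H2)) //.
      by rewrite -smcompA H2c.
    + by move=> i; rewrite -(n_eta l) -H1e -H2c.
    + move=> H' Hc He; apply: H2u; apply: H1u; first by rewrite smcompA Hc.
      by move=> i /=; rewrite n_eta He.
  (* From [Some x] to [Some y], [Sub] and [B] have the same path space by conversion, so the image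
     of the cell under [bm] is also a cell in the source of [E]. *)
  have chc' : continuous (fun z => bm _ _ (ch z) : sP (Sub (epath eB)) (Some x) (Some y)).
    by move=> z; apply: (@continuous_comp _ _ _ ch (fun a => bm _ _ a)); [exact: chc | exact: (@s1_cont _ _ _ bm (Some x) (Some y))].
  have [|H2 [H2c H2d H2u]] := univ _ cS H1 (fun z => bm _ _ (ch z)) chc'.
    by move=> z; rewrite E_SS H1c /= bdE.
  exists H2; split.
  + have [|D [Dc Dd Du]] := univ _ cB (smcomp bm (n l)) (fun z => bm _ _ (ch z)) chc'.
      by move=> z /=; rewrite bdE.
    rewrite (Du bm) // (Du (smcomp E H2)) //; first by rewrite -smcompA H2c.
    by move=> z /=; rewrite H2d E_in.
  + by move=> i; rewrite -(n_eta l) -H1e -H2c.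
  + move=> H' Hc He; apply: H2u.
      by apply: H1u; [rewrite smcompA Hc | move=> i /=; rewrite n_eta He].
    by move=> z; rewrite E_SS Hc.
- have [cc univ] := lim l.
  pose G o' (p : lt o' o) := sval (cid (IH o' p _ (pre o' p))).
  have GP o' (p : lt o' o) := svalP (cid (IH o' p _ (pre o' p))).
  have [|H [H1 H2]] := univ _ cS G.
    move=> o1 o2 l1 p1 p2; have [a1 a2 a3] := GP o2 p2; have [_ _ b3] := GP o1 p1.
    apply: b3; last by move=> i /=; rewrite n_eta a2.
    by rewrite smcompA a1 -smcompA cc.
  have p0 : lt o0 o by apply: mn; case: l.
  exists H; split.
  + have [|D [_ D2]] := univ _ cB (fun o' p => smcomp bm (n p)).
      by move=> o1 o2 l1 p1 p2; rewrite -smcompA cc.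
    rewrite (D2 bm) // (D2 (smcomp E H)) // => o' p.
    rewrite -smcompA H1; by case: (GP o' p).
  + move=> i; rewrite -(n_eta p0) -[LHS]/(smcomp H (n p0) _ _ (eta o0 i)) H1.
    by case: (GP o0 p0).
  + move=> H' Hc He; apply: H2 => o' p; have [_ _ u] := GP o' p; apply: u.
      by rewrite smcompA Hc.
    by move=> i /=; rewrite n_eta He.
Qed.

(** [lift] applied to the identity yields a section [ka] of the canonical map [E] from the
    subdivision to the stage. So [h] is extended to the subdivision and composed with [ka]. For
    uniqueness, an extension [H'] equals the composite of [H'], [E] and [ka], and the composite of
    [H'] and [E] is determined by [Sub_uniq]. *)
Lemma restriction_pushout o (Z : sflow (option S)) (eZ : forall i, sP Z (es g i) (et b i))
    (h : smor (restS (A o)) (restS Z)) :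
  h _ _ (epath (eta o)) = epath eZ ->
  exists H : smor (A o) Z,
    [/\ forall s t x, H (Some s) (Some t) x = h _ _ x, forall i, H _ _ (eta o i) = eZ i &
     forall H' : smor (A o) Z, (forall s t x, H' (Some s) (Some t) x = h _ _ x) ->
       (forall i, H' _ _ (eta o i) = eZ i) -> H' = H].
Proof.
move=> he; have cR := scg_restS (cA o).
have [E [E1 E2]] := Sub_univ cR (f := sid _) (eB := eta o) (ep := epath (eta o)) erefl.
have [ka [ka1 ka2 _]] := lift (cA o) E1 E2 (bm := sid _) (fun i => erefl).
have ka_in s t x : ka (Some s) (Some t) x = x.
  by rewrite -[LHS]E1 -[LHS]/(smcomp E ka (Some s) (Some t) x) ka1.
have [T [T1 T2]] := Sub_univ cR he.
exists (smcomp T ka); split=> [s t x|i|H' h1 h2] /=.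
- by rewrite ka_in T1.
- by rewrite ka2 T2.
have <- : smcomp H' E = T.
  apply: Sub_uniq => [s t a|i] /=; first by rewrite E1 h1 T1.
  by rewrite E2 h2 T2.
by rewrite -smcompA ka1; exact: smor_eq.
Qed.

Definition unrest (Z : sflow S) (e : sP Z g b) (o : O) (H : smor (A o) (Sub e)) :
    smor (restS (A o)) Z :=
  @SMor S (restS (A o)) Z (fun s t x => H (Some s) (Some t) x)
    (fun s t => @s1_cont _ _ _ H (Some s) (Some t))
    (fun s t u => @s1_comp _ _ _ H (Some s) (Some t) (Some u)).

(** Subdivision as a right adjoint of restriction. Since [Sub e] restricts to [Z] by conversion,
    this is [restriction_pushout] with target [Sub e] and its own edges. *)
Lemma extend_sub o (Z : sflow S) (e : sP Z g b) (h : smor (restS (A o)) Z) :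
  h _ _ (epath (eta o)) = e ->
  exists H : smor (A o) (Sub e),
    [/\ unrest H = h, forall i, H _ _ (eta o i) = sedge e i &
     forall H' : smor (A o) (Sub e), unrest H' = h ->
       (forall i, H' _ _ (eta o i) = sedge e i) -> H' = H].
Proof.
move=> he.
pose h' : smor (restS (A o)) (restS (Sub e)) :=
  @SMor S (restS (A o)) (restS (Sub e)) (fun s t x => h s t x)
    (@s1_cont _ _ _ h) (@s1_comp _ _ _ h).
have [|H [H1 H2 H3]] := @restriction_pushout o (Sub e) (sedge e) h'.
  by rewrite /= he -[LHS](sedge_comp e).
exists H; split=> // [|H' e1 e2]; first exact: smor_eq.
by apply: H3 => // s t x; rewrite -[h' _ _ _]/(h s t x) -e1.
Qed.

Lemma epath_n o1 o2 (l : lt o1 o2) : restm (n l) _ _ (epath (eta o1)) = epath (eta o2).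
Proof.
rewrite [LHS](@s1_comp _ _ _ (n l)); 
exact: (congr2 (@scomp _ (A o2) (Some g) None (Some b)) (n_eta l false) (n_eta l true)).
Qed.

(** By [extend_sub], a map sending the composite edge to [e] is a map from the first stage to
    [Sub e] respecting the edges, and there is exactly one. *)
Lemma restriction_base (Z : sflow S) (e : sP Z g b) : scg Z ->
  exists h : smor (restS (A o0)) Z, h _ _ (epath (eta o0)) = e /\
  forall h' : smor (restS (A o0)) Z, h' _ _ (epath (eta o0)) = e -> h' = h.
Proof.
move=> cZ; have [H [H1 H2]] := base (sedge e) (scg_Sub e cZ).
exists (unrest H); split=> [|h' e'].
  rewrite [LHS](@s1_comp _ _ _ H) -[RHS](sedge_comp e).
  exact: (congr2 (@scomp _ (Sub e) (Some g) None (Some b)) (H1 false) (H1 true)).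
have [H' [e1 e2 _]] := extend_sub e'.
by rewrite -e1 (H2 H').
Qed.

(** A test map on the smaller restriction is transposed to a map into [Sub], extended there by the
    property of the step, and restricted again; [descend] transposes a competing extension. Cells
    are kept as they are, their ends being among the original states. *)
Lemma restriction_succ o1 o2 (l : lt o1 o2) : is_succ lt o1 o2 -> triv (restm (n l)) \/
  exists k (x y : S) (bd : Sphere k -> sP (restS (A o1)) x y)
    (ch : Disk k -> sP (restS (A o2)) x y), scell (restm (n l)) bd ch.
Proof.
move=> s.
have descend (Z : sflow S) (h : smor (restS (A o1)) Z) (H1 : smor (A o1) (Sub (h _ _ (epath (eta o1)))))
    (h'' : smor (restS (A o2)) Z) : smcomp h'' (restm (n l)) = h ->
    (forall H' : smor (A o1) (Sub (h _ _ (epath (eta o1)))), unrest H' = h ->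
      (forall i, H' _ _ (eta o1 i) = sedge _ i) -> H' = H1) ->
    exists H'' : smor (A o2) (Sub (h _ _ (epath (eta o1)))), unrest H'' = h'' /\ smcomp H'' (n l) = H1.
  move=> e u; have [|H'' [e1 e2 _]] := @extend_sub o2 Z (h _ _ (epath (eta o1))) h''.
    by rewrite -(epath_n l) -e.
  exists H''; split=> //; apply: u; last by move=> i /=; rewrite n_eta e2.
  by rewrite -[RHS]e -e1; exact: smor_eq.
have [tr|[k [x [y [bd [ch [bdc chc bdE univ]]]]]]] := succ l s.
  left=> Z cZ h; have [H1 [H1r H1e H1u]] := extend_sub (erefl (h _ _ (epath (eta o1)))).
  have [H2 [H2c H2u]] := tr _ (scg_Sub _ cZ) H1.
  exists (unrest H2); split.
    by rewrite -[RHS]H1r -H2c; exact: smor_eq.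
  move=> h'' e; have [H'' [e1 e2]] := descend Z h H1 h'' e H1u.
  by rewrite -e1 (H2u H'').
right; exists k, x, y, bd, ch; split=> // Z cZ h d dc dE.
have [H1 [H1r H1e H1u]] := extend_sub (erefl (h _ _ (epath (eta o1)))).
have [|H2 [H2c H2d H2u]] := univ _ (scg_Sub (h _ _ (epath (eta o1))) cZ) H1 d dc.
  by move=> z; rewrite -dE -[in RHS]H1r.
exists (unrest H2); split=> //.
  by rewrite -[RHS]H1r -H2c; exact: smor_eq.
move=> h'' e ed; have [H'' [e1 e2]] := descend Z h H1 h'' e H1u.
rewrite -e1 (H2u H'') // => z.
by rewrite -ed -[in RHS]e1.
Qed.

Lemma restriction_lim o : is_limit lt o0 o ->
  @scolim _ _ lt (fun o' => lt o' o) (fun o => restS (A o)) (fun o1 o2 l => restm (n l))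
    (restS (A o)) (fun o' l => restm (n l)).
Proof.
move=> l; have [cc univ] := lim l; have [_ _ tot mn] := wo.
have p0 : lt o0 o by apply: mn; case: l.
split=> [ o1 o2 l1 p1 p2|Z cZ c' ec].
  by rewrite -(cc _ _ l1 p1 p2); exact: smor_eq.
pose e := c' o0 p0 _ _ (epath (eta o0)).
(* All legs give the composite edge the same image, so they can be transposed to one and the same
   [Sub e]. *)
have he o' (p : lt o' o) : c' o' p _ _ (epath (eta o')) = e.
  have [e'|ne] := pselect (o' = o0).
    by subst o'; rewrite (Prop_irrelevance p p0).
  by rewrite -(epath_n (mn _ ne)) /e -(ec _ _ (mn _ ne) p0 p).
pose G o' (p : lt o' o) := sval (cid (extend_sub (he o' p))).
have GP o' (p : lt o' o) := svalP (cid (extend_sub (he o' p))).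
have [|H [H1 H2]] := univ _ (scg_Sub e cZ) G.
  move=> o1 o2 l1 p1 p2; have [a1 a2 _] := GP o2 p2; have [_ _ u] := GP o1 p1.
  apply: u => [|i] /=; last by rewrite n_eta a2.
  by rewrite -(ec _ _ l1 p1 p2) -a1; exact: smor_eq.
exists (unrest H); split=> [ o' p|u' eu].
  by have [a _ _] := GP o' p; rewrite -[RHS]a -[sval _]/(G o' p) -(H1 o' p); exact: smor_eq.
have [|H' [e1 e2 _]] := @extend_sub o Z e u'.
  by rewrite -(epath_n p0) -[LHS]/(smcomp u' (restm (n p0)) _ _ _) eu.
rewrite -e1 (H2 H') // => o' p; have [_ _ u] := GP o' p.
apply: u => [|i] /=; last by rewrite n_eta e2.
by rewrite -eu -e1; exact: smor_eq.
Qed.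

End Restriction.

(** * Relative cell complexes *)

Lemma glob_mor_ex (K : topologicalType) (Z : flow) (s u : fst_ Z) (d : K -> fP Z s u) :
  continuous d -> exists p : mor (glob K) Z,
    [/\ m0 p false = s, m0 p true = u & forall x : K, pin (@m1 _ _ p false true x) = pin (d x)].
Proof. by move=> dc; exists (glob_to dc). Qed.

Lemma scell_pushout (S : Type) (A B : sflow S) (f : smor A B) (n : nat) (s u : S)
    (bd : Sphere n -> sP A s u) (ch : Disk n -> sP B s u) :
  scg B -> scell f bd ch -> exists (a : mor (glob (Sphere n)) A) (b : mor (glob (Disk n)) B),
    is_pushout (glob_incl n) a b (s2m f).
Proof.
move=> cB [bdc chc bdE univ].
have [a [a0 a1 aE]] := @glob_mor_ex (Sphere n) A s u bd bdc.
have [b [b0 b1 bE]] := @glob_mor_ex (Disk n) B s u ch chc.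
exists a, b; apply/pushoutP; split; first exact: cB.
  apply: glob_mor_eq => [[]|x] /=; [by rewrite a1 b1 | by rewrite a0 b0|].
  rewrite bE -bdE.
  by rewrite -[RHS]/(pmap (s2m f) (pin (@m1 _ _ a false true x))) aE.
move=> Z cZ p' q' e.
have [h hE] := @mor_pull _ A Z (m0 q') q' (fun=> erefl).
have e0 x : m0 p' x = m0 q' (m0 a x) by rewrite -[RHS]/(m0 (mcomp q' a) x) -e.
have [|||d [dc dE]] := @pin_cast_fun (Disk n) Z _ _ (m0 q' s) (m0 q' u)
  (fun x => @m1 _ _ p' false true x).
- exact: (@m1_cont _ _ p' false true).
- by rewrite e0 a0.
- by rewrite e0 a1.
have [|h' [h'f h'd h'u]] := univ (pull (m0 q')) (scg_pull _ cZ) h d dc.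
  move=> x; apply: (@pin_inj Z); rewrite dE.
  rewrite -[LHS]/(pmap (mcomp (unpull (m0 q')) (s2m h)) (@pin A _ _ (bd x))) hE -aE.
  by rewrite -[LHS]/(pmap (mcomp q' a) (@pin (glob (Sphere n)) false true x)) -e.
exists (mcomp (unpull (m0 q')) (s2m h')); split.
- apply: glob_mor_eq => [[]|x] /=; [by rewrite b1 e0 a1 | by rewrite b0 e0 a0|].
  rewrite -[LHS]/(pmap (mcomp (unpull (m0 q')) (s2m h')) (pin (@m1 _ _ b false true x))) bE.
  by rewrite -dE /pmap /= h'd.
- by rewrite -mcompA -s2m_comp h'f.
- move=> g gb gf.
  have g0 : m0 g =1 m0 q' by move=> x; rewrite -gf.
  have [g' g'E] := mor_pull g0.
  rewrite -g'E; congr mcomp; congr s2m; apply: h'u.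
    by apply: unpull_inj; rewrite s2m_comp mcompA g'E gf hE.
  move=> x; apply: (@pin_inj Z); rewrite dE.
  rewrite -[LHS]/(pmap (mcomp (unpull (m0 q')) (s2m g')) (@pin B _ _ (ch x))) g'E -bE.
  by rewrite -[LHS]/(pmap (mcomp g b) (@pin (glob (Disk n)) false true x)) gb.
Qed.

Lemma scolim_colim (S O : Type) (lt : O -> O -> Prop) (P : O -> Prop) (A : O -> sflow S)
    (n : forall o1 o2, lt o1 o2 -> smor (A o1) (A o2)) (L : sflow S)
    (c : forall o, P o -> smor (A o) L) :
  scg L -> (forall x y, x = y \/ lt x y \/ lt y x) -> (exists o, P o) -> scolim n c ->
  @is_colim O lt P A (fun o1 o2 l => s2m (n o1 o2 l)) L (fun o p => s2m (c o p)).
Proof.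
move=> cL tot [ o Po] [cc univ]; apply/colimP; split; first exact: cL.
  by move=> o1 o2 l p1 p2; rewrite -s2m_comp cc.
move=> Z cZ c' ec; pose tau := m0 (c' o Po).
have st o1 p1 : m0 (c' o1 p1) =1 tau.
  move=> x; have [e|[l|l]] := tot o1 o.
  - by subst o1; rewrite (Prop_irrelevance p1 Po).
  - by rewrite -(ec _ _ l p1 Po).
  - by rewrite /tau -(ec _ _ l Po p1).
pose g o1 p1 := sval (cid (mor_pull (st o1 p1))).
have gE o1 p1 : mcomp (unpull tau) (s2m (g o1 p1)) = c' o1 p1 by exact: svalP (cid (mor_pull (st o1 p1))).
have [|u [u1 u2]] := univ (pull tau) (scg_pull _ cZ) g.
  by move=> o1 o2 l p1 p2; apply: unpull_inj; rewrite s2m_comp mcompA !gE ec.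
exists (mcomp (unpull tau) (s2m u)); split=> [ o1 p1|v ev].
  by rewrite -mcompA -s2m_comp u1 gE.
have v0 : m0 v =1 tau by move=> x; rewrite /tau -(ev o Po).
have [v' vE] := mor_pull v0.
rewrite -vE; congr mcomp; congr s2m; apply: u2 => o1 p1.
by apply: unpull_inj; rewrite s2m_comp mcompA vE gE.
Qed.

Lemma triv_comp (S : Type) (A B C : sflow S) (f : smor A B) (g : smor B C) :
  triv f -> triv g -> triv (smcomp g f).
Proof.
move=> tf tg Z cZ h; have [h1 [e1 u1]] := tf Z cZ h; have [h2 [e2 u2]] := tg Z cZ h1.
exists h2; split=> [|h' e]; first by rewrite smcompA e2.
by apply: u2; apply: u1; rewrite -smcompA.
Qed.

Lemma triv_scell (S : Type) (A B C : sflow S) (f : smor A B) (g : smor B C) (n : nat) (s u : S)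
    (bd : Sphere n -> sP A s u) (ch : Disk n -> sP B s u) :
  scell f bd ch -> triv g -> scell (smcomp g f) bd (fun x => g _ _ (ch x)).
Proof.
move=> [bdc chc bdE univ] tg; split=> //.
- by move=> x; apply: (@continuous_comp _ _ _ ch (fun y => g _ _ y)); [exact: chc | exact: s1_cont].
- by move=> x /=; rewrite bdE.
move=> Z cZ h d dc dE; have [h1 [e1 d1 u1]] := univ Z cZ h d dc dE.
have [h2 [e2 u2]] := tg Z cZ h1.
exists h2; split=> [|x|h' e dh]; first by rewrite smcompA e2.
  by rewrite -d1 -e2.
by apply: u2; apply: u1 => //; rewrite -smcompA.
Qed.

Lemma triv_iso (S : Type) (A B : sflow S) (f : smor A B) :
  scg A -> scg B -> triv f -> is_iso (s2m f).
Proof.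
move=> cA cB tf; have [r [rf _]] := tf A cA (sid A).
exists (s2m r); split; apply: meq_refl; rewrite -s2m_comp -s2m_id; congr s2m; first exact: rf.
have [h [_ u]] := tf B cB f.
have -> : smcomp f r = h by apply: u; rewrite -smcompA rf; exact: smor_eq.
by apply/esym; apply: u; exact: smor_eq.
Qed.

Lemma scolim_triv (S O : Type) (lt : O -> O -> Prop) (P : O -> Prop) (A : O -> sflow S)
    (n : forall o1 o2, lt o1 o2 -> smor (A o1) (A o2)) (L L' : sflow S)
    (c : forall o, P o -> smor (A o) L) (f : smor L L') :
  scolim n c -> triv f -> scolim n (fun o p => smcomp f (c o p)).
Proof.
move=> [cc univ] tf; split=> [ o1 o2 l p1 p2|Z cZ c' ec]; first by rewrite -smcompA cc.
have [u [u1 u2]] := univ Z cZ c' ec; have [v [v1 v2]] := tf Z cZ u.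
exists v; split=> [ o p|w ew]; first by rewrite smcompA v1.
by apply: v2; apply: u2 => o p; rewrite -smcompA.
Qed.

Section Reindex.
Variables (S O : Type) (lt : O -> O -> Prop) (o0 top : O).
Hypothesis wo : well_order_from lt o0.
Hypothesis top_max : forall o, o = top \/ lt o top.
Variables (X : O -> sflow S) (n : forall o1 o2, lt o1 o2 -> smor (X o1) (X o2)).
Hypothesis cX : forall o, scg (X o).
Hypothesis nD : forall o1 o2 o3 (h12 : lt o1 o2) (h23 : lt o2 o3) (h13 : lt o1 o3),
  smcomp (n h23) (n h12) = n h13.
Hypothesis succ : forall o1 o2 (l : lt o1 o2), is_succ lt o1 o2 -> triv (n l) \/
  exists k (x y : S) (bd : Sphere k -> sP (X o1) x y) (ch : Disk k -> sP (X o2) x y),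
    scell (n l) bd ch.
Hypothesis lim : forall o, is_limit lt o0 o ->
  @scolim _ _ lt (fun o' => lt o' o) X n (X o) (fun o' l => n l).

Let tr a b c : lt a b -> lt b c -> lt a c. Proof. by case: wo => _ h _ _; exact: h. Qed.
Let tot a b : a = b \/ lt a b \/ lt b a. Proof. by case: wo => _ _ h _; exact: h. Qed.

(* The steps with [triv] maps attach nothing and are removed from the index. *)
Definition keep (o : O) : Prop :=
  o = top \/ exists o1 (l : lt o o1), is_succ lt o o1 /\ ~ triv (n l).

Lemma lt_upper a b c : lt a c -> lt b c -> is_limit lt o0 c -> exists r, [/\ lt a r, lt b r & lt r c].
Proof.
move=> ac bc [_ h]; have [e|[l|l]] := tot a b.
- by subst b; have [r [r1 r2]] := h a ac; exists r.
- by have [r [r1 r2]] := h b bc; exists r; split=> //; exact: (tr l r1).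
- by have [r [r1 r2]] := h a ac; exists r; split=> //; exact: (tr l r1).
Qed.

Lemma triv_between p q (l : lt p q) :
  (forall o, keep o -> (o = p \/ lt p o) -> ~ lt o q) -> triv (n l).
Proof.
case: (wo) => wf _ _ _.
elim/(well_founded_ind wf): q l => q IH l nk.
have [e|[ o1 s]|lm] := wo_cases lt o0 q.
- subst q; case: wo => _ _ _ mn; have [e|ne] := pselect (p = o0).
    by subst p; case: (wo_irr wo l).
  by case: (wo_asym wo l (mn _ ne)).
- have l1 := proj1 s.
  have t1 : triv (n l1).
    apply: contrapT => nt; apply: (nk o1) => //; first by right; exists q, l1.
    by have [->|l2] := succ_le wo s l; [left|right].
  have [e|l2] := succ_le wo s l; first by subst o1; rewrite (Prop_irrelevance l l1).
  rewrite -(nD l2 l1 l); apply: triv_comp => //; apply: (IH o1 l1 l2) => o ko po lo.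
  by apply: (nk o ko po); exact: (tr lo l1).
have [cc univ] := lim lm => Z cZ h.
have ext r (b : lt p r) (c : lt r q) : exists hr, smcomp hr (n b) = h /\
    forall h' : smor (X r) Z, smcomp h' (n b) = h -> h' = hr.
  apply: (IH r c b _ Z cZ h) => o ko po lo.
  by apply: (nk o ko po); exact: (tr lo c).
pose G o (g : smor (X o) Z) := forall r (a : lt o r) (b : lt p r) (c : lt r q) (hr : smor (X r) Z),
  smcomp hr (n b) = h -> g = smcomp hr (n a).
have Gex o (po : lt o q) : exists g, G o g.
  have [r [a b c]] := lt_upper po l lm.
  have [hr [e u]] := ext r b c.
  exists (smcomp hr (n a)) => r' a' b' c' hr' e'.
  have [er|[lr|lr]] := tot r r'.
  - subst r'; rewrite (Prop_irrelevance a' a); rewrite (Prop_irrelevance b' b) in e'.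
    by rewrite (u hr').
  - by rewrite -(u (smcomp hr' (n lr))) -?smcompA ?(nD b lr b') ?(nD a lr a').
  - have [hr'' [_ u']] := ext r' b' c'.
    rewrite (u' hr') // -(u' (smcomp hr (n lr))) -?smcompA ?(nD b' lr b) //.
    by rewrite (nD a' lr a).
pose g o (po : lt o q) := sval (cid (Gex o po)).
have gP o (po : lt o q) : G o (g o po) by exact: svalP (cid (Gex o po)).
have [|u [u1 u2]] := univ Z cZ g.
  move=> o1 o2 l1 p1 p2; have [r [a b c]] := lt_upper p2 l lm.
  have [hr [e _]] := ext r b c.
  rewrite (gP o2 p2 r a b c hr e) (gP o1 p1 r (tr l1 a) b c hr e).
  by rewrite -smcompA (nD l1 a (tr l1 a)).
exists u; split.
  have [r [a b c]] := lt_upper l l lm; have [hr [e _]] := ext r b c.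
  by rewrite (u1 p l) (gP p l r b b c hr e).
move=> u' eu; apply: u2 => o po; have [r [a b c]] := lt_upper po l lm.
rewrite (gP o po r a b c (smcomp u' (n c))) -?smcompA ?(nD a c po) //.
by rewrite (nD b c l).
Qed.

Definition kidx : Type := {o : O | keep o}.
Definition klt (a b : kidx) : Prop := lt (sval a) (sval b).

Lemma klt_wf : well_founded klt.
Proof.
case: wo => wf _ _ _ [a ka]; elim: (wf a) ka => {}a _ IH ka.
by constructor => -[b kb] l; exact: (IH b l kb).
Qed.

Lemma keep_min : exists a : kidx, forall b : kidx, b <> a -> klt a b.
Proof.
have [|a [ka h]] := wo_min wo (P := keep); first by exists top; left.
exists (exist _ a ka) => -[b kb] ne; have [e|//] := h b kb.
by case: ne; apply: sig_eq.
Qed.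

Lemma klt_wo (a : kidx) : (forall b, b <> a -> klt a b) -> well_order_from klt a.
Proof.
move=> h; split.
- exact: klt_wf.
- by move=> x y z; exact: tr.
- by move=> x y; have [e|h'] := tot (sval x) (sval y); [left; exact: sig_eq | right].
- exact: h.
Qed.

Definition kX (a : kidx) : sflow S := X (sval a).
Definition kn (a b : kidx) (l : klt a b) : smor (kX a) (kX b) := n l.

Lemma keep_succ (a b : kidx) (l : klt a b) : is_succ klt a b -> K_pushout Ig (s2m (kn l)).
Proof.
move=> [_ nb].
have [et|[ o1 [l1 [s nt]]]] := svalP a.
  have [e|l'] := top_max (sval b).
    by case: (wo_irr wo (o := top)); rewrite -[in X in lt _ X]e -et.
  by case: (wo_asym wo l'); rewrite -et.
have [//|[k [x [y [bd [ch sc]]]]]] := succ l1 s.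
have [ch' sc'] : exists ch', scell (n l) bd ch'.
  have [e|[l2|l2]] := tot o1 (sval b).
  - subst o1; exists ch; by rewrite (Prop_irrelevance (l : lt _ _) l1).
  - exists (fun z => n l2 _ _ (ch z)); rewrite -(nD l1 l2 l); apply: triv_scell => //.
    apply: triv_between => o ko po lo; apply: nb; exists (exist _ o ko); split=> //.
    by rewrite /klt /=; case: po => [->//|]; exact: tr.
  - by case: s => _ []; exists (sval b).
have [a' [b' po]] := scell_pushout (cX _) sc'.
by exists _, _, (glob_incl k), a', b'; split => //; constructor.
Qed.

Lemma keep_lim (a0 e : kidx) : (forall b, b <> a0 -> klt a0 b) -> is_limit klt a0 e ->
  @is_colim kidx klt (fun a => klt a e) kX (fun a b l => s2m (kn l)) (kX e)
    (fun a l => s2m (kn l)).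
Proof.
move=> mn [ne lm]; have a0e : klt a0 e by exact: mn.
suff sc : @scolim _ _ klt (fun a => klt a e) kX kn (kX e) (fun a l => kn l).
  apply: (scolim_colim (n := kn) (c := fun a l => kn l)) sc => //.
  - exact: cX.
  - by case: (klt_wo mn).
  - by exists a0.
have [|p [pE pmin]] := wo_min wo (P := fun p => forall a : kidx, klt a e -> lt (sval a) p).
  by exists (sval e).
have plim : is_limit lt o0 p.
  split=> [ep|o lo].
    have [wf _ _ mno] := wo; have l := pE a0 a0e; rewrite ep in l.
    have [e0|n0] := pselect (sval a0 = o0); first by rewrite e0 in l; case: (wo_irr wo l).
    by case: (wo_asym wo l (mno _ n0)).
  have [a [ae oa]] : exists a : kidx, klt a e /\ ~ lt (sval a) o.
    apply: contrapT => na; have H : forall a : kidx, klt a e -> lt (sval a) o.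
      by move=> a ae; apply: contrapT => nl; apply: na; exists a.
    have [eo|lpo] := pmin o H; first by subst o; case: (wo_irr wo lo).
    by case: (wo_asym wo lo lpo).
  have [b [ab be]] := lm a ae.
  exists (sval b); split; last exact: pE.
  by have [<-|[l|l]] := tot (sval a) o; [exact: ab | case: oa | exact: (tr l ab)].
have [cc univ] := lim plim.
have cof o (lo : lt o p) : exists a : kidx, klt a e /\ lt o (sval a).
  have [_ h] := plim; have [r [r1 r2]] := h o lo.
  apply: contrapT => na; have H : forall a : kidx, klt a e -> lt (sval a) r.
    move=> a ae; have [er|[//|l]] := tot (sval a) r.
      by case: na; exists a; split=> //; rewrite er.
    by case: na; exists a; split=> //; exact: (tr r1 l).
  have [eo|lpo] := pmin r H; first by subst r; case: (wo_irr wo r2).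
  by case: (wo_asym wo r2 lpo).
have scp : @scolim _ _ klt (fun a => klt a e) kX kn (X p) (fun a l => n (pE a l)).
  split=> [a b l la lb|Z cZ c' ec]; first exact: nD.
  pose G o (g : smor (X o) Z) := forall (a : kidx) (ae : klt a e) (l : lt o (sval a)),
    g = smcomp (c' a ae) (n l).
  have Gex o (lo : lt o p) : exists g, G o g.
    have [a [ae la]] := cof o lo; exists (smcomp (c' a ae) (n la)) => b be lb.
    have [eab|[l|l]] := tot (sval a) (sval b).
    - have eab' := sig_eq eab; subst b.
      by rewrite (Prop_irrelevance lb la) (Prop_irrelevance be ae).
    - by rewrite -(ec a b l ae be) -smcompA (nD la l lb).
    - by rewrite -(ec b a l be ae) -smcompA (nD lb l la).
  pose g o (lo : lt o p) := sval (cid (Gex o lo)).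
  have gP o (lo : lt o p) : G o (g o lo) by exact: svalP (cid (Gex o lo)).
  have ga a ae : g (sval a) (pE a ae) = c' a ae.
    have [b [ab be]] := lm a ae.
    by rewrite (gP _ (pE a ae) b be ab) -(ec a b ab ae be).
  have [|u [u1 u2]] := univ Z cZ g.
    move=> x y l lx ly; have [a [ae la]] := cof y ly.
    by rewrite (gP y ly a ae la) (gP x lx a ae (tr l la)) -smcompA (nD l la (tr l la)).
  exists u; split=> [a ae|u' eu]; first by rewrite u1 ga.
  apply: u2 => x lx; have [a [ae la]] := cof x lx.
  by rewrite (gP x lx a ae la) -eu -smcompA (nD la (pE a ae) lx).
have [ep|lpe] := pmin (sval e) (fun a ae => ae).
  move: pE scp {cc univ cof plim pmin}; rewrite {p}ep => pE.
  congr scolim; apply: functional_extensionality_dep => a.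
  by apply: funext => ae; rewrite (Prop_irrelevance (pE a ae) ae).
rewrite (_ : (fun a l => kn l) = (fun a l => smcomp (n lpe) (n (pE a l)))); last first.
  apply: functional_extensionality_dep => a; apply: functional_extensionality_dep => ae.
  by rewrite (nD (pE a ae) lpe ae).
apply: scolim_triv => //; apply: triv_between => o ko po lo.
have /(wo_irr wo) // : lt o o.
have H : lt o p := pE (exist _ o ko) lo.
by case: po => [eo|l]; [rewrite -eo in H | exact: (tr H l)].
Qed.

Lemma rel_cell_reindex (B : flow) (psi : mor (X top) B) (f : mor (X o0) B) :
  cg_flow B -> is_iso psi -> (forall l : lt o0 top, f = mcomp psi (s2m (n l))) ->
  o0 <> top -> rel_cell Ig f.
Proof.
move=> cB [psi' [/mor_eq i1 /mor_eq i2]] fE n0.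
have [a0 mn] := keep_min.
pose mp o1 o2 (l : lt o1 o2) := s2m (n l) : mor (X o1) (X o2).
have [r [r1 r2]] := maps_to_max wo mp top_max.
have rD o1 o2 (l : lt o1 o2) : mcomp (r o2) (mp _ _ l) = r o1.
  have [e|l2] := top_max o2.
    by subst o2; rewrite r1 mcomp1m (r2 _ l).
  by rewrite (r2 _ l2) (r2 _ (tr l l2)) /mp -s2m_comp (nD l l2 (tr l l2)).
have [iota [iso_iota iotaE]] : exists iota : mor (X o0) (kX a0), is_iso iota /\
    mcomp (r (sval a0)) iota = r o0.
  have [e|ne] := pselect (sval a0 = o0).
    rewrite /kX e; exists (idmor _); split; last exact: mcompm1.
    by exists (idmor _).
  have l : lt o0 (sval a0) by case: wo => _ _ _; exact.
  exists (s2m (n l)); split; last exact: (rD _ _ l).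
  apply: triv_iso; [exact: cX | exact: cX|].
  apply: triv_between => o ko po lo.
  have [e|/mn l'] := pselect (exist _ o ko = a0).
    by subst a0; exact: (wo_irr wo lo).
  exact: (wo_asym wo l' lo).
exists kidx, klt, a0, (fun a => toflow (kX a)), (fun a b l => s2m (kn l)),
  (fun a => mcomp psi (r (sval a))), iota; split.
- exact: klt_wo.
- by move=> a b d l1 l2 l3; apply: meq_refl; rewrite -s2m_comp /kn (nD l1 l2 l3).
- split; first exact: keep_succ.
  by move=> e; exact: keep_lim.
- apply/colimP; split=> // [a b l _ _|Z cZ c' ec].
    by rewrite -mcompA (rD _ _ l).
  pose kt : kidx := exist _ top (or_introl erefl).
  have ct a : c' a Logic.I = mcomp (c' kt Logic.I) (r (sval a)).
    have [e|l] := top_max (sval a).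
      have e' : a = kt by exact: sig_eq.
      by subst a; rewrite r1 mcompm1.
    by rewrite -(ec a kt l Logic.I Logic.I) (r2 _ l).
  exists (mcomp (c' kt Logic.I) psi'); split=> [a []|u' eu].
    by rewrite [RHS]ct -mcompA [mcomp psi' _]mcompA i1 mcomp1m.
  by rewrite -(eu kt Logic.I) /= r1 mcompm1 -mcompA i2 mcompm1.
- split=> //; apply: meq_refl; rewrite -mcompA iotaE.
  have l : lt o0 top by have [|//] := top_max o0.
  by rewrite (fE l) (r2 _ l).
Qed.

End Reindex.

Lemma well_order_exists (S : Type) (s : S) :
  exists (lt : S -> S -> Prop) (s0 : S), well_order_from lt s0.
Proof.
pose T : eqType := HB.pack S (gen_eqMixin S).
have [Rl wR] := wochoice.well_ordering_principle T.
have minP (P : T -> Prop) : (exists x, P x) -> exists x, P x /\ forall y, P y -> Rl x y.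
  move=> [x Px]; have [z [[zA lb] _]] := wR [pred y | `[<P y>]] (ex_intro _ x (asboolT Px)).
  exists z; split; first exact/asboolP.
  by move=> y Py; apply: lb; apply/asboolP.
have anti x y : Rl x y -> Rl y x -> x = y.
  move=> xy yx; have xx : Rl x x.
    by have [z [-> h]] := minP (eq^~ x) (ex_intro _ x erefl); exact: h.
  have yy : Rl y y.
    by have [z [-> h]] := minP (eq^~ y) (ex_intro _ y erefl); exact: h.
  have [z [_ zu]] := wR [pred w | (w == x) || (w == y)] (ex_intro _ x (predU1l _ erefl)).
  have zx : z = x.
    apply: zu; split; first by rewrite !inE eqxx.
    by move=> w; rewrite !inE => /orP[/eqP->|/eqP->].
  rewrite -zx; apply: zu; split; first by rewrite !inE eqxx orbT.
  by move=> w; rewrite !inE => /orP[/eqP->|/eqP->].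
pose lt (x y : T) := Rl x y /\ x <> y.
have tot x y : x = y \/ lt x y \/ lt y x.
  have [->|ne] := pselect (x = y); [by left | right].
  have [z [zxy h]] := minP (fun z => z = x \/ z = y) (ex_intro _ x (or_introl erefl)).
  have hx := h x (or_introl erefl); have hy := h y (or_intror erefl).
  by case: zxy => e; subst z; [left | right; split=> // /esym].
have asym x y : lt x y -> ~ lt y x by move=> [xy ne] [yx _]; apply: ne; exact: anti.
have wf : well_founded lt.
  move=> x; apply: contrapT => nx.
  have [z [nz h]] := minP (fun z => ~ Acc lt z) (ex_intro _ x nx).
  apply: nz; constructor => y [yz ne]; apply: contrapT => ny.
  by apply: ne; apply: anti => //; exact: h.
have [s0 [_ h0]] := minP (fun=> True) (ex_intro _ s Logic.I).
exists lt, s0; split.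
- exact: wf.
- move=> x y z xy yz; have [e|[//|l]] := tot x z.
    by subst z; case: (asym x y).
  have [w [hw h]] := minP (fun w => [\/ w = x, w = y | w = z]) (ex_intro _ x (Or31 _ _ erefl)).
  have hx := h x (Or31 _ _ erefl); have hy := h y (Or32 _ _ erefl).
  have hz := h z (Or33 _ _ erefl).
  case: hw => e; subst w.
  + by case: l => Rzx ne; case: ne; exact: anti.
  + by case: xy => Rxy ne; case: ne; exact: anti.
  + by case: yz => Ryz ne; case: ne; exact: anti.
- exact: tot.
- by move=> x ne; split; [exact: h0 | exact/nesym].
Qed.

Lemma cg_set_flow (T : Type) : cg_flow (set_flow T).
Proof. by move=> a b; exact: cg_void. Qed.

Lemma set_flow_add_point (A B : Type) (i : A -> B) (b : B) :
  injective i -> (forall a, i a <> b) -> (forall x, x = b \/ exists a, x = i a) ->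
  is_pushout (set_mor (fun v : void => tt)) (set_to (Z := set_flow A) (fun v : void => match v with end))
    (set_to (Z := set_flow B) (fun=> b)) (set_mor i).
Proof.
move=> inj nb cov; apply/pushoutP; split; first exact: cg_set_flow.
  by apply: set_flow_eq; case.
move=> Z cZ p' q' _.
have H x : exists z, (x = b -> z = m0 p' tt) /\ forall a, x = i a -> z = m0 q' a.
  have [->|[a ->]] := cov x.
    by exists (m0 p' tt); split=> // a e; case: (nb a).
  by exists (m0 q' a); split=> [/nb//|a' /inj->].
exists (set_to (fun x => sval (cid (H x)))); split.
- by apply: set_flow_eq => -[] /=; have [h _] := svalP (cid (H b)); exact: h.
- by apply: set_flow_eq => a /=; have [_ h] := svalP (cid (H (i a))); exact: h.
- move=> h' e1 e2; apply: set_flow_eq => x /=; have [h1 h2] := svalP (cid (H x)).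
  have [e|[a e]] := cov x.
    by rewrite (h1 e) -e1 e.
  by rewrite (h2 a e) -e2 e.
Qed.

Section Discrete.
Variables (S : Type) (lt : S -> S -> Prop) (s0 : S).
Hypothesis wo : well_order_from lt s0.

Definition before (o : option S) : Type := {s : S | lt_top lt (Some s) o}.

Lemma lt_top_trans (a b c : option S) : lt_top lt a b -> lt_top lt b c -> lt_top lt a c.
Proof. by case: (lt_top_wo wo) => _ h _ _; exact: h. Qed.

Definition before_incl o1 o2 (l : lt_top lt o1 o2) (x : before o1) : before o2 :=
  exist _ (sval x) (lt_top_trans (svalP x) l).

Lemma rel_cell_set_flow : rel_cell Ig (empty_mor (set_flow S)).
Proof.
have E0 : before (Some s0) -> void.
  move=> [s l]; exfalso; move: l => /= l; have [_ _ _ mn] := wo.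
  have [e|ne] := pselect (s = s0); first by subst s; case: (wo_irr wo l).
  by case: (wo_asym wo l (mn _ ne)).
have woT := lt_top_wo wo.
exists (option S), (lt_top lt), (Some s0), (fun o => set_flow (before o)),
  (fun o1 o2 l => set_mor (before_incl l)), (fun o => set_mor (fun x : before o => sval x)),
  (set_to (Z := set_flow (before (Some s0))) (fun v : void => match v with end)); split.
- exact: woT.
- by move=> o1 o2 o3 l1 l2 l3; apply: meq_refl; apply: set_flow_eq => x; exact: sig_eq.
- split=> [ o1 o2 l s|o [ne lm]].
    case: o1 l s => [s|] // l sc.
    pose b0 : before o2 := exist (fun s => lt_top lt (Some s) o2) s l.
    exists (set_flow void), (set_flow unit), (set_mor (fun v : void => tt)),
      (set_to (Z := set_flow (before (Some s))) (fun v : void => match v with end)),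
      (set_to (Z := set_flow (before o2)) (fun=> b0)).
    split; first exact: Ig_pt.
    apply: (@set_flow_add_point _ _ (before_incl l) b0).
    + by move=> x y /(congr1 sval) /= e; exact: sig_eq.
    + by move=> x /(congr1 sval) /= e; have := svalP x; rewrite /= e; exact: (wo_irr wo).
    + move=> [x lx]; have [e|lxs] := succ_le woT sc lx.
        by left; apply: sig_eq; case: e.
      by right; exists (exist _ x lxs); exact: sig_eq.
  apply/colimP; split; first exact: cg_set_flow.
    by move=> o1 o2 l p1 p2; apply: set_flow_eq => x; exact: sig_eq.
  move=> Z cZ c' ec.
  have up (x : before o) : exists o' (l : lt_top lt o' o) (y : before o'), sval y = sval x.
    have [ o' [l1 l2]] := lm _ (svalP x); exists o', l2.
    by exists (exist (fun s => lt_top lt (Some s) o') (sval x) l1).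
  have H (x : before o) : exists z, forall o' (l : lt_top lt o' o) (y : before o'),
      sval y = sval x -> z = m0 (c' o' l) y.
    have [ o' [l [y ey]]] := up x; exists (m0 (c' o' l) y) => o'' l'' y'' ey''.
    have [_ _ tot _] := woT; have [e|[h|h]] := tot o' o''.
    - subst o''; rewrite (Prop_irrelevance l'' l); congr m0; apply: sig_eq.
      by rewrite ey ey''.
    - rewrite -(ec _ _ h l l'') /=; congr m0; apply: sig_eq; by rewrite /= ey ey''.
    - rewrite -(ec _ _ h l'' l) /=; congr m0; apply: sig_eq; by rewrite /= ey ey''.
  exists (set_to (fun x => sval (cid (H x)))); split=> [ o' p|u' eu].
    by apply: set_flow_eq => y /=; have h := svalP (cid (H (before_incl p y))); exact: (h o' p y).
  apply: set_flow_eq => x /=; have [ o' [l [y ey]]] := up x.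
  rewrite (svalP (cid (H x)) o' l y ey) -(eu o' l) /=; congr m0; exact: sig_eq.
- apply/colimP; split; first exact: cg_set_flow.
    by move=> o1 o2 l p1 p2; apply: set_flow_eq.
  move=> Z cZ c' ec.
  exists (set_to (fun s => m0 (c' None Logic.I) (exist (fun s => lt_top lt (Some s) None) s Logic.I))).
  split=> [ o p|u' eu].
    apply: set_flow_eq => x /=; case: o p x => [ o|] p x.
      rewrite -(ec (Some o) None Logic.I p Logic.I) /=; congr m0; exact: sig_eq.
    by case: p; congr m0; exact: sig_eq.
  by apply: set_flow_eq => s /=; rewrite -(eu None Logic.I).
- split; last by apply: meq_refl; apply: set_flow_eq; case.
  exists (set_to (Z := empty_flow) E0); split; apply: meq_refl; apply: set_flow_eq; first by case.
  by move=> x; case: (E0 x).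
Qed.

End Discrete.

Lemma rel_cell_discrete (S : Type) (s : S) : rel_cell Ig (empty_mor (set_flow S)).
Proof. by have [lt [s0 wo]] := well_order_exists s; exact: (rel_cell_set_flow wo). Qed.

(** * Assembling the factorization *)

Definition incl (S : Type) (B : sflow (option S)) : mor (restS B) B := @unpull S B Some.

Lemma mor_pull_gen (W Z : flow) (T : Type) (sig : fst_ W -> T) (tau : T -> fst_ Z) (h : mor W Z) :
  (forall a, m0 h a = tau (sig a)) ->
  exists g : mor W (pull tau), m0 g =1 sig /\ mcomp (unpull tau) g = h.
Proof.
case: h => h0 h1 hc hm /= /funext e; subst h0.
by exists (@Mor W (pull tau) sig h1 hc hm); split=> //; exact: mor_eq.
Qed.

Lemma unpull_mono (W Z : flow) (T : Type) (tau : T -> fst_ Z) (a b : mor W (pull tau)) :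
  injective tau -> mcomp (unpull tau) a = mcomp (unpull tau) b -> a = b.
Proof.
case: a b => a0 a1 ac am [b0 b1 bc bm] inj e.
have e0 : a0 = b0.
  by apply: funext => x; apply: inj; exact: (congr1 (fun h : mor W Z => m0 h x) e).
subst b0; apply: mor_eq; split=> //= x y z; congr pin; apply: (@pin_inj Z).
exact: (congr1 (fun h : mor W Z => pmap h (pin z)) e).
Qed.

Lemma mor_smor (S : Type) (A B : sflow S) (h : mor A B) :
  m0 h =1 id -> exists g : smor A B, s2m g = h.
Proof.
case: h => h0 h1 hc hm /= /funext e; subst h0.
by exists (@SMor S A B h1 hc hm); exact: mor_eq.
Qed.

Definition i30 : 'I_3 := ord0.
Definition i31 : 'I_3 := @Ordinal 3 1 isT.
Definition i32 : 'I_3 := ord_max.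
Definition p01 : fP IxI i30 i31 := tt.
Definition p12 : fP IxI i31 i32 := tt.

Lemma II_cases (i j : 'I_3) (x : fP IxI i j) :
  [\/ i = i30 /\ j = i31, i = i31 /\ j = i32 | i = i30 /\ j = i32].
Proof.
have := II_P_lt x; case: i j {x} => [[|[|[|i]]] hi] [[|[|[|j]]] hj] //= _.
- by constructor 1; split; apply: val_inj.
- by constructor 3; split; apply: val_inj.
- by constructor 2; split; apply: val_inj.
Qed.

Lemma IxI_eq (Z : flow) (f g : mor IxI Z) : m0 f =1 m0 g ->
  pin (m1 f p01) = pin (m1 g p01) -> pin (m1 f p12) = pin (m1 g p12) -> f = g.
Proof.
move=> e0 e1 e2; apply: mor_eq; split=> // i j x.
have [[ei ej]|[ei ej]|[ei ej]] := II_cases x; subst i j.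
- by rewrite (II_P_sub x p01).
- by rewrite (II_P_sub x p12).
- rewrite (II_P_sub x (fcomp p01 p12)) !m1_comp; exact: pin_comp.
Qed.

Lemma IxI_to (Z : flow) (a b c : fst_ Z) (x : fP Z a b) (y : fP Z b c) :
  exists f : mor IxI Z, [/\ m0 f i30 = a, m0 f i31 = b, m0 f i32 = c,
    pin (m1 f p01) = pin x & pin (m1 f p12) = pin y].
Proof.
pose st (i : 'I_3) : fst_ Z := match val i with 0 => a | 1 => b | _ => c end.
have H (i j : 'I_3) (u : fP IxI i j) : exists v : fP Z (st i) (st j),
    [/\ i = i30 -> j = i31 -> pin v = pin x, i = i31 -> j = i32 -> pin v = pin y &
        i = i30 -> j = i32 -> pin v = pin (fcomp x y)].
  by have [[ei ej]|[ei ej]|[ei ej]] := II_cases u; subst i j;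
    [exists x | exists y | exists (fcomp x y)].
pose f1 i j u := sval (cid (H i j u)).
have f1P i j u := svalP (cid (H i j u)).
have f1c i j : continuous (@f1 i j).
  move=> u; rewrite (_ : @f1 i j = cst (f1 i j u)); first exact: cst_continuous.
  by apply: funext => v; rewrite (II_P_sub v u).
have f1m i j k (u : fP IxI i j) (v : fP IxI j k) : f1 i k (fcomp u v) = fcomp (f1 i j u) (f1 j k v).
  apply: pin_inj.
  have [[ei ej]|[ei ej]|[ei ej]] := II_cases u; have [[ej' ek]|[ej' ek]|[ej' ek]] := II_cases v;
    subst i k; rewrite ?ej in ej' *; move: (ej) (ej') => // _ _; try by subst j.
  subst j; have [_ _ h] := f1P _ _ (fcomp u v); rewrite h //.
  by apply: pin_comp; apply: esym; [have [h1 _ _] := f1P _ _ u; exact: h1 | have [_ h2 _] := f1P _ _ v; exact: h2].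
exists (@Mor IxI Z st f1 f1c f1m); split=> //.
- by have [h _ _] := f1P _ _ p01; exact: h.
- by have [_ h _] := f1P _ _ p12; exact: h.
Qed.

Section Assembly.
Variables (S : Type) (g b : S) (O : Type) (lt : O -> O -> Prop) (o0 top : O).
Hypothesis wo : well_order_from lt o0.
Hypothesis top_max : forall o, o = top \/ lt o top.
Hypothesis top_n0 : o0 <> top.
Variables (A : O -> sflow (option S)) (n : forall o1 o2, lt o1 o2 -> smor (A o1) (A o2))
  (eta : forall o i, sP (A o) (es g i) (et b i)).
Hypothesis cA : forall o, scg (A o).
Hypothesis n_eta : forall o1 o2 (l : lt o1 o2) i, n l _ _ (eta o1 i) = eta o2 i.
Hypothesis nD : forall o1 o2 o3 (h12 : lt o1 o2) (h23 : lt o2 o3) (h13 : lt o1 o3),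
  smcomp (n h23) (n h12) = n h13.
Hypothesis base : forall (Z : sflow (option S)) (eZ : forall i, sP Z (es g i) (et b i)),
  scg Z -> exists H : smor (A o0) Z, (forall i, H _ _ (eta o0 i) = eZ i) /\
  forall H' : smor (A o0) Z, (forall i, H' _ _ (eta o0 i) = eZ i) -> H' = H.
Hypothesis succ : forall o1 o2 (l : lt o1 o2), is_succ lt o1 o2 -> triv (n l) \/
  exists k (x y : S) (bd : Sphere k -> sP (A o1) (Some x) (Some y))
    (ch : Disk k -> sP (A o2) (Some x) (Some y)), scell (n l) bd ch.
Hypothesis lim : forall o, is_limit lt o0 o ->
  @scolim _ _ lt (fun o' => lt o' o) A n (A o) (fun o' l => n l).

Lemma edge_pushout o (Z : flow) (h : mor (restS (A o)) Z) (a : fst_ Z)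
    (x : fP Z (m0 h g) a) (y : fP Z a (m0 h b)) :
  m1 h (epath (eta o)) = fcomp x y ->
  exists H : mor (A o) Z, [/\ mcomp H (incl (A o)) = h, m0 H None = a,
     pin (@m1 _ _ H (Some g) None (eta o false)) = pin x,
     pin (@m1 _ _ H None (Some b) (eta o true)) = pin y &
     forall H' : mor (A o) Z, mcomp H' (incl (A o)) = h -> m0 H' None = a ->
       pin (@m1 _ _ H' (Some g) None (eta o false)) = pin x ->
       pin (@m1 _ _ H' None (Some b) (eta o true)) = pin y -> H' = H].
Proof.
move=> e; pose tau s := if s is Some s then m0 h s else a.
pose h' : smor (restS (A o)) (restS (pull tau)) :=
  @SMor S (restS (A o)) (restS (pull tau)) (fun s t z => m1 h z)
    (fun s t => @m1_cont _ _ h s t) (fun s t u => @m1_comp _ _ h s t u).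
pose eZ i : sP (pull tau) (es g i) (et b i) :=
  match i return sP (pull tau) (es g i) (et b i) with false => x | true => y end.
have [//|H [H1 H2 H3]] := restriction_pushout wo cA n_eta base succ lim (eZ := eZ) (h := h').
exists (mcomp (unpull tau) (s2m H)); split=> //.
- by apply: mor_eq; split=> // s t z /=; rewrite H1.
- by rewrite /= (H2 false).
- by rewrite /= (H2 true).
move=> H' e1 e2 e3 e4.
have st : m0 H' =1 tau by move=> [s|] //=; rewrite -e1.
have [K KE] := mor_pull st; rewrite -KE; congr mcomp; congr s2m.
apply: H3 => [s t z|[]].
- apply: (@pin_inj Z); rewrite -[RHS]/(pmap h (@pin (restS (A o)) _ _ z)) -e1 -KE //.
- apply: (@pin_inj Z); rewrite -[RHS]e4 -KE //.
- apply: (@pin_inj Z); rewrite -[RHS]e3 -KE //.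
Qed.

Let V := restS (A o0).
Let Vh := A o0.

Lemma V_pushout : exists (c : mor (glob (Sphere 0)) (set_flow S)) (d : mor (glob (Disk 0)) V),
  [/\ is_pushout (glob_incl 0) c d (set_to (Z := V) id),
      m0 d false = g, m0 d true = b & pin (@m1 _ _ d false true (center 0)) = @pin V _ _ (epath (eta o0))].
Proof.
have [c [c0 c1 _]] := @glob_mor_ex (Sphere 0) (set_flow S) g b
  (fun x => match Sphere0_empty x with end) (continuous_from_empty (@Sphere0_empty)).
have [d [d0 d1 dE]] := @glob_mor_ex (Disk 0) V g b (cst (epath (eta o0))) (@cst_continuous _ _ _).
exists c, d; split=> //.
apply/pushoutP; split; first by move=> s t; exact: cA.
  by apply: glob_mor_eq => [[]|x] /=; [rewrite d1 c1 | rewrite d0 c0 | case: (Sphere0_empty x)].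
move=> Z cZ p' q' e.
have e0 x : m0 p' x = m0 q' (m0 c x) by rewrite -[RHS]/(m0 (mcomp q' c) x) -e.
have [||ep epE] := @pin_cast Z _ _ (m0 q' g) (m0 q' b) (@m1 _ _ p' false true (center 0)).
- by rewrite e0 c0.
- by rewrite e0 c1.
have [h [h1 h2]] := restriction_base wo cA n_eta base succ lim (ep : sP (pull (m0 q')) g b) (scg_pull (m0 q') cZ).
exists (mcomp (unpull (m0 q')) (s2m h)); split.
- apply: glob_mor_eq => [[]|x] /=; [by rewrite d1 e0 c1 | by rewrite d0 e0 c0|].
  rewrite -[LHS]/(pmap (mcomp (unpull (m0 q')) (s2m h)) (pin (@m1 _ _ d false true x))) dE.
  by rewrite /pmap /= h1 epE (Disk0_center x).
- exact: set_flow_eq.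
- move=> h' ep' eq'.
  have st : m0 h' =1 m0 q' by move=> s; rewrite -eq'.
  have [K KE] := mor_pull st; rewrite -KE; congr mcomp; congr s2m; apply: h2.
  apply: (@pin_inj Z); rewrite epE -ep'.
  rewrite -[RHS]/(pmap h' (pin (@m1 _ _ d false true (center 0)))) dE -KE //.
Qed.

Lemma Vh_pushout (d : mor (glob (Disk 0)) V) :
  m0 d false = g -> m0 d true = b ->
  pin (@m1 _ _ d false true (center 0)) = @pin V _ _ (epath (eta o0)) ->
  exists phi : mor (glob (Disk 0)) IxI,
    [/\ m0 phi false = i30, m0 phi true = i32 &
     exists n' : mor IxI Vh, is_pushout phi d n' (incl Vh)].
Proof.
move=> d0 d1 dE.
have [phi [ph0 ph1 phE]] := @glob_mor_ex (Disk 0) IxI i30 i32 (cst (fcomp p01 p12)) (@cst_continuous _ _ _).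
exists phi; split=> //.
have [n' [n0 n1 n2 nx ny]] := @IxI_to Vh (Some g) None (Some b) (eta o0 false) (eta o0 true).
exists n'; apply/pushoutP; split; first by move=> s t; exact: cA.
  apply: glob_mor_eq => [[]|x] /=; [by rewrite ph1 d1 | by rewrite ph0 d0|].
  rewrite -[LHS]/(pmap n' (pin (@m1 _ _ phi false true x))) phE.
  rewrite -[RHS]/(pmap (incl Vh) (pin (@m1 _ _ d false true x))) (Disk0_center x) dE.
  by rewrite /pmap /= (m1_comp n' p01 p12); exact: (pin_comp nx ny).
move=> Z cZ p' q' e.
have e0 x : m0 p' (m0 phi x) = m0 q' (m0 d x) by exact: (congr1 (fun h : mor _ Z => m0 h x) e).
have [|//|x xE] := @pin_cast Z _ _ (m0 q' g) (m0 p' i31) (m1 p' p01).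
  by rewrite -d0 -e0 ph0.
have [//||y yE] := @pin_cast Z _ _ (m0 p' i31) (m0 q' b) (m1 p' p12).
  by rewrite -d1 -e0 ph1.
have [|H [H1 H2 H3 H4 H5]] := @edge_pushout o0 Z q' (m0 p' i31) x y.
  apply: pin_inj; rewrite (pin_comp xE yE) -m1_comp.
  rewrite -[LHS]/(pmap q' (@pin V _ _ (epath (eta o0)))) -dE.
  rewrite -[LHS]/(pmap (mcomp q' d) (@pin (glob (Disk 0)) false true (center 0))) -e.
  by rewrite -[LHS]/(pmap p' (pin (@m1 _ _ phi false true (center 0)))) phE.
exists H; split=> // [|h' en em].
  apply: IxI_eq.
  - move=> [[|[|[|i]]] hi] //=.
    + rewrite (_ : Ordinal hi = i30) ?n0; last exact: val_inj.
      by rewrite -ph0 e0 d0 -H1.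
    + by rewrite (_ : Ordinal hi = i31) ?n1; last exact: val_inj.
    + rewrite (_ : Ordinal hi = i32) ?n2; last exact: val_inj.
      by rewrite -ph1 e0 d1 -H1.
  - by rewrite -[LHS]/(pmap H (pin (m1 n' p01))) nx -xE.
  - by rewrite -[LHS]/(pmap H (pin (m1 n' p12))) ny -yE.
apply: H5 => //.
- by rewrite -n1 -en.
- by rewrite xE -en -[RHS]/(pmap h' (pin (m1 n' p01))) nx.
- by rewrite yE -en -[RHS]/(pmap h' (pin (m1 n' p12))) ny.
Qed.

Variables (X Y : flow) (f : mor X Y).
Hypotheses (cX : cg_flow X) (cY : cg_flow Y).
Variables (w : mor (A top) Y) (j : mor Y (A top)) (psi : mor (restS (A top)) X)
  (chi : mor X (restS (A top))).
Hypotheses (wj : mcomp w j = idmor _) (jw : mcomp j w = idmor _).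
Hypotheses (pc : mcomp psi chi = idmor _) (cp : mcomp chi psi = idmor _).
Hypothesis fpsi : mcomp f psi = mcomp w (incl (A top)).

Lemma jf : mcomp j f = mcomp (incl (A top)) chi.
Proof.
by rewrite -[f]mcompm1 -pc [mcomp f _]mcompA fpsi -mcompA mcompA jw mcomp1m.
Qed.

Lemma Y_pushout (l : lt o0 top) :
  is_pushout (mcomp psi (s2m (restm (n l)))) (incl Vh) f (mcomp w (s2m (n l))).
Proof.
have incl_n : mcomp (incl (A top)) (s2m (restm (n l))) = mcomp (s2m (n l)) (incl Vh).
  exact: mor_eq.
apply/pushoutP; split=> // [|Z cZ p' q' e].
  by rewrite mcompA fpsi -!mcompA incl_n.
have e0 s : m0 p' (m0 psi s) = m0 q' (Some s) by exact: (congr1 (fun h : mor V Z => m0 h s) e).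
have [|//|x xE] := @pin_cast Z _ _ (m0 p' (m0 psi g)) (m0 q' None)
    (@m1 _ _ q' (Some g) None (eta o0 false)); first by rewrite e0.
have [//||y yE] := @pin_cast Z _ _ (m0 q' None) (m0 p' (m0 psi b))
    (@m1 _ _ q' None (Some b) (eta o0 true)); first by rewrite e0.
have [|H [H1 H2 H3 H4 H5]] := @edge_pushout top Z (mcomp p' psi) (m0 q' None) x y.
  apply: pin_inj; rewrite (pin_comp xE yE) -m1_comp.
  rewrite -(epath_n n_eta l).
  by rewrite -[LHS]/(pmap (mcomp p' (mcomp psi (s2m (restm (n l))))) (@pin V _ _ (epath (eta o0)))) e.
exists (mcomp H j); split.
- by rewrite -mcompA jf mcompA H1 -mcompA pc mcompm1.
- rewrite -mcompA [mcomp j _]mcompA jw mcomp1m.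
  have [|K [_ _ _ _ K5]] := @edge_pushout o0 Z (mcomp q' (incl Vh)) (m0 q' None)
    (@m1 _ _ q' (Some g) None (eta o0 false)) (@m1 _ _ q' None (Some b) (eta o0 true)).
    exact: (m1_comp q').
  rewrite (K5 q') // (K5 (mcomp H (s2m (n l)))) //.
  + by rewrite -mcompA -incl_n mcompA H1 -mcompA.
  + by rewrite -xE -H3 /= (n_eta l false).
  + by rewrite -yE -H4 /= (n_eta l true).
- move=> h' e1 e2.
  rewrite -[h']mcompm1 -wj mcompA; congr mcomp; apply: H5.
  + by rewrite -mcompA -fpsi mcompA e1.
  + by rewrite -[in RHS]e2.
  + by rewrite xE -e2 /= (n_eta l false).
  + by rewrite yE -e2 /= (n_eta l true).
Qed.

Lemma assembly : exists (U V : flow) (g : mor U V) (k : mor V X),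
    meq (mcomp k (mcomp g (empty_mor U))) (empty_mor X) /\
    (exists (c : mor (glob (Sphere 0)) U) (d : mor (glob (Disk 0)) V),
       is_pushout (glob_incl 0) c d g /\
       exists phi : mor (glob (Disk 0)) IxI,
         m0 phi false = (ord0 : 'I_3) /\ m0 phi true = (ord_max : 'I_3) /\
         exists (Vh : flow) (m : mor V Vh) (n : mor IxI Vh),
           is_pushout phi d n m /\
           exists w : mor Vh Y, is_pushout k m f w) /\
    rel_cell Ig (empty_mor U) /\ rel_cell Ig k.
Proof.
have l : lt o0 top by have [|//] := top_max o0.
have [c [d [po1 d0 d1 dE]]] := V_pushout.
have [phi [ph0 ph1 [n' po2]]] := Vh_pushout d0 d1 dE.
exists (set_flow S), V, (set_to (Z := V) id), (mcomp psi (s2m (restm (n l)))).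
split; first by apply: meq_refl; exact: set_flow_eq.
split.
  exists c, d; split=> //; exists phi; do 2 split=> //.
  exists Vh, (incl Vh), n'; split=> //.
  by exists (mcomp w (s2m (n l))); exact: Y_pushout.
split; first exact: rel_cell_discrete g.
apply: (@rel_cell_reindex S O lt o0 top wo top_max (fun o => restS (A o))
  (fun o1 o2 l => restm (n l)) _ _ _ _ X psi).
- by move=> o; apply: scg_restS.
- by move=> o1 o2 o3 h12 h23 h13; rewrite -(nD h12 h23 h13); exact: smor_eq.
- exact: (restriction_succ wo cA n_eta base succ lim).
- exact: (restriction_lim wo cA n_eta base succ lim).
- exact: cX.
- by exists chi; split; apply: meq_refl.
- by move=> l'; rewrite (Prop_irrelevance l' l).
- exact: top_n0.
Qed.

End Assembly.

Lemma cg_cell_flow (X : flow) : cell_flow X -> cg_flow X.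
Proof. by move/cell_flow_tower => [t <-]; exact: tcg. Qed.

Lemma restr_mor_eq (W Y : flow) (P : fst_ Y -> Prop) (a b : mor W (restr P)) :
  (forall x, sval (m0 a x) = sval (m0 b x)) ->
  (forall x y (z : fP W x y), @pin Y _ _ (m1 a z) = @pin Y _ _ (m1 b z)) -> a = b.
Proof.
case: a b => a0 a1 ac am [b0 b1 bc bm] /= e0 e1.
have {}e0 : a0 = b0 by apply: funext => x; apply: sig_eq; exact: e0.
subst b0; apply: mor_eq; split=> //= x y z; congr pin; apply: (@pin_inj Y); exact: e1.
Qed.

Lemma corestr_factor (W X Y : flow) (f : mor X Y) (h : mor W Y) :
  is_iso (corestr f) -> (forall x, image_of f (m0 h x)) -> exists h' : mor W X, mcomp f h' = h.
Proof.
move=> [g [_ /mor_eq fg]] him.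
pose h1 : mor W (restr (image_of f)) :=
  @Mor W (restr (image_of f)) (fun x => exist _ (m0 h x) (him x)) (fun a b x => m1 h x)
    (fun a b => @m1_cont _ _ h a b) (fun a b c => @m1_comp _ _ h a b c).
exists (mcomp g h1).
have e : mcomp (corestr f) (mcomp g h1) = h1 by rewrite mcompA fg mcomp1m.
apply: mor_eq; split=> [x|x y z].
  exact: (congr1 (fun k : mor W (restr (image_of f)) => sval (m0 k x)) e).
have := congr1 (fun k : mor W (restr (image_of f)) => pmap k (pin z)) e.
rewrite /pmap /=; move: (m1 _ _) => u.
move/(congr1 (fun v : Ptot (restr (image_of f)) => @pin Y _ _ (projT2 v))).
exact.
Qed.

Lemma corestr_mono (W X Y : flow) (f : mor X Y) (a b : mor W X) :
  is_iso (corestr f) -> mcomp f a = mcomp f b -> a = b.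
Proof.
move=> [g [/mor_eq gf _]] e; rewrite -[a]mcomp1m -[b]mcomp1m -gf -!mcompA; congr mcomp.
apply: restr_mor_eq => [x|x y z] /=.
  exact: (congr1 (fun k : mor W Y => m0 k x) e).
exact: (congr1 (fun k : mor W Y => pmap k (pin z)) e).
Qed.

Section Factorization.
Variables (t : tower) (X : flow).
Local Notation Y := (tF (ttop t)).
Variables (f : mor X Y) (alpha : fst_ Y).
Hypothesis cX : cg_flow X.
Hypothesis hT : T_homotopy_equiv f.
Hypothesis nalpha : ~ image_of f alpha.
Hypothesis cover : forall y, image_of f y \/ y = alpha.

Let S := fst_ X.

Definition kappa (y : fst_ Y) : option S :=
  if pselect (image_of f y) is left e then Some (sval (cid e)) else None.

Definition theta (s : option S) : fst_ Y := if s is Some s then m0 f s else alpha.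

Lemma theta_kappa y : theta (kappa y) = y.
Proof.
rewrite /kappa; case: pselect => [e|ne] /=; first exact: svalP (cid e).
by case: (cover y).
Qed.

Lemma f_inj : injective (m0 f).
Proof.
case: hT => -[g [/mor_eq gf _]] _ _ x y e.
have h z : m0 g (m0 (corestr f) z) = z by exact: (congr1 (fun k : mor X X => m0 k z) gf).
rewrite -(h x) -(h y) /=; congr (m0 g _); exact: sig_eq.
Qed.

Lemma theta_inj : injective theta.
Proof.
move=> [x|] [y|] //= e; first by rewrite (f_inj e).
  by case: nalpha; exists x.
by case: nalpha; exists y.
Qed.

Lemma kappa_theta s : kappa (theta s) = s.
Proof. by apply: theta_inj; rewrite theta_kappa. Qed.

Lemma kappa_alpha y : kappa y = None <-> y = alpha.
Proof.
split=> [e|->]; first by rewrite -(theta_kappa y) e.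
exact: (kappa_theta None).
Qed.

Lemma reaches_alpha b : exists u : Ptot Y, pend b u = alpha /\ pend (~~ b) u <> alpha.
Proof.
case: hT => _ _ /(_ alpha Logic.I) [//|[g1 [g2 [h1 h2 h3 h4]]]].
by case: b; [exists g1 | exists g2]; split=> //= e; apply: nalpha; rewrite -e.
Qed.

Lemma isE_cm (p q : bool -> tO t) (c : forall b, gcell (p b) (q b)) b o (u : Ptot (tF o)) :
  isE c b u -> pmap (cm o) u = pmap (cm (q b)) (ecell c b).
Proof.
case=> [[e ->]|[l ->]]; first by subst o.
by rewrite -[LHS]/(pmap (mcomp (cm o) (tmap l)) (ecell c b)) cm_map.
Qed.

Lemma isE_top (p q : bool -> tO t) (c : forall b, gcell (p b) (q b)) b :
  isE c b (pmap (cm (q b)) (ecell c b)).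
Proof.
have [e|l] := ttop_max (q b).
  have H o (v : Ptot (tF o)) : o = ttop t -> isE c b v -> isE c b (pmap (cm o) v).
    by move=> e'; subst o; rewrite cm_top; case: v => -[a a'] x.
  by apply: H => //; exact: isE_here.
have -> : cm (q b) = tmap l by rewrite -(cm_map l) cm_top mcomp1m.
by apply: isE_map; exact: isE_here.
Qed.

Lemma factorization : exists (U V : flow) (g : mor U V) (k : mor V X),
    meq (mcomp k (mcomp g (empty_mor U))) (empty_mor X) /\
    (exists (c : mor (glob (Sphere 0)) U) (d : mor (glob (Disk 0)) V),
       is_pushout (glob_incl 0) c d g /\
       exists phi : mor (glob (Disk 0)) IxI,
         m0 phi false = (ord0 : 'I_3) /\ m0 phi true = (ord_max : 'I_3) /\
         exists (Vh : flow) (m : mor V Vh) (n : mor IxI Vh),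
           is_pushout phi d n m /\
           exists w : mor Vh Y, is_pushout k m f w) /\
    rel_cell Ig (empty_mor U) /\ rel_cell Ig k.
Proof.
have [hiso hsing _] := hT; have [hm hp] := hsing _ nalpha.
have [p [q [c [c_sel c_dim c_al c_nal c_un]]]] := edges_exist hm hp reaches_alpha.
have some_end b : exists s, kappa (cend (c b) b) = Some s.
  case E : (kappa _) => [s|]; first by exists s.
  by case: (c_nal b); exact/kappa_alpha.
have [gam gamE] := some_end false; have [bet betE] := some_end true.
have c_src b : kappa (cend (c b) false) = es gam b.
  by case: b => //=; exact/kappa_alpha/(c_al true).
have c_tgt b : kappa (cend (c b) true) = et bet b.
  by case: b => //=; exact/kappa_alpha/(c_al false).
have c_other (o1 o2 : tO t) (c' : gcell o1 o2) : sel o1 o2 = Some c' ->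
    (forall b, o1 <> p b) -> forall b, kappa (cend c' b) <> None.
  move=> E np b /kappa_alpha e; apply: (np (~~ b)).
  by apply: (c_un _ _ _ _ E); rewrite negbK.
pose A := Nst gam bet kappa c.
pose n o1 o2 (l : tlt o1 o2) : smor (A o1) (A o2) := Nmap c_src c_tgt l.
pose et' o i : sP (A o) (es gam i) (et bet i) := eta gam bet kappa c o i.
pose j : mor Y (A (ttop t)) := jN gam bet kappa c (ttop t).
have j0 y : m0 j y = kappa y by rewrite /j /= /kst cm_top.
have [h [h0 hE]] := @mor_pull_gen Y Y _ kappa theta (idmor Y) (fun a => esym (theta_kappa a)).
have cP : scg (pull theta) by apply: scg_pull; exact: tcg.
have [ep epE] : exists ep : forall b, sP (pull theta) (es gam b) (et bet b),
    forall b, @pin (pull theta) _ _ (ep b) = pmap h (pmap (cm (q b)) (ecell c b)).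
  have H b : exists e : sP (pull theta) (es gam b) (et bet b),
      @pin (pull theta) _ _ e = pmap h (pmap (cm (q b)) (ecell c b)).
    by apply: (@pin_cast (pull theta)); rewrite h0; [exact: c_src | exact: c_tgt].
  by exists (fun b => sval (cid (H b))) => b; exact: svalP (cid (H b)).
have [||H [H1 H2]] := @Nst_univ t S gam bet kappa p q c (ttop t) (pull theta) h ep cP.
- by move=> y; rewrite h0 /kst cm_top.
- by move=> b u hu; rewrite epE -(isE_cm hu) cm_top; congr pmap; case: u {hu} => -[a a'] x.
pose w : mor (A (ttop t)) Y := mcomp (unpull theta) (s2m H).
have wj : mcomp w j = idmor _ by rewrite /w -mcompA H1 hE.
have jw : mcomp j w = idmor _.
  have [|K KE] := @mor_smor _ (A (ttop t)) (A (ttop t)) (mcomp j w).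
    by move=> s; rewrite -[LHS]/(m0 j (theta s)) j0 kappa_theta.
  rewrite -KE -s2m_id; congr s2m; apply: Nst_uniq => [|b].
    by rewrite KE -mcompA wj mcompm1 s2m_id mcomp1m.
  apply: (@pin_inj (A (ttop t))).
  rewrite -[LHS]/(pmap (s2m K) (@pin (A (ttop t)) _ _ (et' (ttop t) b))) KE.
  rewrite -[LHS]/(pmap j (pmap (unpull theta) (@pin (pull theta) _ _ (H _ _ (et' (ttop t) b))))) H2 epE.
  rewrite -[pmap (unpull theta) _]/(pmap (mcomp (unpull theta) h) (pmap (cm (q b)) (ecell c b))) hE.
  rewrite (_ : pmap (idmor _) _ = pmap (cm (q b)) (ecell c b)) //.
  exact: (jN_edge c_src c_tgt (isE_top c b)).
have [psi psiE] := @corestr_factor _ _ _ f (mcomp w (incl (A (ttop t)))) hiso (fun s => ex_intro _ s erefl).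
have [chi [chi0 chiE]] := @mor_pull_gen X (A (ttop t)) S id Some (mcomp j f) (fun x => etrans (j0 _) (kappa_theta (Some x))).
have pc : mcomp psi chi = idmor _.
  apply: (corestr_mono hiso); rewrite mcompA psiE -mcompA -[mcomp (incl _) chi]/(mcomp (unpull _) chi) chiE.
  by rewrite mcompA wj mcomp1m mcompm1.
have cp : mcomp chi psi = idmor _.
  apply: (@unpull_mono _ (A (ttop t)) S Some); first by move=> ? ? [].
  by rewrite mcompA chiE -mcompA psiE mcompA jw mcomp1m mcompm1.
apply: (@assembly S gam bet (tO t) (@tlt t) (t0 t) (ttop t) (twf t) (@ttop_max t) _ A n et'
  _ _ _ _ _ _ X Y f cX (@tcg t _) w j psi chi wj jw pc cp psiE).
- by move=> e; have a := alpha; rewrite -e in a; case: (tempty a).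
- by move=> o; exact: scg_Nst.
- by move=> o1 o2 l i; exact: Nmap_eta.
- by move=> o1 o2 o3 h12 h23 h13; exact: NmapD.
- by move=> Z eZ cZ; exact: Nst_base.
- by move=> o1 o2 l s; exact: Nst_succ.
- by move=> o l; exact: Nst_lim.
Qed.

End Factorization.

Theorem theorem8p1 (X Y : flow) (f : mor X Y) (alpha : fst_ Y) :
  cell_flow X -> cell_flow Y -> T_homotopy_equiv f ->
  (* Y^0 = f(X^0) \sqcup {alpha} *)
  ~ image_of f alpha -> (forall y : fst_ Y, image_of f y \/ y = alpha) ->
  exists (U V : flow) (g : mor U V) (k : mor V X),
    (* the factorization  empty -> u_f(X) -> v_f(X) -> X  of  empty -> X *)
    meq (mcomp k (mcomp g (empty_mor U))) (empty_mor X) /\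
    (* (1) *)
    (exists (c : mor (glob (Sphere 0)) U) (d : mor (glob (Disk 0)) V),
       is_pushout (glob_incl 0) c d g /\
       exists phi : mor (glob (Disk 0)) IxI,
         m0 phi false = (ord0 : 'I_3) /\ m0 phi true = (ord_max : 'I_3) /\
         exists (Vh : flow) (m : mor V Vh) (n : mor IxI Vh),
           is_pushout phi d n m /\
           exists w : mor Vh Y, is_pushout k m f w) /\
    (* (2) *)
    rel_cell Ig (empty_mor U) /\ rel_cell Ig k.
Proof.
move=> /cg_cell_flow cX /cell_flow_tower [t e]; subst Y => hT na cov.
exact: (factorization cX hT na cov).
Qed.
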